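(* Let $q_1,\dots,q_m\in\mathbb{R}[x]$ be polynomials in $x=(x_1,\dots,x_n)$. Define $q\colon\mathbb{R}^n\to\mathbb{R}^m$, $a\mapsto(q_1(a),\dots,q_m(a))$, let $C=\overline{\mathrm{cc}}(q(\mathbb{R}^n))\subseteq\mathbb{R}^m$ be the closure of the conic hull of $q(\mathbb{R}^n)$, assumed to be a proper convex cone, and for $t\geqslant 1$ let $$V_t:=\Big\{\sum_{i=1}^m q_i A_i : A_1,\dots,A_m\in\mathrm{Her}_t(\mathbb{C})\Big\},$$ a space of Hermitian $t\times t$ matrix polynomials. Assume that for some $t\in\mathbb{N}$ there exists a homogeneous Hermitian matrix polynomial $H\in V_t$ which is globally positive semidefinite (i.e. $H(a)\in\mathrm{Psd}_t(\mathbb{C})$ for all $a\in\mathbb{R}^n$), which is not a sum of squares of matrix polynomials, and such that for all $u\in\mathbb{R}^n$ the translate $H_u(x):=H(x-u)$ is also contained in $V_t$. Then $C^{\mathrm{min}}$ has no $P^d$-lift, for any $d\geqslant 1$.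
   Context: All vector spaces are real and equipped with the finest locally convex topology (the usual one on finite-dimensional spaces). $\mathrm{Her}_s(\mathbb{C})$ is the real vector space of complex Hermitian $s\times s$ matrices and $\mathrm{Psd}_s(\mathbb{C})$ its cone of positive semidefinite matrices. A convex cone is proper if it is pointed ($C\cap -C=\{0\}$), closed and has non-empty interior. A Hermitian matrix polynomial is a sum of squares of matrix polynomials if it is a finite sum $\sum_k P_k^*P_k$ of Hermitian squares, where the $P_k$ are (not necessarily square) matrices with $t$ columns and entries in $\mathbb{C}[x]$, and the variables $x_i$ are treated as self-adjoint (real). An (abstract) operator system $S$ on a vector space $X$ consists of a proper convex cone $S_s\subseteq X\otimes\mathrm{Her}_s(\mathbb{C})$ for each $s\geqslant 1$, such that for all $s,t$ and all $V\in\mathrm{Mat}_{s,t}(\mathbb{C})$ the map $\mathrm{id}_X\otimes(V^*\cdot V)\colon X\otimes\mathrm{Her}_s(\mathbb{C})\to X\otimes\mathrm{Her}_t(\mathbb{C})$ maps $S_s$ into $S_t$. The operator system $P^d$ on $\mathrm{Her}_d(\mathbb{C})$ is given by $(P^d)_s=\mathrm{Psd}_{ds}(\mathbb{C})\subseteq \mathrm{Her}_d(\mathbb{C})\otimes\mathrm{Her}_s(\mathbb{C})=\mathrm{Her}_{ds}(\mathbb{C})$. For a proper cone $C\subseteq X$, $C^{\mathrm{min}}$ denotes the smallest operator system $S$ on $X$ with base cone $S_1=C$. For a linear map $\phi\colon X\to Y$ and $a\in X\otimes\mathrm{Her}_s(\mathbb{C})$ write $\phi[a]:=(\phi\otimes\mathrm{id}_{\mathrm{Her}_s(\mathbb{C})})(a)$.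 For operator systems $S$ on $X$ and $T$ on $Y$, a $T$-lift of $S$ is a pair $(\pi,\gamma)$ of linear maps $\pi\colon Z\to X$, $\gamma\colon Z\to Y$, for some vector space $Z$, with $\gamma$ injective and $S=\pi[\gamma^{-1}[T]]$ levelwise, i.e. for all $s\geqslant 1$: $S_s=\{\pi[c] : c\in Z\otimes\mathrm{Her}_s(\mathbb{C}),\ \gamma[c]\in T_s\}$. *)

(* Defs.v *)
From HB Require Import structures.
From mathcomp Require Import all_boot all_order all_algebra.
From mathcomp Require Import spectral sesquilinear.
From mathcomp Require Import all_classical all_reals all_analysis.
From mathcomp Require Import complex mxtens.
From mathcomp Require Import -(notations) mpoly.
From mathcomp Require Import ring lra.

Set Implicit Arguments.
Unset Strict Implicit.
Unset Printing Implicit Defensive.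

Import Order.TTheory GRing.Theory Num.Theory.
Import numFieldNormedType.Exports.

Local Open Scope classical_set_scope.
Local Open Scope ring_scope.
Local Open Scope complex_scope.
Local Open Scope sesquilinear_scope.

Local Notation Re := complex.Re.
Local Notation Im := complex.Im.

(** [flc X] is a copy of the real vector space [X] carrying the finest locally
    convex topology: the convex absorbing sets
    form a base of neighbourhoods of [0]. *)

Definition flc (T : Type) : Type := T.

Section FinestLocallyConvex.
Context {R : realType} {X : lmodType R}.

Definition cvx_subset (W : set X) : Prop :=
  forall x y (l : R), W x -> W y -> 0 <= l <= 1 -> W (l *: x + (1 - l) *: y).

Definition absorbing (W : set X) : Prop :=
  forall x, exists2 e : R, 0 < e & forall l : R, `|l| <= e -> W (l *: x).

Definition flc_open (A : set X) : Prop :=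
  forall a, A a -> exists W : set X,
    [/\ cvx_subset W, absorbing W & forall w, W w -> A (a + w)].

Lemma flc_openT : flc_open setT.
Proof.
by move=> a _; exists setT; split=> // x; exists 1.
Qed.

Lemma flc_openI : setI_closed flc_open.
Proof.
move=> A B oA oB a [/oA[V [cV aV VA]] /oB[W [cW aW WB]]].
exists (V `&` W); split.
- by move=> x y l [? ?] [? ?] l01; split; [exact: cV | exact: cW].
- move=> x; have [e e0 Ve] := aV x; have [f f0 Wf] := aW x.
  exists (Num.min e f); first by rewrite lt_min e0.
  by move=> l; rewrite le_min => /andP[le lf]; split; [exact: Ve|exact: Wf].
- by move=> w [? ?]; split; [exact: VA|exact: WB].
Qed.

Lemma flc_open_bigU (I : Type) (f : I -> set X) :
  (forall i, flc_open (f i)) -> flc_open (\bigcup_i f i).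
Proof.
move=> of_ a [i _ /of_[W [cW aW Wf]]]; exists W; split=> // w Ww.
by exists i => //; exact: Wf.
Qed.

End FinestLocallyConvex.

HB.instance Definition _ (R : realType) (X : lmodType R) :=
  Choice.on (flc X).
HB.instance Definition _ (R : realType) (X : lmodType R) :=
  isOpenTopological.Build (flc X) (@flc_openT R X) (@flc_openI R X)
    (@flc_open_bigU R X).

Lemma flc_openE (R : realType) (X : lmodType R) (A : set X) :
  open (A : set (flc X)) = flc_open A.
Proof. by []. Qed.

Lemma cvx_subset_mean (R : realType) (X : lmodType R) (W : set X) k
    (p : 'I_k.+1 -> X) :
  cvx_subset W -> (forall i, W (p i)) -> W (k.+1%:R^-1 *: \sum_i p i).
Proof.
move=> cW; elim: k p => [|k ih] p Wp.
  by rewrite big_ord_recl big_ord0 addr0 invr1 scale1r.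
rewrite big_ord_recr/= scalerDr.
have := cW _ _ (k.+1%:R / k.+2%:R) (ih _ (fun i => Wp (widen_ord (leqnSn _) i)))
  (Wp ord_max).
rewrite scalerA -mulrA (mulrC k.+2%:R^-1) mulrA divff ?pnatr_eq0// mul1r.
have -> : 1 - k.+1%:R / k.+2%:R = k.+2%:R^-1 :> R.
  by rewrite -{1}(@divff _ k.+2%:R) ?pnatr_eq0// -mulrBl -natrB// subSnn div1r.
apply; rewrite divr_ge0//= ler_pdivrMr ?ltr0n// mul1r ler_nat.
exact: leqnSn.
Qed.

(** On [R^m] this is the usual topology. *)
Lemma flc_open_rVE (R : realType) m (A : set 'rV[R]_m) :
  open (A : set (flc 'rV[R]_m)) = open A.
Proof.
rewrite flc_openE; apply/propext; split => [oA|].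
  rewrite openE => a /oA[W [cW aW WA]]; rewrite /interior.
  have [e e0 We] : exists2 e : R, 0 < e &
      forall j l, `|l| <= e -> W (l *: delta_mx (0 : 'I_1) j).
    have /choice[f fP] : forall j, exists e : R, 0 < e /\
        forall l, `|l| <= e -> W (l *: delta_mx (0 : 'I_1) j).
      by move=> j; have [e e0 We] := aW (delta_mx 0 j); exists e.
    exists (\big[Num.min/1]_j f j).
      by apply: (big_ind (fun x => 0 < x)) => // [x y x0 y0|j _]; rewrite ?lt_min ?x0//; case: (fP j).
    move=> j l le; apply: (fP j).2; apply: (le_trans le).
    by rewrite (bigD1 j)//= ge_min lexx.
  case: m A oA a W cW aW WA We => [|m] A oA a W cW aW WA We.
    have W0 : W 0 by have [f f0] := aW 0; move/(_ 0); rewrite scale0r normr0; apply; exact: ltW.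
    exists (fun _ _ => setT); first by move=> *; exact: filterT.
    by move=> b _; rewrite (_ : b = a + 0); [exact: WA | apply/matrixP => ? []].
  exists (fun j k => ball (a j k) (e / m.+1%:R)).
    by move=> j k; apply: nbhsx_ballx; rewrite divr_gt0.
  move=> b /= ab; rewrite -(subrK a b) addrC; apply: WA.
  rewrite [b - a]matrix_sum_delta big_ord1.
  rewrite -[X in W X]scale1r -(@mulVf _ m.+1%:R) ?pnatr_eq0// -scalerA scaler_sumr.
  apply: cvx_subset_mean => // j; rewrite scalerA; apply: We.
  have := ab 0 j; rewrite /ball/= !mxE distrC ltr_pdivlMr// => /ltW.
  by rewrite normrM (ger0_norm (ler0n _ _)) mulrC.
rewrite openE => oA a /oA [P Pa PA].
have /choice[f fP] : forall j, exists e : R, 0 < e /\ ball (a 0 j) e `<=` P 0 j.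
  by move=> j; have /nbhs_ballP[e e0 eP] := Pa 0 j; exists e.
exists [set w : 'rV[R]_m | forall j, `|w 0 j| < f j]; split.
- move=> x y l xf yf /andP[l0 l1] j; rewrite !mxE.
  have l1' : 0 <= 1 - l by rewrite subr_ge0.
  apply: (le_lt_trans (ler_normD _ _)).
  rewrite !normrM (ger0_norm l0) (ger0_norm l1').
  have -> : f j = l * f j + (1 - l) * f j by rewrite -mulrDl addrC subrK mul1r.
  have := ler_wpM2l l0 (ltW (xf j)); have := ler_wpM2l l1' (ltW (yf j)).
  move: l0; rewrite le_eqVlt => /orP[/eqP <-|l0].
    by rewrite subr0 !mul0r !mul1r !add0r => _ _; exact: yf.
  by move=> h _; rewrite ltr_leD// ltr_pM2l.
- move=> x; set S := 1 + \sum_j `|x 0 j|.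
  have S0 : 0 < S by rewrite ltr_pwDl// sumr_ge0.
  have xS j : `|x 0 j| < S.
    rewrite /S (bigD1 j)//= addrCA ltrDl ltr_pwDl// sumr_ge0//.
  have m0 : 0 < \big[Num.min/1]_j f j.
    by apply: (big_ind (fun x => 0 < x)) => // [u v u0 v0|j _]; rewrite ?lt_min ?u0//; case: (fP j).
  exists (\big[Num.min/1]_j f j / S); first by rewrite divr_gt0.
  move=> l; rewrite ler_pdivlMr// => lS j; rewrite mxE normrM.
  have [->|l0] := eqVneq l 0; first by rewrite normr0 mul0r; case: (fP j).
  apply: (@lt_le_trans _ _ (`|l| * S)); first by rewrite ltr_pM2l ?normr_gt0.
  by apply: (le_trans lS); rewrite (bigD1 j)//= ge_min lexx.
- move=> w wf; apply: PA => j k; rewrite (ord1 j); apply: (fP k).2.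
  by rewrite /ball/= !mxE opprD addNKr normrN.
Qed.

Section Cones.
Context {R : realType} {X : lmodType R}.

Definition convex_cone (C : set X) : Prop :=
  [/\ C 0, forall x y, C x -> C y -> C (x + y)
    & forall (l : R) x, 0 <= l -> C x -> C (l *: x)].

Definition proper_cone (C : set X) : Prop :=
  [/\ convex_cone C,
      C `&` [set x | C (- x)] = [set 0],
      closed (C : set (flc X))
    & (C : set (flc X))° !=set0].

Definition conic_hull (A : set X) : set X :=
  [set x | exists k (l : 'I_k -> R) (p : 'I_k -> X),
     [/\ forall i, 0 <= l i, forall i, A (p i) & x = \sum_i l i *: p i]].

End Cones.

(** [herm X s] stands for the tensor product of [X] and [Her_s(C)]: the
    Hermitian [s * s] matrices over the complexification [X[i]] of [X].
    In particular [herm R^o s] is [Her_s(C)]. *)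

Definition hermitianb (X : zmodType) s (a : 'M[X[i]]_s) : bool :=
  [forall j, forall k, a k j == Re (a j k) -i* Im (a j k)].

Record herm (X : zmodType) s :=
  Herm { hmx : 'M[X[i]]_s; _ : hermitianb hmx }.

HB.instance Definition _ (X : zmodType) s := [isSub for @hmx X s].
HB.instance Definition _ (X : zmodType) s := [Choice of herm X s by <:].

Section HermModule.
Context {X : zmodType} {s : nat}.
Implicit Types a b : herm X s.

Lemma hermRe a j k : Re (hmx a k j) = Re (hmx a j k).
Proof. by case: a => a /= /forallP/(_ j)/forallP/(_ k)/eqP ->. Qed.

Lemma hermIm a j k : Im (hmx a k j) = - Im (hmx a j k).
Proof. by case: a => a /= /forallP/(_ j)/forallP/(_ k)/eqP ->. Qed.

Lemma eq_herm a b : (forall j k, Re (hmx a j k) = Re (hmx b j k)) ->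
  (forall j k, Im (hmx a j k) = Im (hmx b j k)) -> a = b.
Proof.
move=> eR eI; apply/val_inj/matrixP => j k /=.
by move: (eR j k) (eI j k); case: (hmx a j k) (hmx b j k) => [? ?] [? ?] /= -> ->.
Qed.

Lemma mkherm_subproof (P Q : 'I_s -> 'I_s -> X) :
  (forall j k, P k j = P j k) -> (forall j k, Q k j = - Q j k) ->
  hermitianb (\matrix_(j, k) (P j k +i* Q j k)).
Proof.
by move=> hP hQ; apply/forallP => j; apply/forallP => k; rewrite !mxE/= hP hQ.
Qed.

Definition herm0 : herm X s :=
  Herm (@mkherm_subproof (fun _ _ => 0) (fun _ _ => 0)
    (fun _ _ => erefl) (fun _ _ => esym (oppr0 _))).

Lemma oppherm_subproof a : hermitianb
  (\matrix_(j, k) ((- Re (hmx a j k)) +i* (- Im (hmx a j k)))).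
Proof.
by apply: mkherm_subproof => j k; rewrite ?(hermRe a j) ?(hermIm a j).
Qed.
Definition oppherm a : herm X s := Herm (oppherm_subproof a).

Lemma addherm_subproof a b : hermitianb
  (\matrix_(j, k) ((Re (hmx a j k) + Re (hmx b j k)) +i*
                   (Im (hmx a j k) + Im (hmx b j k)))).
Proof.
by apply: mkherm_subproof => j k;
  rewrite ?(hermRe _ j) ?(hermIm _ j) ?opprD.
Qed.
Definition addherm a b : herm X s := Herm (addherm_subproof a b).

Fact addhermA : associative addherm.
Proof. by move=> a b c; apply: eq_herm => j k; rewrite !mxE/= addrA. Qed.
Fact addhermC : commutative addherm.
Proof. by move=> a b; apply: eq_herm => j k; rewrite !mxE/= addrC. Qed.
Fact add0herm : left_id herm0 addherm.
Proof. by move=> a; apply: eq_herm => j k; rewrite !mxE/= add0r. Qed.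
Fact addNherm : left_inverse herm0 oppherm addherm.
Proof. by move=> a; apply: eq_herm => j k; rewrite !mxE/= addNr. Qed.

HB.instance Definition _ := GRing.isZmodule.Build (herm X s)
  addhermA addhermC add0herm addNherm.

End HermModule.

Section HermLmodule.
Context {R : realType} {X : lmodType R} {s : nat}.
Implicit Types a b : herm X s.

Lemma scaleherm_subproof (l : R) a : hermitianb
  (\matrix_(j, k) ((l *: Re (hmx a j k)) +i* (l *: Im (hmx a j k)))).
Proof.
by apply: mkherm_subproof => j k; rewrite ?(hermRe _ j) ?(hermIm _ j) ?scalerN.
Qed.
Definition scaleherm (l : R) a : herm X s := Herm (scaleherm_subproof l a).

Fact scalehermA l1 l2 a : scaleherm l1 (scaleherm l2 a) = scaleherm (l1 * l2) a.
Proof. by apply: eq_herm => j k; rewrite !mxE/= scalerA. Qed.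
Fact scale1herm : left_id 1 scaleherm.
Proof. by move=> a; apply: eq_herm => j k; rewrite !mxE/= scale1r. Qed.
Fact scalehermDr : right_distributive scaleherm +%R.
Proof. by move=> l a b; apply: eq_herm => j k; rewrite !mxE/= scalerDr. Qed.
Fact scalehermDl a : {morph scaleherm^~ a : l1 l2 / l1 + l2}.
Proof. by move=> l1 l2; apply: eq_herm => j k; rewrite !mxE/= scalerDl. Qed.

HB.instance Definition _ := GRing.Zmodule_isLmodule.Build R (herm X s)
  scalehermA scale1herm scalehermDr scalehermDl.

End HermLmodule.

Notation "''Her[' R ]_ s" := (herm R^o s)
  (at level 0, s at level 2, format "''Her[' R ]_ s") : type_scope.

Definition Her_mx (R : realType) s (A : 'Her[R]_s) : 'M[R[i]]_s := hmx A.

Lemma Her_mx_hermsym (R : realType) s (A : 'Her[R]_s) : Her_mx A \is hermsymmx.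
Proof.
apply/is_hermitianmxP; rewrite expr0 scale1r; apply/matrixP => j k.
rewrite !mxE /Her_mx; have := hermRe A k j; have := hermIm A k j.
by case: (hmx A j k) (hmx A k j) => [? ?] [? ?] /= -> ->.
Qed.

Section PureTensors.
Context {R : realType} {X : lmodType R} {s : nat}.

Lemma ptens_subproof (x : X) (A : 'Her[R]_s) : hermitianb
  (\matrix_(j, k) ((Re (hmx A j k) *: x) +i* (Im (hmx A j k) *: x))).
Proof.
by apply: mkherm_subproof => j k; rewrite ?(hermRe _ j) ?(hermIm _ j) ?scaleNr.
Qed.
Definition ptens (x : X) (A : 'Her[R]_s) : herm X s := Herm (ptens_subproof x A).

Lemma Re_herm_sum I (r : seq I) (P : pred I) (F : I -> herm X s) j k :
  Re (hmx (\sum_(i <- r | P i) F i) j k) = \sum_(i <- r | P i) Re (hmx (F i) j k).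
Proof.
by apply: (big_morph (fun a => Re (hmx a j k))) => [a b|]; rewrite mxE.
Qed.

Lemma Im_herm_sum I (r : seq I) (P : pred I) (F : I -> herm X s) j k :
  Im (hmx (\sum_(i <- r | P i) F i) j k) = \sum_(i <- r | P i) Im (hmx (F i) j k).
Proof.
by apply: (big_morph (fun a => Im (hmx a j k))) => [a b|]; rewrite mxE.
Qed.

End PureTensors.

Section UniversalProperty.
Context {R : realType} {s : nat}.

Lemma herm_re_subproof (j k : 'I_s) : hermitianb (\matrix_(p, q)
  ((((p == j) && (q == k))%:R + ((p == k) && (q == j))%:R : R^o) +i* 0)).
Proof.
by apply: mkherm_subproof => p q; rewrite ?oppr0// addrC (andbC (q == k)) (andbC (q == j)).
Qed.
Definition herm_re j k : 'Her[R]_s := Herm (herm_re_subproof j k).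

Lemma herm_im_subproof (j k : 'I_s) : hermitianb (\matrix_(p, q)
  (0 +i* (((p == j) && (q == k))%:R - ((p == k) && (q == j))%:R : R^o))).
Proof.
by apply: mkherm_subproof => p q; rewrite // opprB (andbC (q == k)) (andbC (q == j)).
Qed.
Definition herm_im j k : 'Her[R]_s := Herm (herm_im_subproof j k).

Lemma sum_pick (V : lmodType R) (p q : 'I_s) (F : 'I_s -> 'I_s -> V) :
  \sum_j \sum_k ((p == j) && (q == k))%:R *: F j k = F p q.
Proof.
rewrite (bigD1 p)//= [X in _ + X]big1 => [|j /negPf jp]; last first.
  by rewrite big1// => k _; rewrite eq_sym jp scale0r.
rewrite addr0 (bigD1 q)//= big1 => [|k /negPf kq]; last first.
  by rewrite (eq_sym q) kq andbF scale0r.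
by rewrite !eqxx scale1r addr0.
Qed.

Lemma herm_decomp (X : lmodType R) (a : herm X s) : a = 2^-1 *:
  \sum_j \sum_k (ptens (Re (hmx a j k)) (herm_re j k) +
                 ptens (Im (hmx a j k)) (herm_im j k)).
Proof.
have half (x : X) : x = 2^-1 *: (x + x).
  by rewrite -mulr2n -[x *+ 2](scaler_nat 2) scalerA mulVf ?pnatr_eq0// scale1r.
apply: eq_herm => p q; rewrite mxE/=.
  rewrite [LHS]half; congr (_ *: _).
  rewrite Re_herm_sum; under eq_bigr do rewrite Re_herm_sum.
  under eq_bigr do under eq_bigr do rewrite !mxE/= ?mxE/= scale0r addr0 scalerDl.
  under eq_bigr do rewrite big_split/=.
  rewrite big_split/= sum_pick exchange_big/=.
  by rewrite (sum_pick p q (fun k j => Re (hmx a j k))) (hermRe a p q).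
rewrite [LHS]half; congr (_ *: _).
rewrite Im_herm_sum; under eq_bigr do rewrite Im_herm_sum.
under eq_bigr do under eq_bigr do rewrite !mxE/= ?mxE/= scale0r add0r scalerBl.
under eq_bigr do rewrite sumrB.
rewrite sumrB sum_pick exchange_big/= (sum_pick p q (fun k j => Im (hmx a j k))).
by rewrite (hermIm a p q) opprK.
Qed.

Lemma ptens_scalar (r : R^o) (A : 'Her[R]_s) : ptens r A = r *: A.
Proof.
by apply: eq_herm => j k; rewrite !mxE/=; exact: mulrC.
Qed.

(** [herm X s] is a tensor product of [X] and ['Her[R]_s]. *)
Lemma ptens_linearl (X : lmodType R) (A : 'Her[R]_s) :
  linear (fun x : X => ptens x A).
Proof.
by move=> l x y; apply: eq_herm => j k; rewrite !mxE/= ?mxE/= scalerDr !scalerA mulrC.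
Qed.

Lemma ptens_linearr (X : lmodType R) (x : X) : linear (@ptens R X s x).
Proof.
by move=> l A B; apply: eq_herm => j k; rewrite !mxE/= ?mxE/= scalerDl scalerA.
Qed.

Lemma ptens_universal (X W : lmodType R) (f : X -> 'Her[R]_s -> W) :
    (forall A, linear (f^~ A)) -> (forall x, linear (f x)) ->
  exists g : herm X s -> W, [/\ linear g, forall x A, g (ptens x A) = f x A
    & forall h, linear h -> (forall x A, h (ptens x A) = f x A) -> h = g].
Proof.
move=> fl fr.
have fsl A := GRing.isLinear.Build _ _ _ _ _ (fl A).
pose fL A : {linear X -> W} := HB.pack (f^~ A) (fsl A).
have fsr x := GRing.isLinear.Build _ _ _ _ _ (fr x).
pose fR x : {linear 'Her[R]_s -> W} := HB.pack (f x) (fsr x).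
have fLE A x : f x A = fL A x by [].
have fRE A x : f x A = fR x A by [].
clearbody fL fR.
pose g (a : herm X s) : W := 2^-1 *: \sum_j \sum_k
  (f (Re (hmx a j k)) (herm_re j k) + f (Im (hmx a j k)) (herm_im j k)).
exists g; split.
- move=> l a b; rewrite /g !scaler_sumr -big_split/=; apply: eq_bigr => j _.
  rewrite !scaler_sumr -big_split/=; apply: eq_bigr => k _.
  rewrite !mxE/= ?mxE/= !fLE !linearP !scalerDr !scalerA (mulrC l).
  by rewrite !addrA; congr (_ + _); rewrite -!addrA; congr (_ + _); rewrite addrC.
- move=> x A; rewrite [in RHS](herm_decomp A) fRE linearZ/= /g; congr (_ *: _).
  rewrite linear_sum/=; apply: eq_bigr => j _; rewrite linear_sum/=.
  apply: eq_bigr => k _; rewrite linearD/= !ptens_scalar !linearZ/=.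
  by rewrite ?mxE/= -!fRE !fLE !linearZ.
- move=> h hl hE; apply/funext => a; rewrite [in LHS](herm_decomp a).
  have hsl := GRing.isLinear.Build _ _ _ _ _ hl.
  pose hL : {linear herm X s -> W} := HB.pack h hsl.
  have hLE b : h b = hL b by [].
  clearbody hL; rewrite hLE linearZ/= linear_sum/=; congr (_ *: _).
  apply: eq_bigr => j _; rewrite linear_sum/=; apply: eq_bigr => k _.
  by rewrite linearD/= -!hLE !hE.
Qed.

End UniversalProperty.

Section HermMap.
Context {R : realType} {X Y : lmodType R} {s : nat}.

Lemma hmap_subproof (phi : {linear X -> Y}) (a : herm X s) : hermitianb
  (\matrix_(j, k) (phi (Re (hmx a j k)) +i* phi (Im (hmx a j k)))).
Proof.
by apply: mkherm_subproof => j k; rewrite ?(hermRe _ j) ?(hermIm _ j) ?linearN.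
Qed.
Definition hmap (phi : {linear X -> Y}) (a : herm X s) : herm Y s :=
  Herm (hmap_subproof phi a).

Lemma hmap_ptens phi (x : X) A : hmap phi (ptens x A) = ptens (phi x) A.
Proof. by apply: eq_herm => j k; rewrite !mxE/= ?mxE/= linearZ. Qed.

End HermMap.

Section Compression.
Context {R : realType} {X : lmodType R} {s t : nat}.

(** The [(j, k)] entry of [V^* a V] is the sum of the [z a_(p, q)] with
    [z = conj (V_(p, j)) V_(q, k)], where a complex number acts on [X[i]] by
    [(u + i v) (x + i y) = (u x - v y) + i (u y + v x)]. *)
Definition compress_entry (V : 'M[R[i]]_(s, t)) (a : herm X s) j k : X[i] :=
  (\sum_p \sum_q let z := conjc (V p j) * V q k in
     (Re z *: Re (hmx a p q) - Im z *: Im (hmx a p q))) +i*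
  (\sum_p \sum_q let z := conjc (V p j) * V q k in
     (Re z *: Im (hmx a p q) + Im z *: Re (hmx a p q))).

Lemma compress_subproof V a : hermitianb (\matrix_(j, k) compress_entry V a j k).
Proof.
have zC (j k : 'I_t) (p q : 'I_s) :
    conjc (V p j) * V q k = conjc (conjc (V q k) * V p j).
  by rewrite rmorphM/= conjcK mulrC.
have ReC (z : R[i]) : Re (conjc z) = Re z by case: z.
have ImC (z : R[i]) : Im (conjc z) = - Im z by case: z.
apply: mkherm_subproof => j k; rewrite exchange_big/= -?sumrN;
  apply: eq_bigr => q _; rewrite -?sumrN; apply: eq_bigr => p _;
  rewrite zC ReC ImC (hermRe a q p) (hermIm a q p).
  by rewrite !(scalerN, scaleNr) opprK.
by rewrite !(scalerN, scaleNr) opprD.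
Qed.
Definition compress (V : 'M[R[i]]_(s, t)) (a : herm X s) : herm X t :=
  Herm (compress_subproof V a).

Lemma compress_ptens V x (A : 'Her[R]_s) (B : 'Her[R]_t) :
  Her_mx B = V^t* *m Her_mx A *m V -> compress V (ptens x A) = ptens x B.
Proof.
move=> hB.
have ReD (I : finType) (F : I -> R[i]) : Re (\sum_i F i) = \sum_i Re (F i).
  by apply: (big_morph (@complex.Re R)) => // -[? ?] [? ?].
have ImD (I : finType) (F : I -> R[i]) : Im (\sum_i F i) = \sum_i Im (F i).
  by apply: (big_morph (@complex.Im R)) => // -[? ?] [? ?].
have entry j k : (hmx B j k : R[i]) = \sum_p \sum_q conjc (V p j) * V q k * hmx A p q.
  rewrite -[LHS]/(Her_mx B j k) hB mxE exchange_big/=; apply: eq_bigr => q _.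
  rewrite !mxE mulr_suml; apply: eq_bigr => p _.
  by rewrite !mxE mulrAC.
apply: eq_herm => j k; rewrite !mxE/= entry.
  rewrite ReD scaler_suml; apply: eq_bigr => p _.
  rewrite ReD scaler_suml; apply: eq_bigr => q _.
  rewrite !mxE/= !scalerA -scalerBl.
  by case: (_ * V q k) (hmx A p q) => [? ?] [? ?].
rewrite ImD scaler_suml; apply: eq_bigr => p _.
rewrite ImD scaler_suml; apply: eq_bigr => q _.
rewrite !mxE/= !scalerA -scalerDl.
by case: (_ * V q k) (hmx A p q) => [? ?] [? ?].
Qed.

End Compression.

(** Families are indexed by all natural numbers; only the levels [s >= 1]
    matter. *)

Definition levels (X : zmodType) : Type := forall s : nat, set (herm X s).

Section OperatorSystems.
Context {R : realType}.
Implicit Types X Y : lmodType R.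

Definition operator_system X (S : levels X) : Prop :=
  (forall s, (0 < s)%N -> proper_cone (S s)) /\
  (forall s t, (0 < s)%N -> (0 < t)%N -> forall (V : 'M[R[i]]_(s, t)) a,
     S s a -> S t (compress V a)).

Lemma Her1_subproof : hermitianb (\matrix_(j < 1, k < 1) ((1 : R^o) +i* 0)).
Proof. by apply: mkherm_subproof => // j k; rewrite oppr0. Qed.
Definition Her1 : 'Her[R]_1 := Herm Her1_subproof.

Definition base_cone X (S : levels X) : set X := [set x | S 1%N (ptens x Her1)].

Definition smallest_operator_system X (C : set X) (S : levels X) : Prop :=
  [/\ operator_system S, base_cone S = C &
    forall T : levels X, operator_system T -> base_cone T = C ->
      forall s, (0 < s)%N -> S s `<=` T s].

(** [C^min]: the intersection of all operator systems with base cone [C], which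
    is the smallest one whenever a smallest one exists. *)
Definition min_operator_system X (C : set X) : levels X := fun s =>
  [set a | forall T : levels X, operator_system T -> base_cone T = C -> T s a].
Arguments min_operator_system {X} C s _ : rename.

Lemma min_operator_systemE X (C : set X) (S : levels X) :
  smallest_operator_system C S ->
  forall s, (0 < s)%N -> min_operator_system C s = S s.
Proof.
move=> [oS SC Smin] s s0; apply/seteqP; split => a; first exact.
by move=> Sa T oT TC; exact: Smin Sa.
Qed.

Definition is_lift X Y (S : levels X) (T : levels Y) (Z : lmodType R)
    (pi : {linear Z -> X}) (gamma : {linear Z -> Y}) : Prop :=
  injective gamma /\
  forall s, (0 < s)%N ->
    S s = [set hmap pi c | c in [set c : herm Z s | T s (hmap gamma c)]].

Definition has_lift X Y (S : levels X) (T : levels Y) : Prop :=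
  exists (Z : lmodType R) (pi : {linear Z -> X}) (gamma : {linear Z -> Y}),
    is_lift S T pi gamma.

End OperatorSystems.

(** In [R[i]], [0 <= z] says that [z] is real and nonnegative. *)
Definition psdmx (R : realType) n (A : 'M[R[i]]_n) : Prop :=
  A \is hermsymmx /\ forall v : 'cV[R[i]]_n, 0 <= (v^t* *m A *m v) 0 0.

Section PsdSystem.
Context {R : realType} {d : nat}.

(** An entry of [a] is a formal sum [B + i B'] with [B], [B'] Hermitian
    [d * d] matrices. *)
Definition kron_entry s (a : herm 'Her[R]_d s) j k : 'M[R[i]]_d :=
  Her_mx (Re (hmx a j k)) + (0 +i* 1) *: Her_mx (Im (hmx a j k)).

Definition kron s (a : herm 'Her[R]_d s) : 'M[R[i]]_(d * s) :=
  \matrix_(p, q) kron_entry a (mxtens_unindex p).2 (mxtens_unindex q).2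
                   (mxtens_unindex p).1 (mxtens_unindex q).1.

Lemma kron_ptens s (B : 'Her[R]_d) (A : 'Her[R]_s) :
  kron (ptens B A) = tensmx (Her_mx B) (Her_mx A).
Proof.
apply/matrixP => p q; rewrite !mxE/= ?mxE/= /Her_mx ?mxE/=.
case: (hmx B _ _) (hmx A _ _) => [b b'] [c c'] /=.
apply/eqP; rewrite eq_complex/= !mul0r !mul1r !add0r.
have ZC (x y : R^o) : x *: y = y * x by exact: mulrC.
by rewrite !ZC [b' * c + _]addrC !eqxx.
Qed.

Definition psd_system : levels 'Her[R]_d := fun s => [set a | psdmx (kron a)].
Arguments psd_system s _ : rename.

End PsdSystem.

Section MatrixPolynomials.
Context {R : realType} {n : nat}.
Local Notation K := R[i].
Local Notation mxpoly r t := 'M[mpoly n K]_(r, t).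

(** The variables are self-adjoint: only the coefficients are conjugated. *)
Definition adjmp r t (P : mxpoly r t) : mxpoly t r :=
  (map_mx (map_mpoly (@conjc R)) P)^T.

Definition evalmp r t (a : 'rV[R]_n) (P : mxpoly r t) : 'M[K]_(r, t) :=
  map_mx (meval (fun j => (a 0 j)%:C)) P.

Definition translatemp r t (u : 'rV[R]_n) (P : mxpoly r t) : mxpoly r t :=
  map_mx (comp_mpoly [tuple mpolyX K (mnm1 j) - mpolyC n (u 0 j)%:C | j < n]) P.

Definition sos_mp t (H : mxpoly t t) : Prop :=
  exists N (r : 'I_N -> nat) (P : forall k, mxpoly (r k) t),
    H = \sum_k adjmp (P k) *m P k.

Definition homogeneous_mp r t (P : mxpoly r t) : Prop :=
  exists e, forall j k, P j k \is ishomog1 e mdeg.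

Definition mxpoly_span m (q : 'I_m -> mpoly n R) t : set (mxpoly t t) :=
  [set H | exists A : 'I_m -> 'Her[R]_t, H = \sum_i
     \matrix_(j, k) (Her_mx (A i) j k *: map_mpoly (real_complex R) (q i))].

Definition qmap m (q : 'I_m -> mpoly n R) (a : 'rV[R]_n) : 'rV[R]_m :=
  \row_i meval (fun j => a 0 j) (q i).

End MatrixPolynomials.

(* Main.v *)
(** Suppose that (pi, gamma) is a lift of [C^min]. The positive semidefinite
    matrices in the image of gamma lie in a face { U x U^* : x >= 0 } in whose
    relative interior the image has a point. If phi is linear and positive on
    [C], then the tensors that pair nonnegatively with phi, stably under
    compression, form with the positivity over [C] an operator system with base
    cone [C]; hence phi pairs nonnegatively with [C^min], and Hahn-Banach
    extends phi o pi to a completely positive map: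
    phi (pi z) = sum_l V_l^* x V_l whenever gamma z = U x U^*.

    For every point a choose w(a) such that q(a) = pi z and gamma z = U w(a)^* w(a) U^*
    for some z. With phi (q(a)) = H(a - u) this gives
    H(a - u) = sum_l (w(a) V_l)^* (w(a) V_l), where w does not depend on u.
    Quantifier elimination allows to choose the coordinates of w one after the
    other as simple roots of polynomials from a countable list, and by Baire's
    theorem w then has Taylor expansions of any order along a set D that is
    dense near one of its points. Taking this point for u and comparing the
    terms of lowest degree at u writes the form H as a sum of squares. *)

From HB Require Import structures.
Require Import Defs.
From mathcomp Require Import all_boot all_order all_algebra.
From mathcomp Require Import spectral sesquilinear ordered_qelim.
From mathcomp Require Import all_classical all_reals all_analysis.
From mathcomp Require Import complex mxtens.
From mathcomp Require polyrcf qe_rcf.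
From mathcomp Require Import -(notations) mpoly.
From mathcomp Require Import ring lra.

Set Implicit Arguments.
Unset Strict Implicit.
Unset Printing Implicit Defensive.

Import Order.TTheory GRing.Theory Num.Theory.
Import numFieldNormedType.Exports.

Local Open Scope classical_set_scope.
Local Open Scope ring_scope.

(* The analysis library rebinds these notations to derivatives of functions. *)
Local Notation "p ^` ()" := (deriv p) : ring_scope.
Local Notation "p ^` ( k )" := (derivn k p) : ring_scope.

(** * Algebraic selections *)

(** The selection w is regular only at points that cannot be prescribed in advance, and the set D
    may have empty interior. This is why every translate of H must be available: u is chosen after w
    has been fixed. The matrices V_l depend on u but not on a, so the entries of w(a) V_l inherit
    the Taylor expansions of w.

    Positivity controls the orders. If H has degree 2k, a diagonal entry of H(a - u) is a sum of
    squares of size O(|a - u|^(2k)), so every entry of w(a) V_l is O(|a - u|^k) along D and only its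
    form of degree k contributes to H. Density of D near u is enough for the comparison, since a
    form of degree e that is O(|a - u|^(e+1)) along D vanishes. A positive H of odd degree is zero.

    The face is needed for Hahn-Banach. The image of gamma may touch the positive semidefinite cone
    only along its boundary, and then a positive functional need not extend. In the coordinate x of
    the face, the identity comes from a point of the lift and serves as an order unit. *)

Section AlgebraicChoice.
Context {R : realType}.
Implicit Types (e : seq R) (p : {poly R}) (f : ord.formula R).

Lemma rcf_projection f i : ord.rformula f -> exists g : ord.formula R,
  [/\ ord.qf_form g, ord.rformula g &
      forall e, ord.holds e g <-> exists x, ord.holds (set_nth 0 e i x) f].
Proof.
move=> rf; have rE : ord.rformula (ord.Exists i f) by [].
have /andP[qg rg] := ord.quantifier_elim_wf (@qe_rcf.wf_QE_wproj R) rE.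
set g := ord.quantifier_elim _ _ in qg rg.
exists g; split=> // e; have ePg := ord.qf_evalP e qg.
have ePe := ord.quantifier_elim_rformP (@qe_rcf.wf_QE_wproj R)
  (@qe_rcf.valid_QE_wproj R) e rE.
split; first by move=> /ePg /ePe.
by move=> ?; apply/ePg/ePe.
Qed.

(** In characteristic 0 the multiplicity of a root drops by one under derivation, so some derivative
    has [y] as a simple root. Derivatives of the atoms again form a countable list that is uniform
    in the parameters. *)
Lemma root_simple_deriv p y : p != 0 -> root p y ->
  exists k, root p^`(k) y && ~~ root p^`(k.+1) y.
Proof.
have [s] := ubnP (size p); elim: s p => // s ih p; rewrite ltnS => ps p0 py.
have [py'|npy'] := boolP (root p^`() y); last by exists 0%N; rewrite derivn0 py derivn1.
have p'0 : p^`() != 0.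
  apply: contraTneq py => p'0.
  have : (size p <= 1)%N.
    rewrite leqNgt; apply/negP => p1.
    have /polyP/(_ (size p).-2) := p'0; rewrite coef_deriv coef0.
    case: (size p) p1 (lead_coefE p) => [|[|k]]//= _ <- /eqP.
    by rewrite mulrn_eq0 lead_coef_eq0 (negPf p0).
  by move=> /size1_polyC pE; move: p0; rewrite pE polyC_eq0 rootC.
have [k kP] := ih _ (leq_trans (lt_size_deriv p0) ps) p'0 py'.
by exists k.+1; rewrite -!derivSn in kP *.
Qed.

Lemma poly_sgr_near p y : p == 0 \/ ~~ root p y ->
  exists2 d : R, 0 < d & forall z, `|z - y| < d -> Num.sg p.[z] = Num.sg p.[y].
Proof.
move=> [/eqP ->|py]; first by exists 1 => // z _; rewrite !horner0.
have py0 : 0 < `|p.[y]| by rewrite normr_gt0.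
have [d d0 dP] := polyrcf.poly_cont y p py0.
exists d => // z /dP; move: py; rewrite rootE; case: (ltgtP p.[y] 0) => // {}py _.
- rewrite (ltr0_norm py) ltr_distl subrr => /andP[_ pz].
  by rewrite !ltr0_sg.
- rewrite (gtr0_norm py) ltr_distl subrr => /andP[pz _].
  by rewrite !gtr0_sg.
Qed.

Lemma poly_sgr_near_all (ps : seq {poly R}) y :
  (forall p, p \in ps -> p == 0 \/ ~~ root p y) ->
  exists2 d : R, 0 < d & forall p z, p \in ps -> `|z - y| < d ->
    Num.sg p.[z] = Num.sg p.[y].
Proof.
elim: ps => [|p ps ih] h; first by exists 1.
have [|d d0 dP] := ih; first by move=> q qs; apply: h; rewrite inE qs orbT.
have [|d' d'0 d'P] := @poly_sgr_near p y; first by apply: h; rewrite mem_head.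
exists (Num.min d d'); first by rewrite lt_min d0.
move=> q z; rewrite inE lt_min => /orP[/eqP -> /andP[_]|qs /andP[zd _]].
  exact: d'P.
exact: dP.
Qed.

Fixpoint atoms f : seq (qe_rcf.term R) :=
  match f with
  | ord.Bool _ | ord.Unit _ | ord.Exists _ _ | ord.Forall _ _ => [::]
  | ord.Equal t u | ord.Lt t u | ord.Le t u =>
      [:: qe_rcf.Add (qe_rcf.to_rterm t) (qe_rcf.Opp (qe_rcf.to_rterm u))]
  | ord.And g h | ord.Or g h | ord.Implies g h => atoms g ++ atoms h
  | ord.Not g => atoms g
  end.

Definition atom_signs e f :=
  [seq Num.sg (qe_rcf.eval e t) | t <- atoms f].

(** A comparison of two terms depends only on the sign of their difference, and connectives only
    combine comparisons. *)
Lemma holds_sgr e e' f : ord.qf_form f -> ord.rformula f ->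
  atom_signs e f = atom_signs e' f -> ord.holds e f <-> ord.holds e' f.
Proof.
rewrite /atom_signs; elim: f => //=;
  try by move=> g ihg h ihh /andP[qg qh] /andP[rg rh] /eqP;
    rewrite !map_cat eqseq_cat ?size_map// => /andP[/eqP gE /eqP hE];
    have := ihg qg rg gE; have := ihh qh rh hE; tauto.
- move=> t u _ /andP[rt ru] [].
  rewrite !qe_rcf.evalE !qe_rcf.to_rtermE // => h.
  suff E e1 : (GRing.eval e1 t = GRing.eval e1 u) <->
      Num.sg (GRing.eval e1 t - GRing.eval e1 u) = 0.
    by rewrite !E h.
  by split=> [->|/eqP]; [rewrite subrr sgr0 | rewrite sgr_eq0 subr_eq0 => /eqP].
- move=> t u _ /andP[rt ru] [].
  rewrite !qe_rcf.evalE !qe_rcf.to_rtermE // => h.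
  by rewrite -subr_lt0 -sgr_lt0 h sgr_lt0 subr_lt0.
- move=> t u _ /andP[rt ru] [].
  rewrite !qe_rcf.evalE !qe_rcf.to_rtermE // => h.
  by rewrite -subr_le0 -sgr_le0 h sgr_le0 subr_le0.
- by move=> g ihg qg rg gh; have [? ?] := ihg qg rg gh; tauto.
Qed.

(** [inl (j, k)] stands for the [k]-th derivative of the [j]-th atom and
    [inr r] for [Y - r]. *)
Definition candidate f i (c : nat * nat + rat) : seq (qe_rcf.term R) :=
  match c with
  | inl (j, k) => iter k (@qe_rcf.Deriv R)
                    (qe_rcf.abstrX i (nth (qe_rcf.Const 0) (atoms f) j))
  | inr r => [:: qe_rcf.Const (- ratr r); qe_rcf.Const 1]
  end.

(** The index [c] ranges over a countable set that does not depend on [e], so the category argument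
    can fix it. Simplicity of the root is what Newton's method needs later. *)
Lemma algebraic_choice f i e (y : R) : ord.qf_form f -> ord.rformula f ->
  ord.holds (set_nth 0 e i y) f ->
  exists (y' : R) c, let p := qe_rcf.eval_poly e (candidate f i c) in
    [/\ ord.holds (set_nth 0 e i y') f, root p y' & ~~ root p^`() y'].
Proof.
move=> qf rf fy.
pose P j := qe_rcf.eval_poly e (qe_rcf.abstrX i (nth (qe_rcf.Const 0) (atoms f) j)).
have PD j k : qe_rcf.eval_poly e (candidate f i (inl (j, k))) = (P j)^`(k).
  by rewrite /=; elim: k => //= k ih; rewrite qe_rcf.eval_Deriv ih.
have [[j [jf Pj0 Pjy]]|noroot] := EM (exists j,
    [/\ (j < size (atoms f))%N, P j != 0 & root (P j) y]).
  have [k /andP[ky nky]] := root_simple_deriv Pj0 Pjy.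
  by exists y, (inl (j, k)); rewrite PD; split.
(* No nonzero atom vanishes at [y], so the atoms keep their signs at a nearby
   rational. *)
have [|d d0 dP] := @poly_sgr_near_all [seq P j | j <- iota 0 (size (atoms f))] y.
  move=> p /mapP[j]; rewrite mem_iota => /andP[_ jf] ->.
  have [->|Pj0] := eqVneq (P j) 0; [by left|right].
  by apply/negP => Pjy; apply: noroot; exists j.
have [|r] := @rat_in_itvoo R (y - d) (y + d).
  by rewrite ltrBlDr -addrA ltrDl addr_gt0.
rewrite in_itv /= => /andP[yr ry].
exists (ratr r), (inr r); rewrite /= !mul0r !add0r !mul1r.
split; last 2 first.
- by rewrite rootE !hornerE subrr.
- by rewrite !poly.derivE rootE !hornerE oner_eq0.
suff /(holds_sgr qf rf)[_] : atom_signs (set_nth 0 e i (ratr r)) f =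
    atom_signs (set_nth 0 e i y) f by apply.
apply: (@eq_from_nth _ 0); rewrite !size_map// => j jf.
rewrite !(nth_map (qe_rcf.Const 0))// -!qe_rcf.abstrXP; apply: dP.
  by apply: map_f; rewrite mem_iota.
by rewrite ltr_distl yr.
Qed.

End AlgebraicChoice.

(** * Taylor expansions along a subset *)

Section BigO.
Context {R : realType} {n : nat}.
Implicit Types (D : set 'rV[R]_n) (x : 'rV[R]_n) (f g : 'rV[R]_n -> R)
  (T S : mpoly n R).

Definition bigO D x0 k f : Prop :=
  exists C : R, \forall x \near x0, D x -> `|f x| <= C * `|x - x0| ^+ k.

Lemma bigO_sub D D' x0 k f : D' `<=` D -> bigO D x0 k f -> bigO D' x0 k f.
Proof.
by move=> D'D [C fC]; exists C; near=> x => /D'D; near: x.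
Unshelve. all: by end_near. Qed.

Lemma eq_bigO D x0 k f g : (forall x, D x -> f x = g x) ->
  bigO D x0 k f -> bigO D x0 k g.
Proof.
move=> fg [C fC]; exists C; near=> x => Dx; rewrite -fg//.
by move: Dx; near: x.
Unshelve. all: by end_near. Qed.

Lemma bigOD D x0 k f g : bigO D x0 k f -> bigO D x0 k g ->
  bigO D x0 k (fun x => f x + g x).
Proof.
move=> [C fC] [C' gC']; exists (C + C'); near=> x => Dx.
rewrite mulrDl (le_trans (ler_normD _ _))// lerD//; move: Dx; near: x; assumption.
Unshelve. all: by end_near. Qed.

Lemma bigOM D x0 j k f g : bigO D x0 j f -> bigO D x0 k g ->
  bigO D x0 (j + k) (fun x => f x * g x).
Proof.
move=> [C fC] [C' gC']; exists (C * C'); near=> x => Dx.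
rewrite normrM exprD mulrACA ler_pM//; move: Dx; near: x; assumption.
Unshelve. all: by end_near. Qed.

Lemma bigO_cst D x0 c : bigO D x0 0 (fun=> c).
Proof. by exists `|c|; near=> x; rewrite expr0 mulr1. Unshelve. all: by end_near. Qed.

Lemma near_norm_lt (e : R) x0 : 0 < e -> \forall x \near x0, `|x - x0| < e.
Proof.
move=> e0; apply/nbhs_normP; exists e => //= x; by rewrite /ball_/= distrC.
Qed.

Lemma bigO_le D x0 j k f : (j <= k)%N -> bigO D x0 k f -> bigO D x0 j f.
Proof.
move=> jk [C fC]; exists `|C|; near=> x => Dx.
have xx0 : `|x - x0| <= 1 by apply: ltW; near: x; exact: near_norm_lt.
apply: (@le_trans _ _ (C * `|x - x0| ^+ k)); first by move: Dx; near: x.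
apply: (le_trans (ler_norm _)); rewrite normrM normrX normr_id ler_wpM2l//.
exact: ler_wiXn2l.
Unshelve. all: by end_near. Qed.

Lemma bigON D x0 k f : bigO D x0 k f -> bigO D x0 k (fun x => - f x).
Proof.
by move=> [C fC]; exists C; near=> x => Dx; rewrite normrN; move: Dx; near: x.
Unshelve. all: by end_near. Qed.

Lemma bigOB D x0 k f g : bigO D x0 k f -> bigO D x0 k g ->
  bigO D x0 k (fun x => f x - g x).
Proof. by move=> fO gO; apply: bigOD => //; exact: bigON. Qed.

Lemma bigO0 D x0 k : bigO D x0 k (fun=> 0).
Proof. by exists 0; near=> x; rewrite normr0 mul0r. Unshelve. all: by end_near. Qed.

Lemma bigO_sum D x0 k (I : Type) (r : seq I) (P : pred I) (F : I -> 'rV[R]_n -> R) :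
  (forall i, P i -> bigO D x0 k (F i)) ->
  bigO D x0 k (fun x => \sum_(i <- r | P i) F i x).
Proof.
move=> FO; elim: r => [|i r ih].
  by apply: eq_bigO (bigO0 _ _ _) => x _; rewrite big_nil.
have [Pi|Pi] := boolP (P i); last first.
  by apply: eq_bigO ih => x _; rewrite big_cons (negPf Pi).
by apply: eq_bigO (bigOD (FO _ Pi) ih) => x _; rewrite big_cons Pi.
Qed.

Lemma bigO_at D x0 k f : D x0 -> bigO D x0 k.+1 f -> f x0 = 0.
Proof.
move=> Dx0 [C fC]; have := nbhs_singleton fC Dx0.
by rewrite subrr normr0 expr0n/= mulr0 normr_le0 => /eqP.
Qed.

Lemma bigO_lt D x0 k f (e : R) : 0 < e -> bigO D x0 k.+1 f ->
  \forall x \near x0, D x -> `|f x| < e.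
Proof.
move=> e0 /(bigO_le (ltn0Sn k))[C fC].
near=> x => Dx; apply: (@le_lt_trans _ _ (C * `|x - x0| ^+ 1)).
  by move: Dx; near: x.
apply: (@le_lt_trans _ _ ((`|C| + 1) * `|x - x0|)).
  by rewrite expr1 ler_wpM2r// (le_trans (ler_norm _))// lerDl.
have C0 : 0 < `|C| + 1 by rewrite ltr_wpDl.
rewrite mulrC -ltr_pdivlMr//; near: x; apply: near_norm_lt.
by rewrite divr_gt0// ltr_wpDl.
Unshelve. all: by end_near. Qed.

(** [ev x0 T] is the polynomial [T] in the variable [x - x0]. *)
Definition ev x0 T x : R := meval (fun j => (x - x0) 0 j) T.

Lemma mx_coord_le x j : `|x 0 j| <= `|x|.
Proof.
rewrite [X in _ <= X]mx_normrE; exact: (le_bigmax _ (fun i : 'I_1 * 'I_n => `|x i.1 i.2|) (0, j)).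
Qed.

Lemma ev_bigO D x0 T : bigO D x0 1 (fun x => ev x0 T x - ev x0 T x0).
Proof.
rewrite /ev; elim/mpolyind: T => [|c m p _ _ ih].
  by apply: eq_bigO (bigO0 _ _ _) => x _; rewrite !meval0 subrr.
suff mO : bigO D x0 1 (fun x => meval (fun j => (x - x0) 0 j) (mpolyX R m)
    - meval (fun j => (x0 - x0) 0 j) (mpolyX R m)).
  have := bigOD (bigOM (bigO_cst D x0 c) mO) ih; apply: eq_bigO => x _.
  by rewrite !mevalD !mevalZ mulrBr opprD addrACA.
have [->|m0] := eqVneq m (@mnm0 n).
  by apply: eq_bigO (bigO0 _ _ _) => x _; rewrite !mpolyX0 !meval1 subrr.
(* One factor of a nonconstant monomial is bounded by the distance to [x0]; the remaining ones are
   at most 1 nearby. *)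
have [j mj] : exists j, m j != 0%N.
  by apply/existsP; apply: contraNT m0 => /existsPn h; apply/eqP/mnmP => j; rewrite mnm0E; apply/eqP; move: (h j); rewrite negbK.
exists 1; near=> x => _.
rewrite !mevalX subrr (bigD1 j)//= [X in _ - X](bigD1 j)//=.
rewrite [X in X ^+ _ * _ - _](_ : _ = (x - x0) 0 j)// [X in _ - X ^+ _ * _]mxE expr0n (negPf mj) mul0r subr0 mul1r expr1.
rewrite normrM -[X in _ <= X]mulr1 ler_pM//.
  rewrite normrX -(prednK (n := m j)) ?lt0n// exprS -[X in _ <= X]mulr1 ler_pM ?exprn_ge0//; first exact: mx_coord_le.
  rewrite exprn_ile1// (le_trans (mx_coord_le _ _))// ltW//; near: x; exact: near_norm_lt.
rewrite normr_prod; apply: prodr_ile1 => i _.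
rewrite normr_ge0/= normrX exprn_ile1// (le_trans (mx_coord_le _ _))// ltW//; near: x; exact: near_norm_lt.
Unshelve. all: by end_near. Qed.

Lemma ev_bigO0 D x0 T : bigO D x0 0 (ev x0 T).
Proof.
have := bigOD (bigO_le (leq0n 1) (ev_bigO D x0 T)) (bigO_cst D x0 (ev x0 T x0)).
by apply: eq_bigO => x _; rewrite subrK.
Qed.

End BigO.

Section Taylor.
Context {R : realType} {n : nat}.
Implicit Types (D : set 'rV[R]_n) (x : 'rV[R]_n) (f g : 'rV[R]_n -> R)
  (T S : mpoly n R).

(** A single expansion at [x0] that is only tested on [D]; [f] may be arbitrary elsewhere, and no
    derivative has to exist. *)
Definition taylor k D x0 f : Prop :=
  exists T, bigO D x0 k.+1 (fun x => f x - ev x0 T x).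

Lemma taylor_sub k D D' x0 f : D' `<=` D -> taylor k D x0 f -> taylor k D' x0 f.
Proof. by move=> D'D [T fT]; exists T; exact: bigO_sub fT. Qed.

Lemma taylor_cst k D x0 c : taylor k D x0 (fun=> c).
Proof.
exists (mpolyC n c); apply: eq_bigO (bigO0 _ _ _) => x _.
by rewrite /ev mevalC subrr.
Qed.

Lemma taylor_coord k D x0 j : taylor k D x0 (fun x => x 0 j).
Proof.
exists (mpolyX R (mnm1 j) + mpolyC n (x0 0 j)); apply: eq_bigO (bigO0 _ _ _) => x _.
by rewrite /ev mevalD mevalC mevalXU !mxE subrK subrr.
Qed.

Lemma taylorD k D x0 f g : taylor k D x0 f -> taylor k D x0 g ->
  taylor k D x0 (fun x => f x + g x).
Proof.
move=> [T fT] [S gS]; exists (T + S); apply: eq_bigO (bigOD fT gS) => x _.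
by rewrite /ev mevalD opprD addrACA.
Qed.

Lemma taylor_bigO0 k D x0 f : taylor k D x0 f -> bigO D x0 0 f.
Proof.
move=> [T fT]; apply: eq_bigO (bigOD (bigO_le (leq0n _) fT) (ev_bigO0 D x0 T)) => x _.
by rewrite subrK.
Qed.

Lemma taylorM k D x0 f g : taylor k D x0 f -> taylor k D x0 g ->
  taylor k D x0 (fun x => f x * g x).
Proof.
move=> fO [S gS]; have f0 := taylor_bigO0 fO; have [T fT] := fO; exists (T * S).
have := bigOD (bigOM f0 gS) (bigOM (ev_bigO0 D x0 S) fT).
by apply: eq_bigO => x _; rewrite /ev mevalM; ring.
Qed.

Lemma taylor_eval k D x0 (env : 'rV[R]_n -> seq R) t :
  (forall i, taylor k D x0 (fun x => nth 0 (env x) i)) ->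
  taylor k D x0 (fun x => qe_rcf.eval (env x) t).
Proof.
move=> envT; elim: t => //= [c|c|t tT u uT|t tT|t tT c|t tT u uT|t tT c].
- exact: taylor_cst.
- exact: taylor_cst.
- exact: taylorD.
- have := taylorM (taylor_cst k D x0 (-1)) tT.
  by under eq_fun do rewrite mulN1r.
- have := taylorM (taylor_cst k D x0 c%:R) tT.
  by under eq_fun do rewrite mulr_natl.
- exact: taylorM.
- elim: c => [|c ih]; first by under eq_fun do rewrite expr0; exact: taylor_cst.
  by under eq_fun do rewrite exprS; exact: taylorM.
Qed.

Lemma poly_taylor2 (A : comNzRingType) (p : {poly A}) (a h : A) :
  exists q, p.[a + h] = p.[a] + p^`().[a] * h + q * h ^+ 2.
Proof.
elim/poly_ind: p => [|p c [q ih]]; first by exists 0; rewrite deriv0 !horner0; ring.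
exists (p^`().[a] + q * (a + h)).
by rewrite derivMXaddC !hornerMXaddC hornerD hornerMX ih; ring.
Qed.

Lemma newton (G : {poly mpoly n R}) x0 (y0 : R) k :
  ev x0 G.[mpolyC n y0] x0 = 0 -> ev x0 G^`().[mpolyC n y0] x0 != 0 ->
  exists T, ev x0 T x0 = y0 /\ bigO setT x0 k.+1 (ev x0 G.[T]).
Proof.
set c := ev x0 G^`().[_] x0 => G0 c0.
have evh (H : {poly mpoly n R}) T S : ev x0 T x0 = ev x0 S x0 ->
    ev x0 H.[T] x0 = ev x0 H.[S] x0.
  by rewrite /ev -!horner_map/= => ->.
elim: k => [|k [T [T0 TO]]].
  exists (mpolyC n y0); split; first by rewrite /ev mevalC.
  by have := ev_bigO setT x0 G.[mpolyC n y0]; rewrite G0; under eq_fun do rewrite subr0.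
have T0' : ev x0 T x0 = ev x0 (mpolyC n y0) x0 by rewrite T0 /ev mevalC.
have cE : ev x0 G^`().[T] x0 = c by exact: evh.
have [q qE] := poly_taylor2 G T (mpolyC n (- c^-1) * G.[T]).
exists (T + mpolyC n (- c^-1) * G.[T]); split.
  by rewrite {1}/ev mevalD mevalM -/(ev x0 T x0) -/(ev x0 G.[T] x0) T0
    (evh _ _ _ T0') G0 mulr0 addr0.
rewrite qE.
have O1 := bigOM (bigOM (bigO_cst setT x0 (- c^-1)) (ev_bigO setT x0 G^`().[T])) TO.
have O2 := bigOM (bigOM (bigO_cst setT x0 (c^-2)) (ev_bigO0 setT x0 q)) (bigOM TO TO).
have k2 : (k.+2 <= 0 + 0 + (k.+1 + k.+1))%N by rewrite !add0n addnS ltnS leq_addr.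
have {}O2 := bigO_le k2 O2.
apply: eq_bigO (bigOD (O1 : bigO _ _ k.+2 _) O2) => x _; rewrite /= /ev !(mevalD, mevalM, mevalC, rmorphXn)/=.
rewrite -/(ev x0 _ x0) cE; field; exact: c0.
Qed.

(** This plays the role of the implicit function theorem, without continuity of [f]. Newton's method
    gives a polynomial that almost solves the equation, and the uniform Lipschitz bound on the fixed
    interval turns a small residue into a small distance from the root [f x]. *)
Lemma taylor_root k D x0 (P : 'rV[R]_n -> {poly R}) M f (a b C : R) :
  D x0 -> (forall x, size (P x) <= M)%N ->
  (forall i, taylor k D x0 (fun x => (P x)`_i)) ->
  (forall x, D x -> [/\ a < f x < b, root (P x) (f x), ~~ root (P x)^`() (f x) &
     forall s t, a < s < b -> a < t < b -> `|s - t| <= C * `|(P x).[s] - (P x).[t]| ]) ->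
  taylor k D x0 f.
Proof.
move=> Dx0 PM PT fP.
have /choice[c cP] := PT.
(* Replacing the coefficients of [P x] by their Taylor polynomials gives an equation over the
   polynomial ring that agrees with [P x0] at [x0]. *)
pose G := \poly_(i < M) c i.
have c0 i : (P x0)`_i = ev x0 (c i) x0.
  by apply/eqP; rewrite -subr_eq0; apply/eqP/(bigO_at Dx0 (cP i)).
have PG : map_poly (fun T => ev x0 T x0) G = P x0.
  apply/polyP => i; rewrite coef_map_id0; last by rewrite /ev meval0.
  rewrite coef_poly; case: ltnP => iM; first by rewrite c0.
  by rewrite {1}/ev meval0 nth_default// (leq_trans (PM _)).
have [fab rPf nrPf _] := fP _ Dx0.
have [||T [T0 TO]] := @newton G x0 (f x0) k.
- rewrite /ev -horner_map/= -[map_poly _ _]/(map_poly (fun T => ev x0 T x0) G) PG mevalC.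
  exact/eqP.
- rewrite /ev -horner_map/= -deriv_map -[map_poly _ _]/(map_poly (fun T => ev x0 T x0) G) PG mevalC.
  exact: nrPf.
exists T.
(* The residue is that of [G], small by Newton, plus the Taylor errors of the coefficients. *)
have [C' C'P] : bigO D x0 k.+1 (fun x => (P x).[ev x0 T x]).
  have O1 : bigO D x0 k.+1 (fun x => \sum_(i < M) ((P x)`_i - ev x0 (c i) x) * (ev x0 T x) ^+ i).
    apply: bigO_sum => i _; rewrite -[k.+1]addn0; apply: bigOM; first exact: cP.
    by apply: eq_bigO (ev_bigO0 D x0 (T ^+ i)) => x _; rewrite /ev rmorphXn.
  apply: eq_bigO (bigOD O1 (bigO_sub (@subsetT _ D) TO)) => x _.
  have -> : ev x0 G.[T] x = \sum_(i < M) ev x0 (c i) x * ev x0 T x ^+ i.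
    rewrite horner_poly /ev rmorph_sum/=; apply: eq_bigr => i _.
    by rewrite mevalM rmorphXn.
  rewrite -big_split/= (horner_coef_wide _ (PM x)); apply: eq_bigr => i _.
  by rewrite -mulrDl subrK.
have e0 : 0 < Num.min (f x0 - a) (b - f x0) by move: fab; rewrite lt_min !subr_gt0.
exists (`|C| * C'); near=> x => Dx.
have [fxab rPx _ lip] := fP _ Dx.
(* The Lipschitz bound holds only on the interval; T(x) stays there because its value at [x0] is
   f(x0), an interior point. *)
have Tab : a < ev x0 T x < b.
  have : `|ev x0 T x - ev x0 T x0| < Num.min (f x0 - a) (b - f x0).
    by near: x; have := bigO_lt e0 (ev_bigO setT x0 T); apply: filterS => x; exact.
  rewrite T0 lt_min ltr_distl => /andP[/andP[h _]].
  by rewrite ltr_distl => /andP[_ h']; apply/andP; split; lra.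
apply: (le_trans (lip _ _ fxab Tab)).
rewrite (eqP rPx) sub0r normrN -mulrA.
apply: (@le_trans _ _ (`|C| * `|(P x).[ev x0 T x]|)).
  by rewrite ler_wpM2r// ler_norm.
rewrite ler_wpM2l//; move: Dx; near: x; exact: C'P.
Unshelve. all: by end_near. Qed.

(** Near [y] the derivative keeps at least half of its absolute value at [y]; the mean value theorem
    does the rest. *)
Lemma simple_root_bilipschitz (p : {poly R}) y : root p y -> ~~ root p^`() y ->
  exists d C : R, 0 < d /\ forall s t, `|s - y| < d -> `|t - y| < d ->
    `|s - t| <= C * `|p.[s] - p.[t]|.
Proof.
move=> py p'y; have p0 : 0 < `|p^`().[y]| / 2 by rewrite divr_gt0// normr_gt0.
have [d d0 dP] := polyrcf.poly_cont y p^`() p0.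
exists d, (`|p^`().[y]| / 2)^-1; split=> //.
suff h s t : s < t -> `|s - y| < d -> `|t - y| < d ->
    `|s - t| <= (`|p^`().[y]| / 2)^-1 * `|p.[s] - p.[t]|.
  move=> s t sd td; have [st|ts|->] := ltgtP s t; first exact: h.
    by rewrite distrC [`|p.[s] - _|]distrC; exact: h.
  by rewrite !subrr normr0 mulr0.
move=> st sd td; have [c /andP[sc ct]] := polyrcf.poly_mvt p st.
rewrite ler_pdivlMl// [X in _ <= X]distrC => ->.
rewrite normrM [`|s - t|]distrC ler_wpM2r//.
have /dP : `|c - y| < d.
  move: sd td; rewrite !ltr_distl => /andP[? ?] /andP[? ?]; apply/andP; split.
    by apply: lt_trans sc.
  by apply: lt_trans ct _.
move=> /ltW h'.
have := ler_normD (p^`().[y] - p^`().[c]) p^`().[c]; rewrite subrK distrC => h2.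
lra.
Qed.

End Taylor.

(** * Baire category and Nash selection *)

Section Nonmeager.
Context {R : realType} {n : nat}.
Implicit Types (D : set 'rV[R]_n) (x : 'rV[R]_n).

(** By complementation: [D] is not covered by countably many nowhere dense sets. *)
Definition nonmeager D : Prop := forall F : (set 'rV[R]_n)^nat,
  (forall i, open (F i) /\ dense (F i)) -> D `&` \bigcap_i F i !=set0.

Lemma nonmeagerT : nonmeager setT.
Proof.
move=> F FO.
pose U : completeNormedModType R := HB.pack ('rV[R]_n) (Complete.on 'rV[R]_n).
by apply: (@Baire R U F FO) openT; exists 0.
Qed.

Lemma nonmeager_cover D (I : countType) (A : I -> set 'rV[R]_n) :
  nonmeager D -> (forall x, D x -> exists i, A i x) ->
  exists i, nonmeager (D `&` A i).
Proof.
move=> nD DA; apply: contrapT => /forallNP nA.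
have /choice[F FP] : forall i, exists F : (set 'rV[R]_n)^nat,
    (forall j, open (F j) /\ dense (F j)) /\ ~ (D `&` A i `&` \bigcap_j F j !=set0).
  move=> i; have /existsNP[F /not_implyP[FO FA]] := nA i.
  by exists F.
(* If every piece were meager, all the witnessing dense open sets together would still form one
   countable family. Codes of no pair get the whole space. *)
pose G k := if @unpickle (I * nat)%type k is Some p then F p.1 p.2 else setT.
have [|x [Dx Gx]] := nD G.
  move=> k; rewrite /G; case: unpickle => [[i j]|]; first exact: (FP i).1.
  by split; [exact: openT | move=> O O0 _; rewrite setIT].
have [i Aix] := DA _ Dx; apply: (FP i).2; exists x; split=> // j _.
by have := Gx (pickle (i, j)) Logic.I; rewrite /G pickleK.
Qed.

(** The boundary of the closed set [closure D] is nowhere dense, so [D] has a point off this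
    boundary; being in the closure, it lies in its interior. *)
Lemma nonmeager_somewhere_dense D : nonmeager D ->
  exists x0, D x0 /\ \forall x \near x0, closure D x.
Proof.
move=> nD.
have [|x [Dx nDx]] := nD (fun=> ~` closure D `|` (closure D)°).
  move=> _; split.
    by apply: openU; [exact: closed_openC (@closed_closure _ _) | exact: open_interior].
  move=> O [y Oy] oO; have [[z [Oz nDz]]|h] := pselect (O `&` ~` closure D !=set0).
    by exists z; split=> //; left.
  exists y; split=> //; right; apply: (@filterS _ (nbhs y)) (open_nbhs_nbhs (conj oO Oy)) => z Oz.
  by apply: contrapT => nDz; apply: h; exists z.
exists x; split=> //; case: (nDx 0%N I) => // nD'.
by exfalso; apply: nD'; exact: subset_closure.
Qed.

End Nonmeager.

Section Selection.
Context {R : realType} {n : nat}.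
Implicit Types (D : set 'rV[R]_n) (x : 'rV[R]_n).

Lemma selection_step k D (env : 'rV[R]_n -> seq R) i f :
  ord.qf_form f -> ord.rformula f -> nonmeager D ->
  (forall x0 j, D x0 -> taylor k D x0 (fun x => (env x)`_j)) ->
  (forall x, D x -> exists y, ord.holds (set_nth 0 (env x) i y) f) ->
  exists D' (y : 'rV[R]_n -> R), [/\ D' `<=` D, nonmeager D',
    forall x, D' x -> ord.holds (set_nth 0 (env x) i (y x)) f &
    forall x0, D' x0 -> taylor k D' x0 y].
Proof.
move=> qf rf nD envT Df.
pose P c x := qe_rcf.eval_poly (env x) (candidate f i c).
(* The root and the index of its polynomial are chosen pointwise, with no regularity in [x]; outside
   [D] they are arbitrary. *)
have /choice[yc ycP] : forall x, exists yc : R * (nat * nat + rat), D x ->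
   [/\ ord.holds (set_nth 0 (env x) i yc.1) f, root (P yc.2 x) yc.1
     & ~~ root (P yc.2 x)^`() yc.1].
  move=> x; have [/Df[y fy]|nDx] := pselect (D x); last by exists (0, inr 0).
  by have [y' [c h]] := algebraic_choice qf rf fy; exists (y', c).
pose y x := (yc x).1.
(* On each piece the polynomial, a rational interval around the root and an integral Lipschitz
   constant are the same for all points. These data are countable, so some piece is nonmeager; the
   pieces need not be open or even definable. *)
pose A (p : (nat * nat + rat) * ((rat * rat) * nat)) : set 'rV[R]_n :=
  [set x | [/\ (yc x).2 = p.1, ratr p.2.1.1 < y x < ratr p.2.1.2 &
   forall s t, ratr p.2.1.1 < s < ratr p.2.1.2 -> ratr p.2.1.1 < t < ratr p.2.1.2 ->
     `|s - t| <= p.2.2%:R * `|(P p.1 x).[s] - (P p.1 x).[t]|]].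
have [|[c [[a b] N]] nA] := @nonmeager_cover _ _ D _ A nD.
  move=> x /ycP[_ ry nry].
  have [d [C [d0 dC]]] := simple_root_bilipschitz ry nry.
  have [|a] := @rat_in_itvoo R (y x - d) (y x); first by rewrite ltrBlDr ltrDl.
  rewrite in_itv/= => /andP[ya ay].
  have [|b] := @rat_in_itvoo R (y x) (y x + d); first by rewrite ltrDl.
  rewrite in_itv/= => /andP[yb by'].
  exists ((yc x).2, ((a, b), Num.bound `|C|)); split=> //=; first by rewrite ay yb.
  have near_y s : ratr a < s < ratr b -> `|s - (yc x).1| < d.
    move=> /andP[as' sb]; rewrite ltr_distl -/(y x) (lt_trans ya as')/=.
    exact: lt_trans sb _.
  move=> s t /near_y sy /near_y ty; apply: (le_trans (dC _ _ sy ty)).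
  by rewrite ler_wpM2r// ltW// (le_lt_trans (ler_norm _))// archi_boundP//.
exists (D `&` A (c, (a, b, N))), y; split=> //.
  by move=> x [/ycP[fy _ _] _].
move=> x0 D'x0.
apply: (@taylor_root _ _ k _ x0 (P c) (size (candidate f i c)) y (ratr a) (ratr b) N%:R) => //.
- move=> x; rewrite /P qe_rcf.eval_polyP; apply: leq_trans (size_Poly _) _.
  by rewrite size_map.
- move=> j; rewrite /P; under eq_fun do rewrite qe_rcf.eval_polyP coef_Poly.
  have [jc|jc] := ltnP j (size (candidate f i c)); last first.
    under eq_fun do rewrite nth_default ?size_map//.
    exact: taylor_cst.
  under eq_fun do rewrite (nth_map (qe_rcf.Const 0))//.
  apply: taylor_eval => l; apply: (taylor_sub (@subIsetl _ _ _)).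
  by apply: envT; case: D'x0.
- by move=> x [/ycP[_ ry nry] [/= cE yab lip]]; rewrite -cE; split=> //; rewrite cE.
Qed.

Lemma set_nth_size (T : Type) (z : T) s v : set_nth z s (size s) v = rcons s v.
Proof. by elim: s => //= a s ->. Qed.

Lemma selection k N : forall f i D (env : 'rV[R]_n -> seq R),
  ord.qf_form f -> ord.rformula f -> nonmeager D ->
  (forall x, size (env x) = i) ->
  (forall x0 j, D x0 -> taylor k D x0 (fun x => (env x)`_j)) ->
  (forall x, D x -> exists2 y, size y = N & ord.holds (env x ++ y) f) ->
  exists D' (y : 'rV[R]_n -> seq R), [/\ D' `<=` D, nonmeager D',
    forall x, size (y x) = N,
    forall x, D' x -> ord.holds (env x ++ y x) f &
    forall x0 j, D' x0 -> taylor k D' x0 (fun x => (env x ++ y x)`_j)].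
Proof.
elim: N => [|N ih] f i D env qf rf nD ei eT Df.
  exists D, (fun=> [::]); split=> //.
    by move=> x /Df[y /size0nil ->].
  by move=> x0 j Dx0; under eq_fun do rewrite cats0; exact: eT.
(* The last unknown is projected away, the others are selected first, and then they serve as
   parameters for the last one. *)
have [g [qg rg gP]] := rcf_projection (i + N) rf.
have catE x (y : seq R) v : size y = N ->
    set_nth 0 (env x ++ y) (i + N) v = env x ++ rcons y v.
  by move=> yN; rewrite -(ei x) -yN -size_cat set_nth_size rcons_cat.
have [|D1 [y [D1D nD1 yN gy yT]]] := ih g i D env qg rg nD ei eT.
  move=> x /Df[y]; case/lastP: y => // y v; rewrite size_rcons => -[yN] fy.
  by exists y => //; apply/gP; exists v; rewrite catE.
have [|D2 [v [D2D nD2 fv vT]]] :=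
    @selection_step k D1 (fun x => env x ++ y x) (i + N) f qf rf nD1 yT.
  by move=> x /gy /gP.
exists D2, (fun x => rcons (y x) (v x)); split=> //.
- exact: subset_trans D2D D1D.
- by move=> x; rewrite size_rcons yN.
- by move=> x /fv; rewrite catE.
- move=> x0 j D2x0; under eq_fun do rewrite -catE// nth_set_nth/=.
  have [ji|ji] := eqVneq j (i + N)%N; first exact: vT.
  exact/(taylor_sub D2D)/yT/D2D.
Qed.

Definition coords x : seq R := [seq x 0 j | j <- enum 'I_n].

Lemma nth_coords x (j : 'I_n) : (coords x)`_j = x 0 j.
Proof. by rewrite (nth_map j) ?size_enum_ord// nth_ord_enum. Qed.

Lemma nash_selection k N (t : qe_rcf.term R) :
  (forall x, exists2 y, size y = N & qe_rcf.eval (coords x ++ y) t = 0) ->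
  exists D (y : 'rV[R]_n -> seq R), [/\ nonmeager D,
    forall x, D x -> qe_rcf.eval (coords x ++ y x) t = 0 &
    forall x0 j, D x0 -> taylor k D x0 (fun x => (y x)`_j)].
Proof.
move=> tP.
pose f := ord.Equal (qe_rcf.rterm_to_term t) (GRing.Const 0).
have sc x : size (coords x) = n by rewrite size_map size_enum_ord.
have [||||D [y [_ nD yN fy yT]]] := @selection k N f n setT coords _ _ nonmeagerT sc.
- by [].
- by rewrite /= qe_rcf.rtermF.
- move=> x0 j _; have [jn|jn] := ltnP j n; last first.
    under eq_fun do rewrite nth_default ?sc//.
    exact: taylor_cst.
  under eq_fun do rewrite (nth_coords _ (Ordinal jn)).
  exact: taylor_coord.
- by move=> x _; have [y yN yt] := tP x; exists y => //=; rewrite -qe_rcf.evalE.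
exists D, y; split=> //; first by move=> x /fy /=; rewrite qe_rcf.evalE.
move=> x0 j /(yT _ (n + j)%N).
by under eq_fun do rewrite nth_cat sc ltnNge leq_addr/= addKn.
Qed.

End Selection.

(** * Leading forms *)

Section Vanishing.
Context {A : numDomainType}.

Lemma poly_nat_eq0 (p : {poly A}) : (forall k : nat, p.[k%:R] = 0) -> p = 0.
Proof.
move=> p0; apply: (@roots_geq_poly_eq0 _ p [seq k%:R | k <- iota 0 (size p)]).
- by apply/allP => _ /mapP[k _ ->]; apply/rootP.
- rewrite map_inj_uniq ?iota_uniq// => j k /eqP.
  by rewrite eqr_nat => /eqP.
- by rewrite size_map size_iota.
Qed.

Lemma sum_powers_eq0 (I : Type) (r : seq I) (P : pred I) (a : I -> A) (d : I -> nat) :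
  (forall k : nat, \sum_(i <- r | P i) a i * k%:R ^+ d i = 0) ->
  forall j, \sum_(i <- r | P i && (d i == j)) a i = 0.
Proof.
move=> h j; pose p : {poly A} := \sum_(i <- r | P i) (a i)%:P * 'X^(d i).
have p0 : p = 0.
  apply: poly_nat_eq0 => k; rewrite -[RHS](h k) horner_sum; apply: eq_bigr => i _.
  by rewrite hornerM hornerC hornerXn.
have /polyP/(_ j) := p0; rewrite coef0 coef_sum => pj; rewrite -[RHS]pj.
rewrite big_mkcondr/=; apply: eq_bigr => i _.
by rewrite coefCM coefXn eq_sym; case: eqP => _; rewrite ?mulr1 ?mulr0.
Qed.

(** Testing at natural numbers makes the lemma apply both to real polynomials and to complex
    polynomials in real variables. *)
Lemma mpoly_nat_eq0 n (p : mpoly n A) :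
  (forall v : 'I_n -> nat, meval (fun j => (v j)%:R) p = 0) -> p = 0.
Proof.
move=> p0; apply/mpolyP => m; rewrite mcoeff0.
have h (s : seq 'I_n) : forall v : 'I_n -> nat,
    \sum_(m' <- msupp p | all (fun i => m' i == m i) s)
      mcoeff m' p * \prod_i (v i)%:R ^+ m' i = 0.
  elim: s => [v|i s ih v]; first by rewrite -[RHS](p0 v) mevalE.
  under eq_bigl do rewrite /= andbC.
  apply: (sum_powers_eq0 (d := fun m' : multinom n => m' i)) => k.
  (* Scaling the variable [i] by [k] multiplies a monomial by a power of [k], so the monomials
     separate by their exponent in that variable. After all variables only the monomial [m] is
     left. *)
  rewrite -[RHS](ih (fun j => if j == i then v j * k else v j)%N).
  apply: eq_bigr => m' _; rewrite -mulrA; congr (_ * _).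
  rewrite (bigD1 i)//= [in RHS](bigD1 i)//= eqxx natrM exprMn -!mulrA; congr (_ * _).
  rewrite mulrC; congr (_ * _); apply: eq_bigr => j /negPf ->//.
have [mp|] := boolP (m \in msupp p); last by exact: memN_msupp_eq0.
have := h (enum 'I_n) (fun=> 1%N).
rewrite big_mkcond (bigD1_seq m) ?msupp_uniq//= ifT; last by apply/allP.
rewrite big1 => [|i _]; last by rewrite expr1n.
rewrite mulr1 big1 ?addr0// => m' m'm; case: ifP => // /allP h'.
by case/eqP: m'm; apply/mnmP => i; apply/eqP/h'; rewrite mem_enum.
Qed.

End Vanishing.

Section Homogeneous.
Context {R : realType} {n : nat}.
Implicit Types (D : set 'rV[R]_n) (x : 'rV[R]_n) (p : mpoly n R).
Local Notation homog d := (ishomog1 d mdeg).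

Lemma meval_homog d p (l : R) (v : 'I_n -> R) : p \is homog d ->
  meval (fun j => l * v j) p = l ^+ d * meval v p.
Proof.
move=> /dhomogP ph; rewrite !mevalE mulr_sumr; apply: eq_big_seq => m mp.
rewrite mulrCA; congr (_ * _); under eq_bigr do rewrite exprMn.
by rewrite big_split/= prodrXr -mdegE (ph m mp).
Qed.

Lemma ev_homog_bigO D x0 d p : p \is homog d -> bigO D x0 d (ev x0 p).
Proof.
move=> /dhomogP ph; rewrite /ev; under eq_fun do rewrite mevalE big_seq.
apply: bigO_sum => m mp; exists `|mcoeff m p|; near=> x => _.
have -> : d = (\sum_i m i)%N by rewrite -mdegE -(ph m mp).
rewrite normrM ler_wpM2l// -prodrXr normr_prod.
apply: ler_prod => i _; rewrite normr_ge0/= normrX lerXn2r ?nnegrE//.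
exact: mx_coord_le.
Unshelve. all: by end_near. Qed.

Lemma continuous_exp (T : topologicalType) (f : T -> R) k :
  continuous f -> continuous (fun z => f z ^+ k).
Proof.
move=> fc; elim: k => [|k ih].
  by under eq_fun do rewrite expr0; exact: cst_continuous.
under eq_fun do rewrite exprS.
move=> z; apply: (@continuousM _ _ f (fun y => f y ^+ k)); [exact: fc|exact: ih].
Qed.

Lemma continuous_prod (T : topologicalType) (I : Type) (r : seq I) (F : I -> T -> R) :
  (forall i, continuous (F i)) -> continuous (fun z => \prod_(i <- r) F i z).
Proof.
move=> Fc; elim: r => [|i r ih].
  by under eq_fun do rewrite big_nil; exact: cst_continuous.
under eq_fun do rewrite big_cons.
move=> z; apply: (@continuousM _ _ (F i) (fun y => \prod_(i <- r) F i y)); [exact: Fc|exact: ih].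
Qed.

Lemma continuous_meval p : continuous (fun x => meval (fun j => x 0 j) p).
Proof.
elim/mpolyind: p => [|c m p _ _ ih].
  under eq_fun do rewrite meval0.
  exact: cst_continuous.
under eq_fun do rewrite mevalD mevalZ mevalX.
move=> x; apply: (@continuousD _ _ _ (fun x : 'rV[R]_n => c * \prod_i x 0 i ^+ m i)); last exact: ih.
apply: (@continuousM _ _ (cst c) (fun x : 'rV[R]_n => \prod_i x 0 i ^+ m i)).
  exact: cst_continuous.
apply: continuous_prod => i; apply: continuous_exp => z; exact: coord_continuous.
Qed.

(** By continuity the bound passes from [D] to a full ball. Along l h it then reads l^d |p(h)| <= C
    l^(d+1) |h|^(d+1), and l tends to 0. *)
Lemma homog_bigO_eq0 D x0 d p : (\forall x \near x0, closure D x) ->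
  p \is homog d -> bigO D x0 d.+1 (ev x0 p) -> p = 0.
Proof.
move=> Dx0 ph [C pC].
have {pC} [e /= e0 eP] : exists2 e : R, 0 < e & forall x, `|x - x0| < e ->
    `|ev x0 p x| <= C * `|x - x0| ^+ d.+1.
  have [e /= e0 eP] := (@nbhs_normP _ _ x0 _).1 (filterI Dx0 pC); exists e => // x xe.
  pose f x := C * `|x - x0| ^+ d.+1 - `|ev x0 p x|.
  have fc : continuous f.
    have dc : continuous (fun z : 'rV[R]_n => z - x0).
      by move=> z; apply: (@continuousB _ _ _ id (cst x0)) => //; exact: cst_continuous.
    rewrite /f => z; apply: (@continuousB _ _ _ (fun z : 'rV[R]_n => C * `|z - x0| ^+ d.+1) (fun z : 'rV[R]_n => `|ev x0 p z|)).
      apply: (@continuousM _ _ (cst C)); first exact: cst_continuous.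
      apply: continuous_exp => y; apply: (@continuous_comp _ _ _ (fun z : 'rV[R]_n => z - x0) Num.norm).
        exact: dc.
      exact: norm_continuous.
    apply: (@continuous_comp _ _ _ (ev x0 p) Num.norm); last exact: norm_continuous.
    apply: (@continuous_comp _ _ _ (fun x : 'rV[R]_n => x - x0) (fun x : 'rV[R]_n => meval (fun j => x 0 j) p)).
      exact: dc.
    exact: continuous_meval.
  rewrite -subr_ge0 -/(f x) leNgt; apply/negP => fx.
  have xB : nbhs x [set z | `|z - x0| < e /\ f z < 0].
    apply: filterI; last exact: (cvgr_lt (f x) (fc x) 0 fx).
    near=> z; rewrite -(subrK x z) -addrA (le_lt_trans (ler_normD _ _))//.
    rewrite -ltrBrDr; near: z; apply: near_norm_lt; by rewrite subr_gt0.
  have [clx _] : closure D x /\ (D x -> `|ev x0 p x| <= C * `|x - x0| ^+ d.+1).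
    by apply: eP; rewrite /ball_/= distrC.
  have [z [Dz [ze]]] := clx _ xB.
  have [_ /(_ Dz)] : closure D z /\ (D z -> `|ev x0 p z| <= C * `|z - x0| ^+ d.+1).
    by apply: eP; rewrite /ball_/= distrC.
  by rewrite -subr_ge0 -/(f z) leNgt => /negP.
apply: mpoly_nat_eq0 => v; pose h : 'rV[R]_n := \row_j (v j)%:R.
have -> : meval (fun j => (v j)%:R) p = meval (fun j => h 0 j) p.
  by apply: meval_eq => j; rewrite mxE.
apply/eqP; rewrite -normr_le0; apply/ler_addgt0Pr => y y0; rewrite add0r.
(* The scale [l] below satisfies l M < e, which keeps l h in the ball, and l B < y, which makes the
   bound smaller than [y]. The added ones keep the denominators positive. *)
pose M := `|h| + 1; have M0 : 0 < M by rewrite ltr_wpDl.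
pose B := `|C| * M ^+ d.+1 + 1; have B0 : 0 < B.
  by rewrite ltr_wpDl// mulr_ge0// exprn_ge0// ltW.
pose l := Num.min (e / M) (y / B) / 2.
have l0 : 0 < l by rewrite divr_gt0// lt_min !divr_gt0.
have lmin : l < Num.min (e / M) (y / B) by rewrite ltr_pdivrMr// mulr2n mulrDr mulr1 ltrDl lt_min !divr_gt0.
clearbody l; move: lmin; rewrite lt_min => /andP[]; rewrite !ltr_pdivlMr// => le ly.
have := eP (x0 + l *: h); rewrite /ev addrAC subrr add0r.
have -> : meval (fun j => (l *: h) 0 j) p = l ^+ d * meval (fun j => h 0 j) p.
  by rewrite -meval_homog//; apply: meval_eq => j; rewrite mxE.
rewrite normrZ (gtr0_norm l0) normrM normrX (gtr0_norm l0).
have hM : `|h| <= M by rewrite lerDl.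
have lh : l * `|h| < e by apply: le_lt_trans le; rewrite ler_pM2l.
move=> /(_ lh) hC; rewrite -(ler_pM2l (exprn_gt0 d l0)); apply: (le_trans hC).
apply: (@le_trans _ _ (`|C| * (l * M) ^+ d.+1)).
  apply: (@le_trans _ _ (`|C| * (l * `|h|) ^+ d.+1)).
    by rewrite ler_wpM2r ?ler_norm// exprn_ge0// mulr_ge0// ltW.
  by rewrite ler_wpM2l// lerXn2r ?nnegrE ?ler_pM2l// mulr_ge0// ltW.
rewrite exprMn exprSr !mulrA [`|C| * _]mulrC -!mulrA ler_wpM2l ?exprn_ge0 ?ltW//.
rewrite mulrCA; apply: le_lt_trans ly; rewrite ler_pM2l//.
by rewrite /B lerDl.
Unshelve. all: by end_near. Qed.

End Homogeneous.

Section LeadingForm.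
Context {R : realType} {n : nat} {D : set 'rV[R]_n} {x0 : 'rV[R]_n}.
Hypothesis Dx0 : \forall x \near x0, closure D x.
Implicit Types (x : 'rV[R]_n) (p : mpoly n R) (f g : 'rV[R]_n -> R).
Local Notation homog d := (ishomog1 d mdeg).
Local Notation part d := (pihomog mdeg d).

Lemma ev_part k p : (msize p <= k)%N ->
  ev x0 p = fun x => \sum_(d < k) ev x0 (part d p) x.
Proof.
move=> pk; apply/funext => x; rewrite {1}(pihomog_partitionE pk) /ev.
exact: raddf_sum.
Qed.

(** Induction from the lowest degree: once the smaller parts are zero, the part of degree d differs
    from [p] by terms of order d + 1. *)
Lemma part_bigO_eq0 k p : bigO D x0 k (ev x0 p) ->
  forall d, (d < k)%N -> part d p = 0.
Proof.
move=> pO d; elim/ltn_ind: d => d ih dk.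
apply: (homog_bigO_eq0 Dx0 (pihomogP mdeg d p)).
have [dp|dp] := ltnP d (msize p); last first.
  rewrite (_ : part d p = 0); last first.
    rewrite pihomogE big_seq_cond big1// => m /andP[mp /eqP md].
    by have := msize_mdeg_lt mp; rewrite md ltnNge dp.
  by apply: eq_bigO (bigO0 D x0 _) => x _; rewrite /ev meval0.
have rest : bigO D x0 d.+1 (fun x => \sum_(j < msize p | j != Ordinal dp) ev x0 (part j p) x).
  apply: bigO_sum => j jd; have [jd'|] := ltnP j d.
    rewrite (ih _ jd') ?(ltn_trans jd')//.
    by apply: eq_bigO (bigO0 D x0 _) => x _; rewrite /ev meval0.
  rewrite leq_eqVlt => /orP[/eqP dj|dj]; first by case/eqP: jd; apply/val_inj.
  by apply: bigO_le dj _; apply: ev_homog_bigO; exact: pihomogP.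
have := bigOB (bigO_le dk pO) rest; apply: eq_bigO => x _.
by rewrite (ev_part (leqnn _)) (bigD1 (Ordinal dp))//= addrK.
Qed.

Lemma leading_form k f : taylor k D x0 f -> bigO D x0 k f ->
  exists2 p, p \is homog k & bigO D x0 k.+1 (fun x => f x - ev x0 p x).
Proof.
move=> [T fT] fO; exists (part k T); first exact: pihomogP.
have TO : bigO D x0 k (ev x0 T).
  have := bigOB fO (bigO_le (leqnSn k) fT); apply: eq_bigO => x _; ring.
have T0 := part_bigO_eq0 TO.
(* The range is enlarged so that [k] is an index even when [T] has degree less than [k]. *)
have rest : bigO D x0 k.+1 (fun x => \sum_(j < (maxn (msize T) k.+1) | j != k :> nat) ev x0 (part j T) x).
  apply: bigO_sum => j jk; have [jk'|] := ltnP j k.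
    by rewrite (T0 _ jk'); apply: eq_bigO (bigO0 D x0 _) => x _; rewrite /ev meval0.
  rewrite leq_eqVlt eq_sym (negPf jk)/= => kj.
  by apply: bigO_le kj _; apply: ev_homog_bigO; exact: pihomogP.
have := bigOD fT rest; apply: eq_bigO => x _.
have kT : (k < maxn (msize T) k.+1)%N by rewrite leq_max leqnn orbT.
rewrite (ev_part (leq_maxl (msize T) k.+1)) (bigD1 (Ordinal kT))//=.
rewrite (eq_bigl (fun j : 'I__ => j != k :> nat)) => [|j]; ring.
Qed.

Lemma leading_formM k f g p r : p \is homog k -> r \is homog k ->
  bigO D x0 k.+1 (fun x => f x - ev x0 p x) ->
  bigO D x0 k.+1 (fun x => g x - ev x0 r x) ->
  bigO D x0 (k + k).+1 (fun x => f x * g x - ev x0 (p * r) x).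
Proof.
move=> pk rk fp gr.
have fO : bigO D x0 k f.
  by have := bigOD (bigO_le (leqnSn k) fp) (ev_homog_bigO D x0 pk); apply: eq_bigO => x _; rewrite subrK.
have O1 := bigOM fO gr; have O2 := bigOM (ev_homog_bigO D x0 rk) fp.
rewrite -addnS; have := bigOD O1 O2; apply: eq_bigO => x _.
rewrite /ev mevalM; ring.
Qed.

(** Both sides are forms of degree 2k that differ by O(|x - x0|^(2k+1)) along [D]. Two products per
    index are what the real and the imaginary part of a product of complex numbers consist of. *)
Lemma homog_sum_leading (I : finType) k h (f g f' g' : I -> 'rV[R]_n -> R)
    (p r p' r' : I -> mpoly n R) : h \is homog (k + k) ->
  (forall i, [/\ p i \is homog k, r i \is homog k, p' i \is homog k & r' i \is homog k]) ->
  (forall i, bigO D x0 k.+1 (fun x => f i x - ev x0 (p i) x)) ->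
  (forall i, bigO D x0 k.+1 (fun x => g i x - ev x0 (r i) x)) ->
  (forall i, bigO D x0 k.+1 (fun x => f' i x - ev x0 (p' i) x)) ->
  (forall i, bigO D x0 k.+1 (fun x => g' i x - ev x0 (r' i) x)) ->
  (forall x, D x -> ev x0 h x = \sum_i (f i x * g i x + f' i x * g' i x)) ->
  h = \sum_i (p i * r i + p' i * r' i).
Proof.
move=> hk prk fp gr fp' gr' hE; apply/eqP; rewrite -subr_eq0; apply/eqP.
apply: (@homog_bigO_eq0 _ _ D x0 (k + k)%N) => //.
  rewrite rpredB// rpred_sum// => i _; have [? ? ? ?] := prk i.
  by rewrite rpredD// dhomogM.
have O i : bigO D x0 (k + k).+1 (fun x => (f i x * g i x - ev x0 (p i * r i) x) +
     (f' i x * g' i x - ev x0 (p' i * r' i) x)).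
  by have [? ? ? ?] := prk i; apply: bigOD; exact: leading_formM.
have := bigO_sum (index_enum I) (P := xpredT) (fun i _ => O i).
apply: eq_bigO => x Dx; rewrite [RHS]/ev mevalB -!/(ev _ _ _) hE//.
rewrite [in RHS]/ev rmorph_sum/= -sumrB.
by apply: eq_bigr => i _; rewrite /ev mevalD; ring.
Qed.

End LeadingForm.

Local Open Scope complex_scope.
Local Open Scope sesquilinear_scope.

Local Notation Re := complex.Re.
Local Notation Im := complex.Im.

(** * Positive semidefinite matrices *)

(** The kernel of [S] lies in that of [A], and the ranks make it at least as large, so the two
    coincide. *)
Lemma ker_eq_max_rank (F : fieldType) n m (A S : 'M[F]_n) (W : 'M[F]_(m, n)) :
  kermx S *m A = 0 -> (\rank S <= \rank A)%N -> W *m A = 0 -> W *m S = 0.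
Proof.
move=> /sub_kermxP sub rk /sub_kermxP WA; apply/sub_kermxP.
apply: submx_trans WA _; rewrite -(mxrank_leqif_sup sub).2 eqn_leq mxrankS//=.
by rewrite !mxrank_ker leq_sub2l.
Qed.

Section Adjoint.
Context {R : realType}.
Local Notation K := R[i].

Lemma complexP (z z' : K) : Re z = Re z' -> Im z = Im z' -> z = z'.
Proof. by case: z z' => [? ?] [? ?] /= -> ->. Qed.

Lemma Re_sum (I : Type) (r : seq I) (P : pred I) (F : I -> K) :
  Re (\sum_(i <- r | P i) F i) = \sum_(i <- r | P i) Re (F i).
Proof. by apply: (big_morph (@complex.Re R)) => // -[? ?] [? ?]. Qed.

Lemma Im_sum (I : Type) (r : seq I) (P : pred I) (F : I -> K) :
  Im (\sum_(i <- r | P i) F i) = \sum_(i <- r | P i) Im (F i).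
Proof. by apply: (big_morph (@complex.Im R)) => // -[? ?] [? ?]. Qed.

Lemma adjE m n (A : 'M[K]_(m, n)) j k : A^t* j k = conjc (A k j).
Proof. by rewrite !mxE. Qed.

Lemma mxform n (A : 'M[K]_n) (v : 'cV[K]_n) :
  (v^t* *m A *m v) 0 0 = \sum_j \sum_k conjc (v j 0) * A j k * v k 0.
Proof.
rewrite mxE exchange_big/=; apply: eq_bigr => k _; rewrite mxE mulr_suml.
by apply: eq_bigr => j _; rewrite adjE.
Qed.

Lemma adjM m n p (A : 'M[K]_(m, n)) (B : 'M[K]_(n, p)) :
  (A *m B)^t* = B^t* *m A^t*.
Proof. by rewrite trmx_mul map_mxM. Qed.

Lemma adjD m n (A B : 'M[K]_(m, n)) : (A + B)^t* = A^t* + B^t*.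
Proof. by apply/matrixP => j k; rewrite !(adjE, mxE) rmorphD. Qed.

Lemma adjB m n (A B : 'M[K]_(m, n)) : (A - B)^t* = A^t* - B^t*.
Proof. by apply/matrixP => j k; rewrite !(adjE, mxE) rmorphB. Qed.

Lemma adj1 n : (1%:M : 'M[K]_n)^t* = 1%:M.
Proof. by apply/matrixP => j k; rewrite !(adjE, mxE) eq_sym rmorph_nat. Qed.

Lemma adj0 m n : (0 : 'M[K]_(m, n))^t* = 0.
Proof. by apply/matrixP => j k; rewrite !(adjE, mxE) rmorph0. Qed.

Lemma adjK m n (A : 'M[K]_(m, n)) : A^t*^t* = A.
Proof. by apply/matrixP => j k; rewrite !adjE conjcK. Qed.

Lemma adj_sum m n (I : Type) (r : seq I) (F : I -> 'M[K]_(m, n)) :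
  (\sum_(i <- r) F i)^t* = \sum_(i <- r) (F i)^t*.
Proof.
elim: r => [|i r ih]; first by rewrite !big_nil adj0.
by rewrite !big_cons adjD ih.
Qed.

Lemma adj_tens m n p q (A : 'M[K]_(m, n)) (B : 'M[K]_(p, q)) :
  (tensmx A B)^t* = tensmx (A^t*) (B^t*).
Proof. by apply/matrixP => j k; rewrite adjE !mxE rmorphM. Qed.

Lemma hermsymE n (A : 'M[K]_n) : (A \is hermsymmx) = (A^t* == A).
Proof. by rewrite qualifE expr0 scale1r eq_sym. Qed.

Lemma gram_ge0 n m (A : 'M[K]_(n, m)) j : 0 <= (A^t* *m A) j j.
Proof.
rewrite mxE sumr_ge0// => i _; rewrite adjE mulrC.
exact: (mul_conjC_ge0 (A i j)).
Qed.

Lemma gram_eq0 n m (A : 'M[K]_(n, m)) : (forall j, (A^t* *m A) j j = 0) -> A = 0.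
Proof.
move=> A0; apply/matrixP => i j; rewrite mxE.
have /eqP := A0 j; rewrite mxE psumr_eq0 => [/allP/(_ i (mem_index_enum _))/=|l _].
  by rewrite adjE mulrC => h; apply/eqP; rewrite -(mul_conjC_eq0 (A i j)).
by rewrite adjE mulrC; exact: (mul_conjC_ge0 (A l j)).
Qed.

Lemma psd_gram n m (B : 'M[K]_(m, n)) : psdmx (B^t* *m B).
Proof.
split; first by rewrite hermsymE adjM adjK.
by move=> v; rewrite mulmxA -adjM -mulmxA; exact: gram_ge0.
Qed.

Lemma psd_factor n (A : 'M[K]_n) : psdmx A -> exists B : 'M[K]_n, A = B^t* *m B.
Proof.
move=> [Ah Apos]; have An := hermitian_normalmx Ah.
have /orthomx_spectralP AE := An.
set P := spectralmx A in AE; set d := spectral_diag A in AE.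
have PU : P \is unitarymx := spectral_unitarymx A.
rewrite (invmx_unitary PU) in AE; clearbody P d.
have PP : P *m P^t* = 1%:M by apply/unitarymxP.
have d0 j : 0 <= d 0 j.
  have := Apos (P^t* *m delta_mx j 0).
  rewrite adjM adjK AE !mulmxA.
  rewrite -[X in X *m diag_mx d]mulmxA PP mulmx1 -[X in X *m delta_mx _ _]mulmxA PP mulmx1.
  rewrite -mulmxA -colE mxE (bigD1 j)//= big1 => [|i ij].
    by rewrite addr0 !mxE !eqxx/= rmorph1 mul1r.
  by rewrite !mxE (negPf ij)/= rmorph0 mul0r.
exists (diag_mx (map_mx sqrtC d) *m P).
rewrite [LHS]AE adjM mulmxA -[X in _ = X *m P]mulmxA.
suff -> : diag_mx d = (diag_mx (map_mx sqrtC d))^t* *m diag_mx (map_mx sqrtC d) by [].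
apply/matrixP => i j; rewrite [RHS]mxE (bigD1 i)//= big1 => [|l li]; last first.
  by rewrite adjE !mxE (negPf li) rmorph0 mul0r.
rewrite addr0 adjE !mxE eqxx mulr1n; have [->|ij] := eqVneq i j; last by rewrite mulr0n mulr0.
rewrite !mulr1n.
have -> : conjc (sqrtC (d 0 j)) = sqrtC (d 0 j).
  by apply: (CrealP _); apply: ger0_real; rewrite sqrtC_ge0.
by rewrite -expr2 sqrtCK.
Qed.

Lemma psdD n (A B : 'M[K]_n) : psdmx A -> psdmx B -> psdmx (A + B).
Proof.
move=> [Ah A0] [Bh B0]; split.
  by move: Ah Bh; rewrite !hermsymE adjD => /eqP -> /eqP ->.
by move=> v; rewrite mulmxDr mulmxDl mxE addr_ge0.
Qed.

Lemma psd_congr n m (A : 'M[K]_n) (V : 'M[K]_(n, m)) : psdmx A -> psdmx (V^t* *m A *m V).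
Proof. by move=> /psd_factor[B ->]; rewrite mulmxA -adjM -mulmxA; exact: psd_gram. Qed.

Lemma psd_scalar n (c : R) : 0 <= c -> psdmx (c%:C%:M : 'M[K]_n).
Proof.
move=> c0; have := psd_gram ((Num.sqrt c)%:C%:M : 'M[K]_n).
congr psdmx; apply/matrixP => j k; rewrite mul_mx_scalar mxE adjE !mxE eq_sym.
case: eqP => _; last by rewrite !mulr0n rmorph0 mulr0.
by rewrite !mulr1n /= oppr0 -rmorphM/= -expr2 sqr_sqrtr.
Qed.

Lemma psdZ n (l : R) (A : 'M[K]_n) : 0 <= l -> psdmx A -> psdmx (l%:C *: A).
Proof.
move=> l0 /psd_factor[B ->]; have [M ME] := psd_factor (psd_scalar n l0).
have -> : l%:C *: (B^t* *m B) = B^t* *m l%:C%:M *m B by rewrite mul_mx_scalar scalemxAl.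
by rewrite ME mulmxA -adjM -mulmxA; exact: psd_gram.
Qed.

(** The left inverse of [U] makes the coordinate x of a matrix U x U^* recoverable. From A = B^* B
    and a full rank factorization B = X Y, the Gram matrix of [X] is T^* T with [T] invertible, and
    T Y has independent rows. *)
Lemma psd_factor_free n (A : 'M[K]_n) : psdmx A ->
  exists r (U : 'M[K]_(n, r)) (U' : 'M[K]_(r, n)), A = U *m U^t* /\ U' *m U = 1%:M.
Proof.
move=> /psd_factor[B ->].
have [r [X [Y [BE Xfull Yfree]]]] : exists r (X : 'M[K]_(n, r)) (Y : 'M[K]_(r, n)),
    [/\ B = X *m Y, row_full X & row_free Y].
  exists (\rank B), (col_base B), (row_base B).
  by rewrite mulmx_base col_base_full row_base_free.
have [T TE] := psd_factor (psd_gram X).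
have Tunit : T \in unitmx.
  rewrite -row_full_unit -cokermx_eq0; have TN := mulmx_coker T.
  set N := cokermx T in TN *; clearbody N.
  have XN : X *m N = 0.
    apply: gram_eq0 => j; rewrite adjM mulmxA -[X in X *m N]mulmxA TE !mulmxA.
    by rewrite -(mulmxA _ T N) TN mulmx0 mxE.
  by rewrite -(mul1mx N) -(mulVpmx Xfull) -mulmxA XN mulmx0.
have TYfree : row_free (T *m Y) by rewrite /row_free mxrankMfree// mxrank_unit.
exists r, ((T *m Y)^t*), ((pinvmx (T *m Y))^t*); split; last first.
  by rewrite -adjM mulmxVp// adj1.
by rewrite adjK BE !adjM -!mulmxA; congr (_ *m _); rewrite !mulmxA TE.
Qed.

Lemma psdD_ker n m (A B : 'M[K]_n) (W : 'M[K]_(m, n)) :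
  psdmx A -> psdmx B -> W *m (A + B) = 0 -> W *m A = 0.
Proof.
move=> /psd_factor[L ->] /psd_factor[M ->] WLM.
have LM0 : (L *m W^t*)^t* *m (L *m W^t*) + (M *m W^t*)^t* *m (M *m W^t*) = 0.
  by rewrite -[RHS](mul0mx m (W^t*)) -WLM mulmxDr mulmxDl !adjM !adjK !mulmxA.
have LW : L *m W^t* = 0.
  apply: gram_eq0 => j; apply/eqP; rewrite eq_le gram_ge0 andbT.
  move/matrixP/(_ j j)/eqP: LM0; rewrite [X in X == _]mxE [X in _ == X]mxE addr_eq0 => /eqP ->.
  by rewrite oppr_le0 gram_ge0.
by rewrite mulmxA -[W in W *m L^t*]adjK -adjM LW adj0 mul0mx.
Qed.

(** If adding [B] does not raise the rank, then [B] lives on the face of the cone generated by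
    [A]. *)
Lemma psd_max_rank_ker n m (A B : 'M[K]_n) (W : 'M[K]_(m, n)) :
  psdmx A -> psdmx B -> (\rank (A + B)%R <= \rank A)%N -> W *m A = 0 -> W *m B = 0.
Proof.
move=> pA pB rk WA.
have sub : kermx (A + B) *m A = 0 := psdD_ker pA pB (mulmx_ker _).
have := ker_eq_max_rank sub rk WA.
by rewrite mulmxDr WA add0r.
Qed.

Lemma complex_real_ge0 (z : K) : conjc z = z -> (0 <= z) = (0 <= Re z).
Proof.
case: z => x y /= [/eqP]; rewrite eq_sym -addr_eq0 -mulr2n mulrn_eq0/= => /eqP ->.
by rewrite lecE/= eqxx.
Qed.

Lemma conj_form n (A : 'M[K]_n) (v : 'cV[K]_n) : A^t* = A ->
  conjc ((v^t* *m A *m v) 0 0) = (v^t* *m A *m v) 0 0.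
Proof. by move=> AA; rewrite -adjE !adjM adjK AA mulmxA. Qed.

Lemma psdmxE n (A : 'M[K]_n) : psdmx A <->
  A^t* = A /\ forall v : 'cV[K]_n, 0 <= Re ((v^t* *m A *m v) 0 0).
Proof.
split=> [[/eqP Ah Apos]|[Ah Apos]].
  have AA : A^t* = A by apply/eqP; rewrite -hermsymE; apply/eqP.
  by split=> // v; rewrite -complex_real_ge0 ?conj_form.
split; first by rewrite hermsymE Ah.
by move=> v; rewrite complex_real_ge0 ?conj_form.
Qed.

(** The entrywise pairing is the trace of A B^T. With A = L^* L it becomes the sum of the values of
    the form [B] at the transposed rows of [L]. *)
Lemma psd_trace_ge0 n (A B : 'M[K]_n) : psdmx A -> psdmx B ->
  0 <= Re (\sum_j \sum_k A j k * B j k).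
Proof.
move=> /psd_factor[L ->] [_ Bpos].
have -> : \sum_j \sum_k (L^t* *m L) j k * B j k =
    \sum_l (((row l L)^T)^t* *m B *m (row l L)^T) 0 0.
  under [RHS]eq_bigr do rewrite mxform.
  rewrite [RHS]exchange_big/=; apply: eq_bigr => j _.
  rewrite [RHS]exchange_big/=; apply: eq_bigr => k _.
  rewrite mxE mulr_suml; apply: eq_bigr => l _.
  by rewrite adjE !mxE mulrAC.
rewrite Re_sum sumr_ge0// => l _; have := Bpos ((row l L)^T).
by case: (_ 0 0) => [x y]; rewrite lecE/= => /andP[].
Qed.

Lemma Re_form_bound (x a y : K) : Re (conjc x * a * y) <=
  (`|Re a| + `|Im a|) * ((Re x ^+ 2 + Im x ^+ 2) + (Re y ^+ 2 + Im y ^+ 2)).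
Proof.
case: x a y => [x1 x2] [a1 a2] [y1 y2] /=.
have q : forall u w : R, - ((u ^+ 2 + w ^+ 2) / 2) <= u * w <= (u ^+ 2 + w ^+ 2) / 2.
  move=> u w; have := sqr_ge0 (u - w); have := sqr_ge0 (u + w).
  by rewrite !expr2 => ? ?; apply/andP; split; nra.
have h1 : a1 * (x1 * y1 + x2 * y2) <= `|a1| * ((x1 ^+ 2 + x2 ^+ 2) + (y1 ^+ 2 + y2 ^+ 2)).
  apply: (le_trans (ler_norm _)); rewrite normrM ler_wpM2l// ler_norml.
  by have /andP[? ?] := q x1 y1; have /andP[? ?] := q x2 y2; have := sqr_ge0 x1; have := sqr_ge0 x2; have := sqr_ge0 y1; have := sqr_ge0 y2; move=> *; apply/andP; split; lra.
have h2 : a2 * (x2 * y1 - x1 * y2) <= `|a2| * ((x1 ^+ 2 + x2 ^+ 2) + (y1 ^+ 2 + y2 ^+ 2)).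
  apply: (le_trans (ler_norm _)); rewrite normrM ler_wpM2l// ler_norml.
  by have /andP[? ?] := q x2 y1; have /andP[? ?] := q x1 y2; have := sqr_ge0 x1; have := sqr_ge0 x2; have := sqr_ge0 y1; have := sqr_ge0 y2; move=> *; apply/andP; split; lra.
rewrite [X in _ <= X]mulrDl (_ : _ - _ = a1 * (x1 * y1 + x2 * y2) + a2 * (x2 * y1 - x1 * y2)).
  exact: lerD h1 h2.
by ring.
Qed.

Lemma psd_order_unit n (A : 'M[K]_n) : A^t* = A ->
  exists2 M : R, 0 < M & psdmx (M%:C%:M - A).
Proof.
move=> AA; pose c j k := `|Re (A j k)| + `|Im (A j k)|.
have c0 j k : 0 <= c j k by rewrite addr_ge0.
(* The factor 2 bounds |v_j|^2 + |v_k|^2 by twice the squared norm of v; the 1 makes the constant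
   positive for A = 0. *)
pose M := 1 + \sum_j \sum_k 2 * c j k.
have M0 : 0 < M by rewrite ltr_wpDr// sumr_ge0// => j _; rewrite sumr_ge0// => k _; rewrite mulr_ge0.
exists M => //; apply/psdmxE; split.
  rewrite adjB AA; congr (_ - _); apply/matrixP => j k; rewrite adjE !mxE eq_sym.
  by case: eqP => _; rewrite ?mulr1n ?mulr0n ?rmorph0//= oppr0.
move=> v; pose N := \sum_j (Re (v j 0) ^+ 2 + Im (v j 0) ^+ 2).
have Nj j : Re (v j 0) ^+ 2 + Im (v j 0) ^+ 2 <= N.
  by rewrite /N (bigD1 j)//= lerDl sumr_ge0// => i _; rewrite addr_ge0 ?sqr_ge0.
have -> : (v^t* *m (M%:C%:M - A) *m v) 0 0 = (M * N)%:C - (v^t* *m A *m v) 0 0.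
  rewrite mulmxBr mulmxBl mxE [X in _ + X]mxE; congr (_ - _).
  rewrite -mulmxA mul_scalar_mx -scalemxAr mxE rmorphM; congr (_ * _).
  rewrite mxE /N rmorph_sum/=; apply: eq_bigr => j _; rewrite adjE.
  by case: (v j 0) => [x y] /=; apply: complexP => /=; ring.
have -> : Re ((M * N)%:C - (v^t* *m A *m v) 0 0) = M * N - Re ((v^t* *m A *m v) 0 0).
  by case: (_ 0 0).
rewrite subr_ge0 mxform Re_sum mulrDl mul1r -[X in X <= _]add0r lerD//.
  by rewrite sumr_ge0// => j _; rewrite addr_ge0 ?sqr_ge0.
rewrite mulr_suml; apply: ler_sum => j _; rewrite Re_sum mulr_suml; apply: ler_sum => k _.
apply: (le_trans (Re_form_bound _ _ _)); rewrite -/(c j k) [2 * _]mulrC -mulrA ler_wpM2l//.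
by have := Nj j; have := Nj k; lra.
Qed.

End Adjoint.

(** * Positive functionals *)

Section SublinearMinorant.
Context {R : realType} {Y : lmodType R}.
Implicit Types p : Y -> R.

Definition sublinear p : Prop :=
  (forall x y, p (x + y) <= p x + p y) /\ (forall l x, 0 <= l -> p (l *: x) = l * p x).

Lemma sublinear0 p : sublinear p -> p 0 = 0.
Proof. by move=> [_ pZ]; rewrite -(scale0r 0) pZ// mul0r. Qed.

Lemma sublinear_opp p x : sublinear p -> 0 <= p x + p (- x).
Proof. by move=> ps; rewrite -(sublinear0 ps) -(subrr x); exact: ps.1. Qed.

Lemma sublinear_homog p : (forall x y, p (x + y) <= p x + p y) -> p 0 = 0 ->
  (forall l x, 0 < l -> p (l *: x) <= l * p x) -> sublinear p.
Proof.
move=> pD p0 pZ; split=> // l x; rewrite le_eqVlt => /orP[/eqP <-|l0].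
  by rewrite scale0r mul0r.
apply/eqP; rewrite eq_le pZ//= -ler_pdivlMl//.
by apply: le_trans (pZ _ _ _); rewrite ?invr_gt0// scalerA mulVf ?gt_eqF// scale1r.
Qed.

(** The infimum over t >= 0 of p(x + t e) - t p(e) is again sublinear and below p; t = 1 at x = -e
    gives at most -p(e), so it is linear along [e]. *)
Lemma sublinear_step p e : sublinear p ->
  exists p', [/\ sublinear p', forall x, p' x <= p x & p' e + p' (- e) <= 0].
Proof.
move=> ps; have [pD pZ] := ps.
pose A x := [set r | exists2 t, 0 <= t & r = p (x + t *: e) - t * p e].
have A0 x : A x !=set0 by exists (p (x + 0 *: e) - 0 * p e), 0.
have Alb x : has_lbound (A x).
  exists (- p (- x)) => _ [t t0 ->]; have := pD (x + t *: e) (- x).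
  by rewrite addrAC subrr add0r pZ// => h; lra.
have le x t : 0 <= t -> inf (A x) <= p (x + t *: e) - t * p e.
  by move=> t0; apply: ge_inf => //; exists t.
have infP x y : (forall t, 0 <= t -> y <= p (x + t *: e) - t * p e) -> y <= inf (A x).
  by move=> h; apply: lb_le_inf => // _ [t t0 ->]; exact: h.
have lep x : inf (A x) <= p x.
  by have := le x 0 (lexx _); rewrite scale0r addr0 mul0r subr0.
exists (fun x => inf (A x)); split=> //.
- apply: sublinear_homog => [x y||l x l0].
  + rewrite -lerBlDl; apply: (infP) => t t0; rewrite lerBlDl -lerBlDr.
    apply: (infP) => s s0; rewrite lerBlDr; apply: (le_trans (le _ (s + t) _)).
      exact: addr_ge0.
    have := pD (x + s *: e) (y + t *: e); rewrite addrACA -scalerDl mulrDl => h; lra.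
  + apply/eqP; rewrite eq_le; apply/andP; split.
      by rewrite -[X in _ <= X](sublinear0 ps).
    by apply: (infP) => t t0; rewrite add0r pZ// subrr.
  + rewrite -ler_pdivrMl//; apply: (infP) => t t0; rewrite ler_pdivrMl//.
    apply: (le_trans (le _ (l * t) _)); first by rewrite mulr_ge0// ltW.
    by rewrite -scalerA -scalerDr (pZ _ _ (ltW l0)) mulrBr mulrA.
- have := le (- e) 1 ler01; rewrite scale1r addNr (sublinear0 ps) mul1r sub0r.
  have := lep e; lra.
Qed.

(** Hahn-Banach for a finite spanning list, without Zorn's lemma: [sublinear_step] is applied once
    for each vector of the list. Linearity along a vector survives later steps, and the vectors
    along which a sublinear function is linear form a subspace. *)
Lemma sublinear_minorant p (es : seq Y) : sublinear p ->
  (forall L : Y -> Prop, L 0 -> (forall x y, L x -> L y -> L (x + y)) ->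
     (forall l x, L x -> L (l *: x)) -> (forall e, e \in es -> L e) -> forall y, L y) ->
  exists F : Y -> R, [/\ forall x y, F (x + y) = F x + F y,
    forall l x, F (l *: x) = l * F x & forall y, F y <= p y].
Proof.
move=> ps span.
have {ps} [p' [ps p'p pe]] : exists p', [/\ sublinear p', forall x, p' x <= p x &
    forall e, e \in es -> p' e + p' (- e) <= 0].
  elim: es {span} => [|e es [p1 [p1s p1p p1e]]]; first by exists p.
  have [p2 [p2s p21 p2e]] := sublinear_step e p1s.
  exists p2; split=> //; first by move=> x; apply: le_trans (p21 x) _.
  move=> e'; rewrite inE => /orP[/eqP -> //|/p1e].
  by apply: le_trans; rewrite lerD.
have [pD pZ] := ps.
have pN x : p' (- x) = - p' x.
  suff : p' x + p' (- x) <= 0 by have := sublinear_opp x ps; lra.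
  move: x; apply: span => //.
  - by rewrite oppr0 (sublinear0 ps) addr0.
  - move=> x y hx hy; have := pD x y; have := pD (- x) (- y); rewrite -opprD; lra.
  - move=> l x hx; have [l0|l0] := leP 0 l.
      by rewrite -scalerN !pZ// -mulrDr mulr_ge0_le0.
    have l0' : 0 <= - l by rewrite oppr_ge0 ltW.
    have -> : l *: x = (- l) *: (- x) by rewrite scaleNr scalerN opprK.
    by rewrite -scalerN opprK !pZ// -mulrDr addrC mulr_ge0_le0.
exists p'; split=> // [x y|l x].
  apply/eqP; rewrite eq_le pD/=; have := pD (- x) (- y).
  by rewrite -opprD !pN -opprD lerN2.
have [l0|l0] := leP 0 l; first exact: pZ.
by rewrite -[l *: x]opprK pN -scaleNr pZ ?oppr_ge0 ?ltW// mulNr opprK.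
Qed.

End SublinearMinorant.

(** * Positive functionals on Hermitian matrices *)

Section PositiveFunctional.
Context {R : realType} {N : nat}.
Local Notation K := R[i].

Lemma herm_span (L : 'Her[R]_N -> Prop) : L 0 ->
  (forall x y, L x -> L y -> L (x + y)) -> (forall (l : R) x, L x -> L (l *: x)) ->
  (forall j k, L (herm_re j k) /\ L (herm_im j k)) -> forall a, L a.
Proof.
move=> L0 LD LZ Lb a; rewrite (herm_decomp a); apply: (LZ).
elim/big_ind: _ => // j _; elim/big_ind: _ => // k _.
by have [? ?] := Lb j k; apply: (LD); rewrite ptens_scalar; apply: (LZ).
Qed.

Lemma outerE (v : 'cV[K]_N) j k : (v *m v^t*) j k = v j 0 * conjc (v k 0).
Proof. by rewrite mxE big_ord1 adjE. Qed.

Lemma outer_herm_subproof (v : 'cV[K]_N) : hermitianb (v *m v^t* : 'M[(R^o)[i]]_N).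
Proof.
apply/forallP => j; apply/forallP => k; apply/eqP; rewrite !outerE.
by case: (v j 0) (v k 0) => [x y] [z w] /=; congr (_ +i* _); ring.
Qed.

Definition outer_herm (v : 'cV[K]_N) : 'Her[R]_N := Herm (outer_herm_subproof v).

Lemma positive_functional (F : 'Her[R]_N -> R) :
  (forall x y, F (x + y) = F x + F y) -> (forall l x, F (l *: x) = l * F x) ->
  (forall v, 0 <= F (outer_herm v)) ->
  exists w : 'I_N -> 'cV[K]_N, forall a, (F a)%:C = \sum_l ((w l)^t* *m Her_mx a *m w l) 0 0.
Proof.
move=> FD FZ Fpos.
have Fsum (I : Type) (r : seq I) (G : I -> 'Her[R]_N) : F (\sum_(i <- r) G i) = \sum_(i <- r) F (G i).
  elim: r => [|i r ih]; last by rewrite !big_cons FD ih.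
  by rewrite !big_nil -(scale0r 0) FZ mul0r.
(* The matrix that represents [F] in the entrywise pairing: the half comes from [herm_decomp], the
   minus sign from the real part of a product. The value of [F] at v v^* is the form of its
   transpose at v, so the transpose is positive semidefinite. *)
pose M : 'M[K]_N := \matrix_(j, k) ((2^-1 * F (herm_re j k)) +i* (- (2^-1 * F (herm_im j k)))).
have MC j k : M k j = conjc (M j k).
  rewrite !mxE /= opprK.
  have -> : herm_re k j = herm_re j k :> 'Her[R]_N.
    by apply: eq_herm => p q; rewrite !mxE//= addrC.
  have -> : herm_im k j = (-1) *: herm_im j k :> 'Her[R]_N.
    by apply: eq_herm => p q; rewrite !mxE//= ?scaler0// scaleN1r opprB.
  by rewrite FZ; congr (_ +i* _); ring.
have FE a : (F a)%:C = \sum_j \sum_k Her_mx a j k * M j k.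
  have E : F a = \sum_j \sum_k 2^-1 * (Re (hmx a j k) * F (herm_re j k) + Im (hmx a j k) * F (herm_im j k)).
    rewrite {1}(herm_decomp a) FZ Fsum mulr_sumr; apply: eq_bigr => j _.
    rewrite Fsum mulr_sumr; apply: eq_bigr => k _.
    by rewrite FD !ptens_scalar !FZ.
  (* Exchanging the two indices conjugates every term. *)
  have EI : \sum_j \sum_k Im (Her_mx a j k * M j k) = 0.
    have : \sum_j \sum_k Im (Her_mx a j k * M j k) = - \sum_j \sum_k Im (Her_mx a j k * M j k).
      rewrite [LHS]exchange_big/= -sumrN; apply: eq_bigr => j _; rewrite -sumrN; apply: eq_bigr => k _.
      rewrite MC /Her_mx; have := hermRe a j k; have := hermIm a j k.
      case: (hmx a k j) (hmx a j k) (M j k) => [x y] [z w] [u v] /= -> ->; ring.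
    by move=> h; lra.
  apply: complexP => /=.
    rewrite E Re_sum; apply: eq_bigr => j _; rewrite Re_sum; apply: eq_bigr => k _.
    by rewrite mxE /Her_mx; case: (hmx a j k) => [x y] /=; ring.
  by rewrite -[LHS]EI Im_sum; apply: eq_bigr => j _; rewrite Im_sum.
clearbody M; have [|B BE] := @psd_factor _ _ M^T.
  split.
    by rewrite hermsymE; apply/eqP/matrixP => j k; rewrite adjE !mxE (MC j k).
  move=> v; rewrite mxform exchange_big/=.
  have -> : \sum_j \sum_k conjc (v k 0) * M^T k j * v j 0 = (F (outer_herm v))%:C.
    rewrite FE; apply: eq_bigr => j _; apply: eq_bigr => k _.
    by rewrite /Her_mx /= outerE mxE mulrC mulrA.
  by rewrite lecR.
exists (fun l => (row l B)^t*) => a; rewrite FE.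
under [RHS]eq_bigr do rewrite mxform.
rewrite [RHS]exchange_big/=; apply: eq_bigr => j _; rewrite [RHS]exchange_big/=; apply: eq_bigr => k _.
have -> : M j k = (B^t* *m B) k j by rewrite -BE mxE.
rewrite mxE mulr_sumr; apply: eq_bigr => l _; rewrite !(adjE, mxE) conjcK; ring.
Qed.

End PositiveFunctional.

(** * An operator system bounding the smallest one *)

Section LinearFunctions.
Context {R : realType}.

Lemma linear_funD (X Y : lmodType R) (f : X -> Y) : linear f -> forall x y, f (x + y) = f x + f y.
Proof. by move=> fl x y; rewrite -[x]scale1r fl !scale1r. Qed.

Lemma linear_fun0 (X Y : lmodType R) (f : X -> Y) : linear f -> f 0 = 0.
Proof. by move=> fl; apply: (addrI (f 0)); rewrite -linear_funD// !addr0. Qed.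

Lemma linear_funZ (X Y : lmodType R) (f : X -> Y) : linear f -> forall l x, f (l *: x) = l *: f x.
Proof.
by move=> fl l x; rewrite -[l *: x]addr0 fl linear_fun0// addr0.
Qed.

End LinearFunctions.

(** * Closed sets and interior points in the finest locally convex topology *)

Section FlcTopology.
Context {R : realType}.

Lemma cvx_shrink (X : lmodType R) (T : set X) a y (e e' : R) : cvx_subset T ->
  T a -> T (a + e *: y) -> 0 < e -> 0 <= e' <= e -> T (a + e' *: y).
Proof.
move=> cT Ta Te e0 /andP[e'0 e'e].
have -> : a + e' *: y = (e' / e) *: (a + e *: y) + (1 - e' / e) *: a.
  rewrite scalerDr addrAC -scalerDl addrC [e' / e + _]addrC subrK scale1r.
  by rewrite scalerA mulfVK ?gt_eqF// addrC.
by apply: cT => //; rewrite divr_ge0 ?(ltW e0)//= ler_pdivrMr// mul1r.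
Qed.

Lemma cone_cvx (X : lmodType R) (T : set X) : convex_cone T -> cvx_subset T.
Proof.
move=> [_ TD TZ] x y l Tx Ty /andP[l0 l1].
by apply: TD; apply: TZ => //; rewrite subr_ge0.
Qed.

Lemma flc_closed_preimage (X Y : lmodType R) (f : X -> Y) (A : set Y) :
  (forall x y, f (x + y) = f x + f y) -> (forall l x, f (l *: x) = l *: f x) ->
  closed (A : set (flc Y)) -> closed (f @^-1` A : set (flc X)).
Proof.
move=> fD fZ cA; rewrite -openC flc_openE => x nAx.
have : flc_open (~` A) by rewrite -flc_openE openC.
move=> /(_ (f x) nAx)[W [cW aW WA]]; exists (f @^-1` W); split.
- by move=> u v l Wu Wv l01; rewrite /preimage/= fD !fZ; exact: cW.
- by move=> u; have [e e0 We] := aW (f u); exists e => // l le; rewrite /preimage/= fZ; exact: We.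
- by move=> w Ww; rewrite /preimage/= fD; exact: WA.
Qed.

Lemma flc_closed_ge0 (X : lmodType R) (f : X -> R) :
  (forall x y, f (x + y) = f x + f y) -> (forall l x, f (l *: x) = l * f x) ->
  closed ([set x | 0 <= f x] : set (flc X)).
Proof.
move=> fD fZ; rewrite -openC flc_openE => x /negP; rewrite -ltNge => fx0.
exists [set w | f w < - f x]; split.
- move=> u v l /= fu fv /andP[l0 l1]; rewrite fD !fZ.
  have [->|l0'] := eqVneq l 0; first by rewrite mul0r subr0 mul1r add0r.
  have lp : 0 < l by rewrite lt_def l0'.
  have := ltr_pM2l lp (f u) (- f x); rewrite fu.
  have := ler_wpM2l (_ : 0 <= 1 - l) (ltW fv); rewrite subr_ge0 => /(_ l1).
  by move=> h h'; have := h'; move=> /idP h''; lra.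
- move=> u; exists (- f x / (`|f u| + 1)).
    by rewrite divr_gt0 ?oppr_gt0// ltr_wpDl.
  move=> l; rewrite ler_pdivlMr ?ltr_wpDl// => h /=; rewrite fZ.
  have [->|l0] := eqVneq l 0; first by rewrite mul0r oppr_gt0.
  apply: (le_lt_trans (ler_norm _)); apply: lt_le_trans h.
  by rewrite normrM ltr_pM2l ?normr_gt0// ltrDl.
- by move=> w /=; rewrite fD => fw; apply/negP; rewrite -ltNge; lra.
Qed.

(** For a convex set, algebraic interior points are topological ones: the set of all of them is
    open. *)
Lemma flc_interiorP (X : lmodType R) (T : set X) x0 :
  cvx_subset T -> (forall y, exists2 e : R, 0 < e & T (x0 + e *: y)) ->
  (T : set (flc X))° x0.
Proof.
move=> cT Tx0.
pose A := [set a | forall y : X, exists2 e : R, 0 < e & T (a + e *: y)].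
have AT a : A a -> T a by move=> /(_ 0)[e _]; rewrite scaler0 addr0.
rewrite /interior nbhsE; exists A; last by move=> a /AT.
split=> //; rewrite flc_openE => a Aa.
(* The factor 2 leaves room for a midpoint: a + w + (e/2) y is the mean of a + 2 w and a + e y. *)
exists [set w | T (a + 2 *: w)]; split.
- move=> x y l Tx Ty l01 /=.
  have -> : a + 2 *: (l *: x + (1 - l) *: y) = l *: (a + 2 *: x) + (1 - l) *: (a + 2 *: y).
    rewrite !scalerDr !scalerA addrACA -scalerDl addrC [l + _]addrC subrK scale1r.
    by rewrite addrC ![_ * 2]mulrC.
  exact: cT.
- move=> y; have [e e0 Te] := Aa y; have [f f0 Tf] := Aa (- y).
  exists (Num.min e f / 2); first by rewrite divr_gt0// lt_min e0.
  move=> l; rewrite ler_pdivlMr// le_min => /andP[le lf] /=.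
  have [l0|l0] := leP 0 l.
    rewrite scalerA; apply: (cvx_shrink cT (AT _ Aa) Te e0).
    by rewrite mulr_ge0//= mulrC; apply: le_trans le; rewrite ler_wpM2r// ler_norm.
  rewrite scalerA -[2 * l]opprK scaleNr -scalerN; apply: (cvx_shrink cT (AT _ Aa) Tf f0).
  by move: lf; rewrite ltr0_norm// => lf; apply/andP; split; lra.
- move=> w /= Tw y; have [e e0 Te] := Aa y; exists (e / 2); first by rewrite divr_gt0.
  have -> : a + w + (e / 2) *: y = 2^-1 *: (a + 2 *: w) + (1 - 2^-1) *: (a + e *: y).
    have h : 1 - 2^-1 = 2^-1 :> R by lra.
    rewrite h !scalerDr !scalerA mulVf// scale1r addrACA -scalerDl.
    have -> : 2^-1 + 2^-1 = 1 :> R by lra.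
    by rewrite scale1r addrA mulrC.
  by apply: cT => //; apply/andP; split; lra.
Qed.

Lemma flc_interior_absorbing (X : lmodType R) (T : set X) x0 :
  (T : set (flc X))° x0 -> forall y, exists2 e : R, 0 < e & T (x0 + e *: y).
Proof.
rewrite /interior nbhsE => -[A [oA Ax0] AT] y.
have /(_ x0 Ax0)[W [_ aW WA]] : flc_open A by rewrite -flc_openE.
have [e e0 We] := aW y; exists e => //; apply/AT/WA/We.
by rewrite gtr0_norm.
Qed.

End FlcTopology.

(** * Compressions as linear maps, determined by pure tensors *)

Section CompressionTheory.
Context {R : realType}.
Local Notation K := R[i].

Lemma herm_of_subproof t (A : 'M[K]_t) : A^t* = A -> hermitianb (A : 'M[(R^o)[i]]_t).
Proof.
move=> AA; apply/forallP => j; apply/forallP => k; apply/eqP.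
by rewrite -{1}AA adjE; case: (A j k).
Qed.

Definition herm_of t (A : 'M[K]_t) (AA : A^t* = A) : 'Her[R]_t := Herm (herm_of_subproof AA).

Lemma Her_mxK t (A : 'Her[R]_t) : (Her_mx A)^t* = Her_mx A.
Proof. by apply/eqP; rewrite -hermsymE; exact: Her_mx_hermsym. Qed.

Lemma Her_mxD n (A B : 'Her[R]_n) : Her_mx (A + B) = Her_mx A + Her_mx B.
Proof. by apply/matrixP => j k; rewrite !mxE/=; case: (hmx A j k) (hmx B j k) => [? ?] [? ?]. Qed.

Lemma Her_mxZ n l (A : 'Her[R]_n) : Her_mx (l *: A) = l%:C *: Her_mx A.
Proof.
apply/matrixP => j k; rewrite !mxE/= /Her_mx; case: (hmx A j k) => [x y].
by apply: complexP => /=; rewrite -![_ *: _]/(_ * _); ring.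
Qed.

Lemma Her_mx_sum t (I : Type) (s : seq I) (F : I -> 'Her[R]_t) :
  Her_mx (\sum_(i <- s) F i) = \sum_(i <- s) Her_mx (F i).
Proof.
elim: s => [|i s ih].
  by rewrite !big_nil; apply/matrixP => j k; rewrite [RHS]mxE /Her_mx mxE.
by rewrite !big_cons -ih; exact: Her_mxD.
Qed.

Lemma linear_herm_ext (X W : lmodType R) s (g h : herm X s -> W) :
  linear g -> linear h -> (forall x A, g (ptens x A) = h (ptens x A)) -> g =1 h.
Proof.
move=> gl hl gh a; rewrite (herm_decomp a).
rewrite (linear_funZ gl) (linear_funZ hl); congr (_ *: _).
elim/big_rec: _ => [|j y _ ih]; first by rewrite !linear_fun0.
rewrite (linear_funD gl) (linear_funD hl) ih; congr (_ + _).
elim/big_rec: _ => [|k z _ ih']; first by rewrite !linear_fun0.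
by rewrite !(linear_funD gl) !(linear_funD hl) ih' !gh.
Qed.

Lemma hmap_linear (X Y : lmodType R) s (phi : {linear X -> Y}) : linear (hmap (s := s) phi).
Proof. by move=> l a b; apply: eq_herm => j k; rewrite !mxE/= ?mxE/= linearP. Qed.

Lemma ptensDl (X : lmodType R) s (x y : X) (A : 'Her[R]_s) : ptens (x + y) A = ptens x A + ptens y A :> herm X s.
Proof. exact: (linear_funD (ptens_linearl (X := X) A)). Qed.

Lemma ptensDr (X : lmodType R) s (x : X) (A B : 'Her[R]_s) : ptens x (A + B) = ptens x A + ptens x B.
Proof. exact: (linear_funD (ptens_linearr x)). Qed.

Lemma ptensZl (X : lmodType R) s (l : R) (x : X) (A : 'Her[R]_s) : ptens (l *: x) A = l *: ptens x A :> herm X s.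
Proof. exact: (linear_funZ (ptens_linearl (X := X) A)). Qed.

Lemma ptensZr (X : lmodType R) s (l : R) (x : X) (A : 'Her[R]_s) : ptens x (l *: A) = l *: ptens x A.
Proof. exact: (linear_funZ (ptens_linearr x)). Qed.

Lemma compress_linear (X : lmodType R) s t (V : 'M[K]_(s, t)) :
  linear (compress (X := X) V).
Proof.
move=> l a b; apply: eq_herm => j k; rewrite !mxE/= ?mxE/=.
  rewrite scaler_sumr -big_split/=; apply: eq_bigr => p _.
  rewrite scaler_sumr -big_split/=; apply: eq_bigr => q _.
  rewrite !mxE/= ?mxE/= !scalerDr !scalerN !scalerA ![_ * l]mulrC opprD.
  by rewrite addrACA.
rewrite scaler_sumr -big_split/=; apply: eq_bigr => p _.
rewrite scaler_sumr -big_split/=; apply: eq_bigr => q _.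
rewrite !mxE/= ?mxE/= !scalerDr !scalerA ![_ * l]mulrC.
by rewrite addrACA.
Qed.

Lemma conj_hermsym s t (V : 'M[K]_(s, t)) (A : 'Her[R]_s) :
  (V^t* *m Her_mx A *m V)^t* = V^t* *m Her_mx A *m V.
Proof. by rewrite !adjM adjK Her_mxK mulmxA. Qed.

Definition conj_herm s t (V : 'M[K]_(s, t)) (A : 'Her[R]_s) : 'Her[R]_t :=
  herm_of (conj_hermsym V A).

Lemma compress_ptensE (X : lmodType R) s t (V : 'M[K]_(s, t)) (x : X) A :
  compress V (ptens x A) = ptens x (conj_herm V A).
Proof. exact: compress_ptens. Qed.

Lemma compress_comp (X : lmodType R) s t u (V : 'M[K]_(t, u)) (W : 'M[K]_(s, t)) (a : herm X s) :
  compress V (compress W a) = compress (W *m V) a.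
Proof.
apply: (@linear_herm_ext _ _ s (fun a => compress V (compress W a))) => [l x y||x A].
- by rewrite !compress_linear.
- exact: compress_linear.
- rewrite !compress_ptensE; congr ptens; apply: val_inj => /=.
  by rewrite adjM !mulmxA.
Qed.

Lemma compress1 (X : lmodType R) s (a : herm X s) : compress 1%:M a = a.
Proof.
apply: (@linear_herm_ext _ _ s (compress 1%:M) id) => [||x A].
- exact: compress_linear.
- by [].
- rewrite compress_ptensE; congr ptens; apply: val_inj => /=.
  by rewrite adj1 mul1mx mulmx1.
Qed.

Lemma Her_mx_unitB s (M : R) (A : 'Her[R]_s) :
  Her_mx (M *: herm_of (@adj1 R s) - A) = M%:C%:M - Her_mx A.
Proof.
apply/matrixP => j k; rewrite /Her_mx !mxE/=.
by apply: complexP; rewrite /= ?mxE/=; case: eqP => _; case: (hmx A j k) => [x y] /=; rewrite ?mulr1n ?mulr0n/= -![_ *: _]/(_ * _) ?mulr1 ?mulr0.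
Qed.

Lemma psd_Her_unit s (A : 'Her[R]_s) :
  exists2 M : R, 0 < M & psdmx (Her_mx (M *: herm_of (@adj1 R s) - A)).
Proof.
have [M M0 MP] := psd_order_unit (Her_mxK A).
exists M; first exact: M0.
rewrite Her_mx_unitB; exact: MP.
Qed.

End CompressionTheory.

Lemma mean_cancel (R : realType) (V : lmodType R) (p r q z : V) (S m : R) : S != 0 ->
  p + (m / S) *: z =
  (2 * S)^-1 *: (S *: p + r + (q + m *: z) + (S *: p - r + (m *: z - q))).
Proof.
have cancel (a b c e : V) : a + b + (c + e) + (a - b + (e - c)) = (a + a) + (e + e).
  by rewrite addrACA (addrACA a b) subrr addr0 (addrC c e) (addrACA e c) subrr addr0.
move=> S0; rewrite cancel.
have dbl (x : V) : x + x = (2 : R) *: x by rewrite -[x in LHS]scale1r -scalerDl.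
rewrite !dbl scalerDr !scalerA; congr (_ + _ *: _).
  rewrite -[LHS]scale1r; congr (_ *: _); field; exact: S0.
field; exact: S0.
Qed.

(** * The test system *)

Section TestSystem.
Context {R : realType} {X : lmodType R} (C : set X) (t : nat) (phi : {linear X -> 'Her[R]_t}).
Local Notation K := R[i].

Definition entry (b : herm X 1) : X := Re (hmx b 0 0).

(** The functional [x (x) A |-> sum_(j, k) A_(j, k) phi(x)_(j, k)]. *)
Definition pairing (b : herm X t) : R := \sum_j \sum_k
  (Re (Her_mx (phi (Re (hmx b j k))) j k) - Im (Her_mx (phi (Im (hmx b j k))) j k)).

(** The first condition alone describes the largest operator system with base cone [C]; it keeps the
    cones pointed and the base cone inside [C]. Pure tensors of positive factors satisfy both
    conditions, which gives interior points and the rest of the base cone. *)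
Definition test_system : levels X := fun s => [set a |
  (forall V : 'M[K]_(s, 1), C (entry (compress V a))) /\
  (forall V : 'M[K]_(s, t), 0 <= pairing (compress V a))].

Lemma pairing_linear : linear (pairing : herm X t -> R^o).
Proof.
move=> l a b; rewrite /pairing scaler_sumr -big_split/=; apply: eq_bigr => j _.
rewrite scaler_sumr -big_split/=; apply: eq_bigr => k _.
rewrite /Her_mx !mxE/= !linearP !mxE/= ?mxE/=.
rewrite -![_ *: _]/(_ * _).
ring.
Qed.

Lemma entry_linear : linear entry.
Proof. by move=> l a b; rewrite /entry !mxE/= ?mxE. Qed.

Lemma pairing_ptens x A :
  pairing (ptens x A) = Re (\sum_j \sum_k Her_mx A j k * Her_mx (phi x) j k).
Proof.
rewrite Re_sum; apply: eq_bigr => j _; rewrite Re_sum; apply: eq_bigr => k _.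
rewrite /Her_mx !mxE/= !linearZ/= !mxE/=.
by case: (hmx A j k) (hmx (phi x) j k) => [? ?] [? ?].
Qed.

Lemma pairing_conj_herm s x (V : 'M[K]_(s, t)) A :
  pairing (compress V (ptens x A)) =
  Re (\sum_j \sum_k (V^t* *m Her_mx A *m V) j k * Her_mx (phi x) j k).
Proof. by rewrite compress_ptensE pairing_ptens. Qed.

Lemma entry_ptens s (V : 'M[K]_(s, 1)) x A :
  entry (compress V (ptens x A)) = Re ((V^t* *m Her_mx A *m V) 0 0) *: x.
Proof. by rewrite compress_ptensE /entry !mxE. Qed.

Hypothesis Cproper : proper_cone C.
Hypothesis phiC : forall x, C x -> psdmx (Her_mx (phi x)).

Lemma test_system_pure s x (A : 'Her[R]_s) : C x -> psdmx (Her_mx A) ->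
  test_system (ptens x A).
Proof.
move=> Cx pA; have [[_ _ CZ] _ _ _] := Cproper; split=> V.
  rewrite entry_ptens; apply: CZ => //.
  by have := (psd_congr V pA).2 1%:M; rewrite adj1 mul1mx mulmx1; case: (_ 0 0) => [a b]; rewrite lecE/= => /andP[].
rewrite pairing_conj_herm; apply: psd_trace_ge0; last exact: phiC.
exact: psd_congr.
Qed.

Lemma test_system_compress s u (V : 'M[K]_(s, u)) (a : herm X s) :
  test_system a -> test_system (compress V a).
Proof. by move=> [aC ap]; split=> W; rewrite compress_comp. Qed.

Lemma entry_compress_linear s (V : 'M[K]_(s, 1)) : linear (fun a : herm X s => entry (compress V a)).
Proof. by move=> l a b; rewrite compress_linear entry_linear. Qed.

Lemma pairing_compress_linear s (V : 'M[K]_(s, t)) :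
  linear (fun a : herm X s => pairing (compress V a) : R^o).
Proof. by move=> l a b; rewrite compress_linear pairing_linear. Qed.

Lemma test_system_cone s : convex_cone (@test_system s).
Proof.
have [[C0 CD CZ] _ _ _] := Cproper.
pose eD s (V : 'M[K]_(s, 1)) := linear_funD (entry_compress_linear V).
pose eZ s (V : 'M[K]_(s, 1)) := linear_funZ (entry_compress_linear V).
pose pD s (V : 'M[K]_(s, t)) := linear_funD (pairing_compress_linear V).
pose pZ s (V : 'M[K]_(s, t)) := linear_funZ (pairing_compress_linear V).
split=> [|a b [aC ap] [bC bp]|l a l0 [aC ap]]; split=> V.
- by rewrite (linear_fun0 (entry_compress_linear V)).
- by rewrite (linear_fun0 (pairing_compress_linear V)).
- by rewrite eD; exact: CD.
- by rewrite pD addr_ge0.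
- by rewrite eZ; exact: CZ.
- by rewrite pZ mulr_ge0.
Qed.

Lemma test_system_closed s : closed (@test_system s : set (flc (herm X s))).
Proof.
have [_ _ Cc _] := Cproper.
have -> : @test_system s =
   (\bigcap_(V in [set: 'M[K]_(s, 1)]) ((fun a : herm X s => entry (compress V a)) @^-1` C)) `&`
   (\bigcap_(V in [set: 'M[K]_(s, t)]) [set a : herm X s | 0 <= pairing (compress V a)]).
  by apply/seteqP; split=> a [aC ap]; split=> V *; [exact: aC|exact: ap|exact: aC|exact: ap].
apply: (@closedI (flc (herm X s))); apply: (@closed_bigI (flc (herm X s))) => V _.
  apply: flc_closed_preimage Cc.
    exact: (linear_funD (entry_compress_linear V)).
  exact: (linear_funZ (entry_compress_linear V)).
apply: flc_closed_ge0.
  exact: (linear_funD (pairing_compress_linear V)).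
exact: (linear_funZ (pairing_compress_linear V)).
Qed.

(** The real part of the sesquilinear expression v^* a w; compressions to level 1 give its diagonal
    values. *)
Definition polar s (a : herm X s) (v w : 'cV[K]_s) : X := \sum_p \sum_q
  (Re (conjc (v p 0) * w q 0) *: Re (hmx a p q) - Im (conjc (v p 0) * w q 0) *: Im (hmx a p q)).

Lemma polarDl s (a : herm X s) v v' w : polar a (v + v') w = polar a v w + polar a v' w.
Proof.
rewrite /polar -big_split/=; apply: eq_bigr => p _; rewrite -big_split/=; apply: eq_bigr => q _.
rewrite mxE rmorphD mulrDl; case: (_ * _) (_ * _) => [x y] [z w'] /=.
by rewrite !scalerDl opprD addrACA.
Qed.

Lemma polarDr s (a : herm X s) v w w' : polar a v (w + w') = polar a v w + polar a v w'.
Proof.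
rewrite /polar -big_split/=; apply: eq_bigr => p _; rewrite -big_split/=; apply: eq_bigr => q _.
rewrite mxE mulrDr; case: (_ * _) (_ * _) => [x y] [z w''] /=.
by rewrite !scalerDl opprD addrACA.
Qed.

Lemma polar_delta s (a : herm X s) (x y : K) j k :
  polar a (x *: delta_mx j 0) (y *: delta_mx k 0) =
  Re (conjc x * y) *: Re (hmx a j k) - Im (conjc x * y) *: Im (hmx a j k).
Proof.
rewrite /polar (bigD1 j)//= [X in _ + X]big1 ?addr0 => [|p pj].
  rewrite (bigD1 k)//= [X in _ + X]big1 ?addr0 => [|q qk]; first by rewrite !mxE !eqxx !mulr1.
  by rewrite !mxE !eqxx (negPf qk) !mulr0 !scale0r subr0.
apply: big1 => q _; rewrite !mxE (negPf pj) mulr0 rmorph0 mul0r !scale0r subr0//.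
Qed.

Lemma entry_compress s (a : herm X s) (V : 'cV[K]_s) : entry (compress V a) = polar a V V.
Proof. by rewrite /entry !mxE. Qed.

Lemma test_system_pointed s : @test_system s `&` [set a | test_system (- a)] = [set 0].
Proof.
have [[C0 CD CZ] Cpt _ _] := Cproper.
apply/seteqP; split=> [a [[aC _] [naC _]]|_ ->]; last first.
  by split => /=; rewrite ?oppr0; have [] := test_system_cone s.
have a0 V : polar a V V = 0.
  rewrite -entry_compress; suff : (C `&` [set x | C (- x)]) (entry (compress V a)) by rewrite Cpt.
  split; first exact: aC.
  by have := naC V; rewrite -scaleN1r (linear_funZ (entry_compress_linear V)) scaleN1r.
(* Polarization at e_j + y e_k, whose two cross terms agree by Hermitian symmetry. Then y = 1 and y
   = i kill the real and the imaginary part of the entry. *)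
have key (y : K) j k : Re y *: Re (hmx a j k) - Im y *: Im (hmx a j k) = 0.
  have := a0 (1 *: delta_mx j 0 + y *: delta_mx k 0).
  rewrite !(polarDl, polarDr) !a0 add0r addr0 !polar_delta rmorph1 mul1r mulr1.
  rewrite (hermRe a j k) (hermIm a j k); case: y => u v /=.
  rewrite scaleNr scalerN opprK -mulr2n => /eqP.
  rewrite -[_ *+ 2](scaler_nat 2) scaler_eq0 pnatr_eq0/= => /eqP.
  by [].
apply: eq_herm => j k; rewrite mxE/=.
  by have := key 1 j k; rewrite /= scale1r scale0r subr0.
by have /eqP := key (0 +i* 1) j k; rewrite /= scale1r scale0r sub0r oppr_eq0 => /eqP.
Qed.

Lemma test_system_interior s : (@test_system s : set (flc (herm X s)))° !=set0.
Proof.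
have [Ccone _ _ [c0 c0C]] := Cproper; have [C0 CD CZ] := Ccone.
have c0C' := flc_interior_absorbing c0C.
have Cc0 : C c0 by have [e _] := c0C' 0; rewrite scaler0 addr0.
have Tcone := test_system_cone s; have [TC0 TCD TCZ] := Tcone.
pose I : 'Her[R]_s := herm_of (@adj1 R s).
have pI : psdmx (Her_mx I).
  by have := psd_gram (1%:M : 'M[K]_s); rewrite adj1 mul1mx.
have TI : test_system (ptens c0 I) by exact: test_system_pure.
exists (ptens c0 I); apply: flc_interiorP; first exact: cone_cvx.
have cvx := cone_cvx Tcone.
(* The admissible directions are closed under sums and positive multiples, so pure tensors
   suffice. *)
pose P (y : herm X s) := exists2 e : R, 0 < e & test_system (ptens c0 I + e *: y).
have PD y y' : P y -> P y' -> P (y + y').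
  move=> [e e0 Te] [e' e'0 Te']; have m0 : 0 < Num.min e e' by rewrite lt_min e0.
  exists (Num.min e e' / 2); first by rewrite divr_gt0.
  have -> : ptens c0 I + (Num.min e e' / 2) *: (y + y') =
    2^-1 *: (ptens c0 I + Num.min e e' *: y) + (1 - 2^-1) *: (ptens c0 I + Num.min e e' *: y').
    have -> : 1 - 2^-1 = 2^-1 :> R by lra.
    rewrite -scalerDr addrACA -scalerDr [X in _ = X]scalerDr scalerA; congr (_ + _ *: _); last exact: mulrC.
    by rewrite -[X in _ *: (X + X)]scale1r -scalerDl scalerA mulVf ?scale1r.
  apply: (cvx); last by apply/andP; split; lra.
    by apply: cvx_shrink Te _ _ => //; rewrite (ltW m0) ge_min lexx.
  by apply: cvx_shrink Te' _ _ => //; rewrite (ltW m0) ge_min lexx orbT.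
have PZ l y : 0 < l -> P y -> P (l *: y).
  move=> l0 [e e0 Te]; exists (e / l); first by rewrite divr_gt0.
  by rewrite scalerA divfK ?gt_eqF.
have P0 : P 0 by exists 1 => //; rewrite scaler0 addr0.
have Ppure x A : P (ptens x A).
  have [e e0 Ce] := c0C' x; have [e' e'0 Ce'] := c0C' (- x).
  pose m := Num.min e e'; have m0 : 0 < m by rewrite lt_min e0.
  have Cm : C (c0 + m *: x).
    by apply: cvx_shrink (cone_cvx Ccone) _ Ce _ _ => //; rewrite (ltW m0)/= ge_min lexx.
  have Cm' : C (c0 - m *: x).
    rewrite -scalerN; apply: cvx_shrink (cone_cvx Ccone) _ Ce' _ _ => //.
    by rewrite (ltW m0)/= ge_min lexx orbT.
  have [M1 M10 pM1] := psd_Her_unit A; have [M2 M20 pM2] := psd_Her_unit (- A).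
  have pM : psdmx (Her_mx ((M1 + M2) *: I - A)) /\ psdmx (Her_mx ((M1 + M2) *: I - (- A))).
    rewrite !Her_mx_unitB in pM1 pM2 *; split.
      have -> : (M1 + M2)%:C%:M - Her_mx A = (M1%:C%:M - Her_mx A) + M2%:C%:M.
        by rewrite rmorphD raddfD/= addrAC.
      exact: psdD pM1 (psd_scalar _ (ltW M20)).
    have -> : (M1 + M2)%:C%:M - Her_mx (- A) = (M2%:C%:M - Her_mx (- A)) + M1%:C%:M.
      by rewrite [M1 + M2]addrC rmorphD raddfD/= addrAC.
    exact: psdD pM2 (psd_scalar _ (ltW M10)).
  have S0 : 0 < M1 + M2 by rewrite addr_gt0.
  set S := M1 + M2 in pM S0 *.
  exists (m / (M1 + M2)); first by rewrite divr_gt0.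
  (* In the sum of (c0 + m x) (x) (S I + A) and (c0 - m x) (x) (S I - A) the mixed terms cancel and
     2 S c0 (x) I + 2 m x (x) A remains; all four factors are positive. *)
  have -> : ptens c0 I + (m / S) *: ptens x A = (2 * S)^-1 *:
     (ptens (c0 + m *: x) (S *: I - (- A)) + ptens (c0 - m *: x) (S *: I - A)).
    have -> : ptens (c0 + m *: x) (S *: I - (- A)) =
        S *: ptens c0 I + ptens c0 A + (S *: (m *: ptens x I) + m *: ptens x A).
      by rewrite opprK !(ptensDl, ptensDr) !(ptensZl, ptensZr).
    have -> : ptens (c0 - m *: x) (S *: I - A) =
        S *: ptens c0 I - ptens c0 A + (m *: ptens x A - S *: (m *: ptens x I)).
      rewrite -scaleNr -[- A]scaleN1r !(ptensDl, ptensDr) !(ptensZl, ptensZr) !scaleN1r.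
      by rewrite !scaleNr !scalerN opprK [- _ + m *: _]addrC.
    by apply: mean_cancel; exact: lt0r_neq0.
  apply: TCZ; first by rewrite invr_ge0 mulr_ge0// ltW.
  apply: TCD; [exact: (test_system_pure Cm pM.2)|exact: (test_system_pure Cm' pM.1)].
move=> y; rewrite (herm_decomp y); apply: PZ => //.
elim/big_ind: _ => // j _; elim/big_ind: _ => // k _.
by apply: PD; exact: Ppure.
Qed.

Lemma test_system_base : base_cone test_system = C.
Proof.
apply/seteqP; split=> x.
  move=> [/(_ 1%:M) + _]; rewrite entry_ptens adj1 mul1mx mulmx1.
  by rewrite /Her_mx/= mxE/= scale1r.
move=> Cx; apply: test_system_pure => //.
have -> : Her_mx Her1 = (1%:M : 'M[K]_1)^t* *m 1%:M.
  by rewrite adj1 mul1mx; apply/matrixP => j k; rewrite !mxE !ord1.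
exact: psd_gram.
Qed.

Lemma test_system_operator_system : operator_system test_system.
Proof.
split=> [s _|s u _ _ V a]; last exact: test_system_compress.
split; [exact: test_system_cone|exact: test_system_pointed|
  exact: test_system_closed|exact: test_system_interior].
Qed.

Lemma min_system_pairing_ge0 (a : herm X t) :
  min_operator_system C a -> 0 <= pairing a.
Proof.
move=> /(_ _ test_system_operator_system test_system_base)[_ /(_ 1%:M)].
by rewrite compress1.
Qed.

End TestSystem.

(** * Completely positive extension *)

(** Hahn-Banach for p(y) = inf of f(c) over the [c] that dominate [y]. This is finite because every
    [y] is dominated and because [f] is nonnegative on whatever dominates 0. *)
Lemma dominated_functional (R : realType) (E Y : lmodType R) (es : seq Y)
    (f : E -> R) (dom : E -> Y -> Prop) :
  (forall x y, f (x + y) = f x + f y) -> (forall l x, f (l *: x) = l * f x) ->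
  (forall c y c' y', dom c y -> dom c' y' -> dom (c + c') (y + y')) ->
  (forall l c y, 0 <= l -> dom c y -> dom (l *: c) (l *: y)) ->
  (forall c, dom c 0 -> 0 <= f c) -> (forall y, exists c, dom c y) ->
  (forall L : Y -> Prop, L 0 -> (forall x y, L x -> L y -> L (x + y)) ->
     (forall (l : R) x, L x -> L (l *: x)) -> (forall e, e \in es -> L e) -> forall y, L y) ->
  exists F : Y -> R, [/\ forall x y, F (x + y) = F x + F y,
    forall l x, F (l *: x) = l * F x & forall c y, dom c y -> F y <= f c].
Proof.
move=> fD fZ domD domZ dom0 domT span.
have [c0 dc0] := domT 0; have f0 : f 0 = 0 by rewrite -(scale0r 0) fZ mul0r.
have dom00 : dom 0 0 by have := domZ 0 _ _ (lexx _) dc0; rewrite !scale0r.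
pose A y := [set s | exists2 c, dom c y & s = f c].
have A0 y : A y !=set0 by have [c dc] := domT y; exists (f c), c.
have Alb y : has_lbound (A y).
  have [c' dc'] := domT (- y); exists (- f c') => _ [c dc ->].
  by have := domD _ _ _ _ dc dc'; rewrite subrr => /dom0; rewrite fD; lra.
have le c y : dom c y -> inf (A y) <= f c by move=> dc; apply: ge_inf => //; exists c.
have infP y s : (forall c, dom c y -> s <= f c) -> s <= inf (A y).
  by move=> h; apply: lb_le_inf => // _ [c dc ->]; exact: h.
have ps : sublinear (fun y => inf (A y)).
  apply: sublinear_homog => [x y||l x l0].
  - rewrite -lerBlDl; apply: (infP) => c dc; rewrite lerBlDl -lerBlDr.
    apply: (infP) => c' dc'; rewrite lerBlDr addrC -fD; apply: le.
    by rewrite addrC; exact: domD.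
  - apply/eqP; rewrite eq_le; apply/andP; split; first by rewrite -f0; exact: le.
    by apply: (infP) => c /dom0.
  - rewrite -ler_pdivrMl//; apply: (infP) => c dc; rewrite ler_pdivrMl// -fZ.
    by apply: le; apply: domZ => //; exact: ltW.
have [F [FD FZ Fp]] := sublinear_minorant ps span.
by exists F; split=> // c y dc; apply: le_trans (Fp y) (le _ _ dc).
Qed.

Section Kron.
Context {R : realType} {d s : nat}.
Local Notation K := R[i].

Lemma kronD (a b : herm 'Her[R]_d s) : kron (a + b) = kron a + kron b.
Proof.
apply/matrixP => p q; rewrite !mxE/= ?mxE/= /Her_mx ?mxE/=.
case: (hmx (Re (hmx a _ _)) _ _) (hmx (Re (hmx b _ _)) _ _) (hmx (Im (hmx a _ _)) _ _)
  (hmx (Im (hmx b _ _)) _ _) => [? ?] [? ?] [? ?] [? ?].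
by apply: complexP => /=; ring.
Qed.

Lemma kronZ (l : R) (a : herm 'Her[R]_d s) : kron (l *: a) = l%:C *: kron a.
Proof.
apply/matrixP => p q; rewrite !mxE/= ?mxE/= /Her_mx ?mxE/=.
case: (hmx (Re (hmx a _ _)) _ _) (hmx (Im (hmx a _ _)) _ _) => [? ?] [? ?].
by apply: complexP => /=; rewrite -![_ *: _]/(_ * _); ring.
Qed.

End Kron.

Section Dilation.
Context {R : realType} {Z : lmodType R} {d t r : nat}.
Local Notation K := R[i].
Context (gamma : {linear Z -> 'Her[R]_d}) (f : herm Z t -> R).
Context (z1 : Z) (U : 'M[K]_(d, r)).
Hypothesis fD : forall x y, f (x + y) = f x + f y.
Hypothesis fZ : forall l x, f (l *: x) = l * f x.
Hypothesis f_ge0 : forall c, psdmx (kron (hmap gamma c)) -> 0 <= f c.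
Hypothesis z1E : Her_mx (gamma z1) = U *m U^t*.

Let UU : 'M[K]_(d * t, r * t) := tensmx U 1%:M.

Lemma kron_sandwich (z : Z) (x : 'M[K]_r) (A : 'Her[R]_t) :
  Her_mx (gamma z) = U *m x *m U^t* ->
  kron (hmap gamma (ptens z A)) = UU *m tensmx x (Her_mx A) *m UU^t*.
Proof.
move=> zE; rewrite hmap_ptens kron_ptens zE /UU adj_tens adj1.
by rewrite !tensmx_mul mul1mx mulmx1.
Qed.

Let dom (c : herm Z t) (y : 'Her[R]_(r * t)) : Prop :=
  psdmx (kron (hmap gamma c) - UU *m Her_mx y *m UU^t*).

(** A tensor [c] dominates [y] when its image under gamma exceeds [y] transported by U (x) 1. The
    extension lives on the matrices over the face, not on all those of size [d * t]. *)
Lemma positive_extension : exists w : 'I_(r * t) -> 'cV[K]_(r * t),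
  forall (z : Z) (x : 'M[K]_r) (A : 'Her[R]_t), x^t* = x ->
    Her_mx (gamma z) = U *m x *m U^t* ->
    (f (ptens z A))%:C = \sum_l ((w l)^t* *m tensmx x (Her_mx A) *m w l) 0 0.
Proof.
pose es : seq 'Her[R]_(r * t) :=
  [seq herm_re p.1 p.2 | p <- enum {: 'I_(r * t) * 'I_(r * t)}] ++
  [seq herm_im p.1 p.2 | p <- enum {: 'I_(r * t) * 'I_(r * t)}].
have h0 : hmap gamma (0 : herm Z t) = 0 by exact: (linear_fun0 (hmap_linear gamma)).
have k0 : kron (0 : herm 'Her[R]_d t) = 0 by have := kronZ 0 (0 : herm 'Her[R]_d t); rewrite rmorph0 !scale0r.
have H0 : Her_mx (0 : 'Her[R]_(r * t)) = 0 by have := Her_mxZ 0 (0 : 'Her[R]_(r * t)); rewrite rmorph0 !scale0r.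
have [|||||||F [FD FZ Fdom]] := @dominated_functional R (herm Z t) 'Her[R]_(r * t) es f dom.
- exact: fD.
- exact: fZ.
- move=> c y c' y' dc dc'; rewrite /dom (linear_funD (hmap_linear gamma)) kronD Her_mxD mulmxDr mulmxDl opprD addrACA.
  exact: (psdD dc dc').
- move=> l c y l0 dc; rewrite /dom (linear_funZ (hmap_linear gamma)) kronZ Her_mxZ -scalemxAr -scalemxAl -scalerBr.
  exact: (psdZ l0 dc).
- by move=> c; rewrite /dom H0 mulmx0 mul0mx subr0 => /f_ge0.
- move=> y; have [M M0 MP] := psd_order_unit (Her_mxK y).
  (* The point [z1] corresponds to the identity of the face, so its tensor with M I dominates any
     [y] bounded by M. *)
  exists (ptens z1 (M *: herm_of (@adj1 R t))); rewrite /dom.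
  rewrite (@kron_sandwich _ 1%:M) ?mulmx1//.
  have -> : tensmx 1%:M (Her_mx (M *: herm_of (@adj1 R t))) = M%:C%:M :> 'M[K]_(r * t).
    rewrite Her_mxZ; apply/matrixP => p q; rewrite !mxE.
    have [->|pq] := eqVneq p q; first by rewrite !eqxx mul1r mulr1.
    have [p1|//] := eqVneq (mxtens_unindex p).1 (mxtens_unindex q).1; last by rewrite mul0r.
    have [p2|//] := eqVneq (mxtens_unindex p).2 (mxtens_unindex q).2; last by rewrite !mulr0.
    case/eqP: pq; rewrite -[p]mxtens_unindexK -[q]mxtens_unindexK.
    by rewrite [mxtens_unindex p]surjective_pairing p1 p2 -surjective_pairing.
  rewrite -mulmxBl -mulmxBr -[X in X *m _ *m _]adjK.
  exact: (psd_congr _ MP).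
- move=> L L0 LD LZ Le; apply: herm_span => // j k; split; apply: Le; rewrite mem_cat.
    by apply/orP; left; apply/mapP; exists (j, k); rewrite ?mem_enum.
  by apply/orP; right; apply/mapP; exists (j, k); rewrite ?mem_enum.
have F0 : F 0 = 0 by have := FZ 0 0; rewrite scale0r mul0r.
have f0 : f 0 = 0 by have := fZ 0 0; rewrite scale0r mul0r.
have FN y : F (- y) = - F y by rewrite -scaleN1r FZ mulN1r.
have fN c : f (- c) = - f c by rewrite -scaleN1r fZ mulN1r.
have HN (y : 'Her[R]_(r * t)) : Her_mx (- y) = - Her_mx y.
  by rewrite -[- y]scaleN1r Her_mxZ rmorphN rmorph1 scaleN1r.
have [v|w wE] := positive_functional FD FZ.
  (* Since 0 dominates -v v^*, the functional is nonnegative at v v^*. *)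
  have : dom 0 (- outer_herm v).
    rewrite /dom h0 k0 HN sub0r mulmxN mulNmx opprK.
    have := psd_gram ((UU *m v)^t*); rewrite adjK adjM !mulmxA; exact.
  by move=> /Fdom; rewrite FN f0 oppr_le0.
exists w => z x A xx zE.
have yy : (tensmx x (Her_mx A))^t* = tensmx x (Her_mx A) by rewrite adj_tens xx Her_mxK.
rewrite -[tensmx _ _]/(Her_mx (herm_of yy)) -wE; congr (_%:C).
have psd0 : psdmx (0 : 'M[K]_(d * t)).
  by have := psd_gram (0 : 'M[K]_(d * t)); rewrite mulmx0.
(* Here the domination is an equality, so it also holds for the negatives, and the two inequalities
   force equality of the functionals. *)
have dp : dom (ptens z A) (herm_of yy).
  by rewrite /dom (kron_sandwich _ zE) subrr.
have dn : dom (- ptens z A) (- herm_of yy).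
  rewrite /dom -[- ptens z A]scaleN1r (linear_funZ (hmap_linear gamma)) kronZ (kron_sandwich _ zE).
  rewrite HN mulmxN mulNmx.
  by rewrite rmorphN1 scaleN1r subrr; exact: psd0.
apply/eqP; rewrite eq_le (Fdom _ _ dp) andbT.
by have := Fdom _ _ dn; rewrite FN fN lerN2.
Qed.

End Dilation.

(** * From vectors on a tensor product to matrices *)

Section TensorForms.
Context {R : realType}.
Local Notation K := R[i].

Definition unvec r t (w : 'cV[K]_(r * t)) : 'M[K]_(r, t) :=
  \matrix_(i, j) w (mxtens_index (i, j)) 0.

Lemma sum_mxtens r t (F : 'I_(r * t) -> K) :
  \sum_p F p = \sum_i \sum_j F (mxtens_index (i, j)).
Proof.
rewrite (reindex (@mxtens_index r t)); last first.
  by exists (@mxtens_unindex r t) => p _; [exact: mxtens_indexK|exact: mxtens_unindexK].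
by rewrite pair_bigA; apply: eq_bigr => -[i j] _.
Qed.

Lemma tens_form r t (w : 'cV[K]_(r * t)) (x : 'M[K]_r) (A : 'M[K]_t) :
  (w^t* *m tensmx x A *m w) 0 0 =
  \sum_j \sum_k A j k * ((unvec w)^t* *m x *m unvec w) j k.
Proof.
rewrite mxform sum_mxtens exchange_big/=; apply: eq_bigr => j _.
transitivity (\sum_i \sum_k \sum_l conjc (w (mxtens_index (i, j)) 0) * (x i l * A j k) * w (mxtens_index (l, k)) 0).
  apply: eq_bigr => i _; rewrite sum_mxtens exchange_big/=; apply: eq_bigr => k _.
  by apply: eq_bigr => l _; rewrite tensmxE.
rewrite exchange_big/=; apply: eq_bigr => k _.
rewrite mxE mulr_sumr exchange_big/=; apply: eq_bigr => l _.
rewrite mxE mulr_suml mulr_sumr; apply: eq_bigr => i _.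
by rewrite adjE !mxE; ring.
Qed.

(** Testing with the transpose of D = M - N, which is Hermitian, turns the pairing with [D] into the
    sum of the squared moduli of its entries. *)
Lemma herm_trace_inj t (M N : 'M[K]_t) : M^t* = M -> N^t* = N ->
  (forall A : 'Her[R]_t, Re (\sum_j \sum_k Her_mx A j k * M j k) =
     Re (\sum_j \sum_k Her_mx A j k * N j k)) -> M = N.
Proof.
move=> MM NN h; apply/eqP; rewrite -subr_eq0; apply/eqP.
set D := M - N; have DD : D^t* = D by rewrite adjB MM NN.
have E j k : conjc (D j k) = D k j by rewrite -adjE DD.
have DT : (D^T)^t* = D^T.
  by apply/matrixP => j k; rewrite adjE [D^T k j]mxE [RHS]mxE E.
have := h (herm_of DT); rewrite [Her_mx _]/(D^T) => {}h.
have sq (z : K) : Re (conjc z * z) = Re z ^+ 2 + Im z ^+ 2 by case: z => u v /=; ring.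
have D0 : \sum_j \sum_k (Re (D j k) ^+ 2 + Im (D j k) ^+ 2) = 0.
  transitivity (Re (\sum_j \sum_k D^T j k * M j k) - Re (\sum_j \sum_k D^T j k * N j k)).
    rewrite !Re_sum -sumrB; apply: eq_bigr => j _; rewrite !Re_sum -sumrB; apply: eq_bigr => k _.
    rewrite -sq E [D^T j k]mxE; have -> : D j k = M j k - N j k by rewrite !mxE.
    by rewrite mulrBr; case: (_ * M j k) (_ * N j k) => [? ?] [? ?].
  by rewrite h subrr.
have nn j k : 0 <= Re (D j k) ^+ 2 + Im (D j k) ^+ 2 by rewrite addr_ge0 ?sqr_ge0.
apply/matrixP => j k; rewrite [RHS]mxE.
move/eqP: D0; rewrite psumr_eq0 => [/allP/(_ j (mem_index_enum _))/=|i _]; last exact: sumr_ge0.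
rewrite psumr_eq0 => [/allP/(_ k (mem_index_enum _))/=|i _]; last exact: nn.
by rewrite paddr_eq0 ?sqr_ge0// !sqrf_eq0 => /andP[/eqP ? /eqP ?]; exact: complexP.
Qed.

End TensorForms.

(** * Points, face and positive maps of a lift *)

Section LiftModel.
Context {R : realType} {X Z : lmodType R} {d : nat}.
Local Notation K := R[i].
Context (C : set X) (pi : {linear Z -> X}) (gamma : {linear Z -> 'Her[R]_d}).
Hypothesis Cproper : proper_cone C.
Hypothesis lift : is_lift (min_operator_system C) (@psd_system R d) pi gamma.

Lemma psd_kron1 (b : herm 'Her[R]_d 1) : psdmx (kron b) -> psdmx (Her_mx (Re (hmx b 0 0))).
Proof.
move=> pb; pose e : 'I_d -> 'I_(d * 1) := fun i => mxtens_index (i, 0).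
pose P : 'M[K]_(d * 1, d) := \matrix_(p, i) (p == e i)%:R.
have := psd_congr P pb; congr psdmx; apply/matrixP => i j.
have im0 : Im (hmx b 0 0) = 0.
  have := hermIm b 0 0; move/eqP; rewrite -addr_eq0 -mulr2n -scaler_nat scaler_eq0 pnatr_eq0/=.
  by move/eqP.
have -> : (P^t* *m kron b *m P) i j = kron b (e i) (e j).
  rewrite mxE (bigD1 (e j))//= big1 ?addr0 => [|p pj]; last by rewrite [P p j]mxE (negPf pj) mulr0.
  rewrite [P _ j]mxE eqxx mulr1 mxE (bigD1 (e i))//= big1 ?addr0 => [|p pi']; last first.
    by rewrite adjE [P p i]mxE (negPf pi') rmorph0 mul0r.
  by rewrite adjE [P _ i]mxE eqxx rmorph1 mul1r.
rewrite mxE /kron_entry !mxtens_indexK/= im0 [LHS]mxE [X in _ + X]mxE.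
by rewrite [Her_mx 0 i j]mxE/= mulr0 addr0.
Qed.

Lemma lift_points y : C y -> exists z, pi z = y /\ psdmx (Her_mx (gamma z)).
Proof.
move=> Cy; have [_ /(_ 1%N isT) S1] := lift.
have : min_operator_system C (ptens y Her1).
  by move=> T oT TC; have := Cy; rewrite -{1}TC.
rewrite S1 => -[c pc cy]; exists (Re (hmx c 0 0)); split.
  by have := congr1 (fun b : herm X 1 => Re (hmx b 0 0)) cy; rewrite /= !mxE/= ?mxE/= scale1r.
by have := psd_kron1 pc; rewrite mxE/=.
Qed.

(** A positive semidefinite value of maximal rank spans the face: adding any other such value cannot
    raise the rank, so that value vanishes on the kernel of the first. *)
Lemma lift_face : exists r (U : 'M[K]_(d, r)) (z1 : Z), Her_mx (gamma z1) = U *m U^t* /\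
  forall z, psdmx (Her_mx (gamma z)) ->
    exists2 x, psdmx x & Her_mx (gamma z) = U *m x *m U^t*.
Proof.
pose P k := `[< exists z, psdmx (Her_mx (gamma z)) /\ \rank (Her_mx (gamma z)) = k >].
have exP : exists k, P k.
  exists (\rank (Her_mx (gamma 0))); apply/asboolP; exists 0; split=> //.
  by have := psd_gram (0 : 'M[K]_d); rewrite mulmx0; congr psdmx; rewrite linear0; apply/matrixP => j k; rewrite !mxE.
have Pd k : P k -> (k <= d)%N by move=> /asboolP[z [_ <-]]; exact: rank_leq_row.
case: (ex_maxnP exP Pd) => k /asboolP[z1 [p1 r1]] kmax.
have [r [U [U' [GE U'U]]]] := psd_factor_free p1.
exists r, U, z1; split=> // z pz.
set G := Her_mx (gamma z) in pz *.
have WG : (1%:M - U *m U') *m G = 0.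
  apply: (psd_max_rank_ker p1 pz); last first.
    by rewrite GE mulmxA mulmxBl mul1mx -mulmxA U'U mulmx1 subrr mul0mx.
  rewrite r1; apply: kmax; apply/asboolP; exists (z1 + z).
  have -> : Her_mx (gamma (z1 + z)) = Her_mx (gamma z1) + G by exact: etrans (congr1 (@Her_mx R d) (linearD gamma z1 z)) (Her_mxD _ _).
  by split; first exact: (psdD p1 pz).
have {}WG : G = U *m U' *m G.
  by apply/eqP; rewrite -subr_eq0 -[X in X - _]mul1mx -mulmxBl WG.
exists (U' *m G *m U'^t*).
  by have := psd_congr (U'^t*) pz; rewrite adjK.
have GG : G^t* = G := Her_mxK (gamma z).
have /(congr1 (fun A => A^t*)) := WG; rewrite !adjM GG => WG'.
by rewrite {1}WG {1}WG' !mulmxA.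
Qed.

(** Pairing with phi after pi is nonnegative on the positive tensors of the lift, so it extends to a
    positive functional. Its representing vectors, read as [r] by [t] matrices, are the V_l. *)
Lemma cp_representation r (U : 'M[K]_(d, r)) z1 t (phi : {linear X -> 'Her[R]_t}) :
  Her_mx (gamma z1) = U *m U^t* -> (0 < t)%N ->
  (forall x, C x -> psdmx (Her_mx (phi x))) ->
  exists N (V : 'I_N -> 'M[K]_(r, t)), forall z x, x^t* = x ->
    Her_mx (gamma z) = U *m x *m U^t* ->
    Her_mx (phi (pi z)) = \sum_l (V l)^t* *m x *m V l.
Proof.
move=> z1E t0 phiC; pose f (c : herm Z t) := pairing phi (hmap pi c).
have fl : linear (f : herm Z t -> R^o).
  by move=> l a b; rewrite /f hmap_linear pairing_linear.
have f_ge0 c : psdmx (kron (hmap gamma c)) -> 0 <= f c.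
  move=> pc; apply: (min_system_pairing_ge0 Cproper phiC).
  by rewrite lift.2//; exists c.
have [w wE] := positive_extension (linear_funD fl) (linear_funZ fl) f_ge0 z1E.
exists (r * t)%N, (fun l => unvec (w l)) => z x xx zE.
apply: herm_trace_inj.
- exact: Her_mxK.
- rewrite adj_sum; apply: eq_bigr => l _.
  by rewrite !adjM adjK xx mulmxA.
- move=> A; have := wE z x A xx zE; rewrite /f hmap_ptens pairing_ptens => /(congr1 (@complex.Re R)) /= ->.
  congr (Re _); under eq_bigr do rewrite tens_form.
  rewrite exchange_big/=; apply: eq_bigr => j _.
  rewrite exchange_big/=; apply: eq_bigr => k _.
  by rewrite summxE mulr_sumr.
Qed.

End LiftModel.

(** * Sums of squares from Taylor expansions *)

Lemma taylor_le (R : realType) n j k (D : set 'rV[R]_n) x0 f :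
  (j <= k)%N -> taylor k D x0 f -> taylor j D x0 f.
Proof. by move=> jk [T fT]; exists T; apply: bigO_le fT. Qed.

Lemma taylor_sum (R : realType) n k (D : set 'rV[R]_n) x0 (I : Type) (r : seq I)
    (F : I -> 'rV[R]_n -> R) :
  (forall i, taylor k D x0 (F i)) -> taylor k D x0 (fun x => \sum_(i <- r) F i x).
Proof.
move=> FT; elim: r => [|i r ih].
  by under eq_fun do rewrite big_nil; exact: taylor_cst.
by under eq_fun do rewrite big_cons; exact: taylorD.
Qed.

Lemma bigO_sqr (R : realType) n k (D : set 'rV[R]_n) x0 (f g : 'rV[R]_n -> R) :
  (forall x, D x -> f x ^+ 2 <= g x) -> bigO D x0 (k + k) g -> bigO D x0 k f.
Proof.
move=> fg [C gC]; exists (`|C| + 1); near=> x => Dx.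
have C0 : 0 <= (`|C| + 1) * `|x - x0| ^+ k by rewrite mulr_ge0// exprn_ge0.
rewrite -ler_sqr ?nnegrE// real_normK ?num_real//; apply: (le_trans (fg _ Dx)).
apply: (le_trans (ler_norm _)); apply: (@le_trans _ _ (C * `|x - x0| ^+ (k + k))).
  by move: Dx; near: x.
rewrite exprMn -exprM muln2 -addnn ler_wpM2r ?exprn_ge0//.
by apply: (le_trans (ler_norm _)); have := normr_ge0 C; nra.
Unshelve. all: by end_near. Qed.

Lemma meval_map (A B : comNzRingType) (f : {rmorphism A -> B}) n (v : 'I_n -> A)
    (w : 'I_n -> B) (p : mpoly n A) :
  (forall j, w j = f (v j)) -> meval w (map_mpoly f p) = f (meval v p).
Proof.
move=> wE; elim/mpolyind: p => [|c m p _ _ ih]; first by rewrite !raddf0.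
rewrite raddfD/= !mevalD rmorphD ih; congr (_ + _).
rewrite map_mpolyZ map_mpolyX !mevalZ !mevalX rmorphM rmorph_prod/=.
by congr (_ * _); apply: eq_bigr => i _; rewrite rmorphXn wE.
Qed.

Lemma complex_parts (R : realType) (u v : R) : u%:C + (0 +i* 1) * v%:C = u +i* v.
Proof. by congr (_ +i* _) => /=; ring. Qed.

Section ComplexPolynomials.
Context {R : realType} {n : nat}.
Local Notation K := R[i].
Implicit Types (a x : 'rV[R]_n).
Local Notation homog d := (ishomog1 d mdeg).

Definition ceval a (p : mpoly n K) : K := meval (fun j => (a 0 j)%:C) p.

Definition mpolyRe (p : mpoly n K) : mpoly n R := \sum_(m <- msupp p) Re (mcoeff m p) *: mpolyX R m.
Definition mpolyIm (p : mpoly n K) : mpoly n R := \sum_(m <- msupp p) Im (mcoeff m p) *: mpolyX R m.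

Lemma ReM_real (z : K) (c : R) : Re (z * c%:C) = Re z * c.
Proof. by case: z => u v /=; rewrite mulr0 subr0. Qed.
Lemma ImM_real (z : K) (c : R) : Im (z * c%:C) = Im z * c.
Proof. by case: z => u v /=; rewrite mulr0 add0r. Qed.

Lemma monom_real a (m : multinom n) :
  \prod_i (a 0 i)%:C ^+ m i = (\prod_i a 0 i ^+ m i)%:C :> K.
Proof. by rewrite rmorph_prod; apply: eq_bigr => i _; rewrite rmorphXn. Qed.

Lemma Re_ceval a (p : mpoly n K) : Re (ceval a p) = meval (fun j => a 0 j) (mpolyRe p).
Proof.
rewrite /ceval mevalE Re_sum /mpolyRe rmorph_sum/=; apply: eq_bigr => m _.
by rewrite monom_real ReM_real mevalZ mevalX.
Qed.

Lemma Im_ceval a (p : mpoly n K) : Im (ceval a p) = meval (fun j => a 0 j) (mpolyIm p).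
Proof.
rewrite /ceval mevalE Im_sum /mpolyIm rmorph_sum/=; apply: eq_bigr => m _.
by rewrite monom_real ImM_real mevalZ mevalX.
Qed.

Lemma mpolyRe_homog d (p : mpoly n K) : p \is homog d -> mpolyRe p \is homog d.
Proof.
move=> /dhomogP pd; rewrite /mpolyRe big_seq rpred_sum// => m mp.
by apply: rpredZ; rewrite dhomogX; apply/eqP/pd.
Qed.

Lemma mpolyIm_homog d (p : mpoly n K) : p \is homog d -> mpolyIm p \is homog d.
Proof.
move=> /dhomogP pd; rewrite /mpolyIm big_seq rpred_sum// => m mp.
by apply: rpredZ; rewrite dhomogX; apply/eqP/pd.
Qed.

Lemma ceval_eq0 (p : mpoly n K) : (forall a, ceval a p = 0) -> p = 0.
Proof.
move=> p0; apply: mpoly_nat_eq0 => v; rewrite -[RHS](p0 (\row_j (v j)%:R)).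
by apply: meval_eq => j; rewrite mxE rmorph_nat.
Qed.

Lemma psdmx_diag_ge0 t (A : 'M[K]_t) j : psdmx A -> 0 <= Re (A j j).
Proof.
move=> [_ /(_ (delta_mx j 0))].
rewrite -mulmxA -colE mxE (bigD1 j)//= big1 => [|i ij].
  by rewrite addr0 !mxE !eqxx/= rmorph1 mul1r; case: (A j j) => u v; rewrite lecE/= => /andP[].
by rewrite !mxE (negPf ij)/= rmorph0 mul0r.
Qed.

(** The pair [p] runs over a summand and a row of w V_i; [a] and [b] are the real and imaginary
    parts of the entries in that row. *)
Lemma sos_of_taylor r t N d (H : 'M[mpoly n K]_t) (D : set 'rV[R]_n) x0
    (w : 'rV[R]_n -> 'M[K]_r) (V : 'I_N -> 'M[K]_(r, t)) :
  (forall j l, H j l \is homog d) -> (forall a, psdmx (evalmp a H)) ->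
  (\forall x \near x0, closure D x) ->
  (forall x, D x -> evalmp (x - x0) H =
     \sum_i (w x *m V i)^t* *m (w x *m V i)) ->
  (forall i j, taylor d D x0 (fun x => Re (w x i j))) ->
  (forall i j, taylor d D x0 (fun x => Im (w x i j))) ->
  sos_mp H.
Proof.
move=> Hd Hpsd Dx0 HE wRe wIm.
pose a (p : 'I_N * 'I_r) j x := Re ((w x *m V p.1) p.2 j).
pose b (p : 'I_N * 'I_r) j x := Im ((w x *m V p.1) p.2 j).
pose hre j l := mpolyRe (H j l); pose him j l := mpolyIm (H j l).
have aT p j : taylor d D x0 (a p j).
  rewrite /a; under eq_fun do rewrite mxE Re_sum.
  apply: taylor_sum => l.
  have := taylorD (taylorM (wRe p.2 l) (taylor_cst d D x0 (Re (V p.1 l j))))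
    (taylorM (wIm p.2 l) (taylor_cst d D x0 (- Im (V p.1 l j)))).
  congr taylor; apply/funext => x.
  by case: (w x _ _) (V _ _ _) => [? ?] [? ?] /=; rewrite mulrN.
have bT p j : taylor d D x0 (b p j).
  rewrite /b; under eq_fun do rewrite mxE Im_sum.
  apply: taylor_sum => l.
  have := taylorD (taylorM (wRe p.2 l) (taylor_cst d D x0 (Im (V p.1 l j))))
    (taylorM (wIm p.2 l) (taylor_cst d D x0 (Re (V p.1 l j)))).
  congr taylor; apply/funext => x.
  by case: (w x _ _) (V _ _ _) => [? ?] [? ?].
have HE' x j l : D x -> ceval (x - x0) (H j l) =
    \sum_p conjc ((w x *m V p.1) p.2 j) * (w x *m V p.1) p.2 l.
  move=> /HE /matrixP/(_ j l); rewrite mxE => E.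
  rewrite [LHS](E : ceval (x - x0) (H j l) = _).
  rewrite summxE -(pair_bigA _ (fun i s => conjc ((w x *m V i) s j) * (w x *m V i) s l))/=.
  apply: eq_bigr => i _; rewrite mxE; apply: eq_bigr => s _.
  by rewrite !mxE.
have reE x j l : D x -> ev x0 (hre j l) x = \sum_p (a p j x * a p l x + b p j x * b p l x).
  move=> Dx; rewrite -[LHS]Re_ceval (HE' _ _ _ Dx) Re_sum; apply: eq_bigr => p _.
  by rewrite /a /b; case: (_ p.2 j) (_ p.2 l) => [? ?] [? ?] /=; ring.
have imE x j l : D x -> ev x0 (him j l) x = \sum_p (a p j x * b p l x + (- b p j x) * a p l x).
  move=> Dx; rewrite -[LHS]Im_ceval (HE' _ _ _ Dx) Im_sum; apply: eq_bigr => p _.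
  by rewrite /a /b; case: (_ p.2 j) (_ p.2 l) => [? ?] [? ?] /=; ring.
have hreH j l : hre j l \is homog d by exact: mpolyRe_homog.
have himH j l : him j l \is homog d by exact: mpolyIm_homog.
have [k dk] : exists k, d = (odd d + (k + k))%N.
  by exists d./2; rewrite addnn odd_double_half.
(* In odd degree a nonnegative form is zero, so all the squares vanish on [D], hence H = 0 and the
   empty sum represents it. *)
have [dodd|deven] := boolP (odd d).
  have ab0 x p j : D x -> a p j x = 0 /\ b p j x = 0.
    move=> Dx; have := reE x j j Dx.
    have pos y : 0 <= ev 0 (hre j j) y.
      by rewrite -[X in 0 <= X]Re_ceval; have := psdmx_diag_ge0 j (Hpsd (y - 0)); rewrite mxE.
    have -> : ev x0 (hre j j) x = 0.
      have := pos (x - x0); have := pos (x0 - x); rewrite /ev !subr0.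
      have -> : meval (fun l => (x0 - x) 0 l) (hre j j) = - meval (fun l => (x - x0) 0 l) (hre j j).
        rewrite (@meval_eq _ _ _ (fun l => -1 * (x - x0) 0 l)) => [|l]; last by rewrite !mxE; ring.
        by rewrite (meval_homog _ _ (hreH j j)) -signr_odd dodd/= expr1 mulN1r.
      by move=> ? ?; lra.
    move/esym/eqP; rewrite psumr_eq0 => [/allP/(_ p (mem_index_enum _))/=|i _]; last by rewrite -!expr2 addr_ge0 ?sqr_ge0.
    by rewrite -!expr2 paddr_eq0 ?sqr_ge0// !sqrf_eq0 => /andP[/eqP -> /eqP ->].
  have h0 (h : mpoly n R) : h \is homog d -> (forall x, D x -> ev x0 h x = 0) -> h = 0.
    move=> hd hD; apply: (homog_bigO_eq0 Dx0 hd).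
    by apply: eq_bigO (bigO0 D x0 _) => x Dx; rewrite hD.
  exists 0%N, (fun=> 0%N), (fun=> 0); rewrite big_ord0; apply/matrixP => j l.
  rewrite mxE; apply: ceval_eq0 => y; apply: complexP.
    rewrite Re_ceval -/(hre j l) (h0 (hre j l)) ?meval0// => x Dx.
    by rewrite reE// big1// => p _; have [-> ->] := ab0 x p j Dx; rewrite !mul0r addr0.
  rewrite Im_ceval -/(him j l) (h0 (him j l)) ?meval0// => x Dx.
  by rewrite imE// big1// => p _; have [-> ->] := ab0 x p j Dx; rewrite oppr0 !mul0r addr0.
move: dk; rewrite (negPf deven) add0n => dk.
have kd : (k <= d)%N by rewrite dk leq_addr.
(* The diagonal entries bound the square of each entry of column j, which halves the order; the
   off-diagonal entries follow from the same leading forms. *)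
have diagO j : bigO D x0 (k + k) (ev x0 (hre j j)).
  by rewrite -dk; exact: ev_homog_bigO.
have abO p j : bigO D x0 k (a p j) /\ bigO D x0 k (b p j).
  have le x : D x -> a p j x ^+ 2 + b p j x ^+ 2 <= ev x0 (hre j j) x.
    move=> Dx; rewrite reE// (bigD1 p)//= -!expr2 lerDl sumr_ge0// => i _.
    by rewrite -!expr2 addr_ge0 ?sqr_ge0.
  split; apply: (bigO_sqr _ (diagO j)) => x /le; apply: le_trans.
    by rewrite lerDl sqr_ge0.
  by rewrite lerDr sqr_ge0.
have /choice[qa qaP] : forall pj, exists q, q \is homog k /\
    bigO D x0 k.+1 (fun x => a pj.1 pj.2 x - ev x0 q x).
  move=> [p j]; have [q ? ?] := leading_form Dx0 (taylor_le kd (aT p j)) (abO p j).1.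
  by exists q.
have /choice[qb qbP] : forall pj, exists q, q \is homog k /\
    bigO D x0 k.+1 (fun x => b pj.1 pj.2 x - ev x0 q x).
  move=> [p j]; have [q ? ?] := leading_form Dx0 (taylor_le kd (bT p j)) (abO p j).2.
  by exists q.
have hreQ j l : hre j l = \sum_p (qa (p, j) * qa (p, l) + qb (p, j) * qb (p, l)).
  apply: (homog_sum_leading (k := k) Dx0 _ _ _ _ _ _ (fun x Dx => reE x j l Dx)).
  - by rewrite -dk.
  - by move=> p; split; [exact: (qaP (_, _)).1|exact: (qaP (_, _)).1|exact: (qbP (_, _)).1|exact: (qbP (_, _)).1].
  - by move=> p; exact: (qaP (_, _)).2.
  - by move=> p; exact: (qaP (_, _)).2.
  - by move=> p; exact: (qbP (_, _)).2.
  - by move=> p; exact: (qbP (_, _)).2.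
have himQ j l : him j l = \sum_p (qa (p, j) * qb (p, l) + (- qb (p, j)) * qa (p, l)).
  apply: (homog_sum_leading (k := k) Dx0 _ _ _ _ _ _ (fun x Dx => imE x j l Dx)).
  - by rewrite -dk.
  - by move=> p; split; [exact: (qaP (_, _)).1|exact: (qbP (_, _)).1|rewrite rpredN; exact: (qbP (_, _)).1|exact: (qaP (_, _)).1].
  - by move=> p; exact: (qaP (_, _)).2.
  - by move=> p; exact: (qbP (_, _)).2.
  - move=> p; have := bigON (qbP (p, j)).2; apply: eq_bigO => x _.
    by rewrite /ev mevalN/= opprB opprK addrC.
  - by move=> p; exact: (qaP (_, _)).2.
exists N, (fun=> r), (fun i => \matrix_(s, j) (map_mpoly (real_complex R) (qa ((i, s), j))
   + mpolyC n (0 +i* 1) * map_mpoly (real_complex R) (qb ((i, s), j)))).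
apply/matrixP => j l; apply/eqP; rewrite -subr_eq0; apply/eqP/ceval_eq0 => y.
rewrite /ceval mevalB -/(ceval y _); apply/eqP; rewrite subr_eq0; apply/eqP.
have cQ (q : mpoly n R) : meval (fun j => (y 0 j)%:C) (map_mpoly (real_complex R) q) =
    (meval (fun j => y 0 j) q)%:C by exact: meval_map.
have cC (p : mpoly n K) : meval (fun j => (y 0 j)%:C) (map_mpoly (@conjc R) p) = conjc (ceval y p).
  by apply: meval_map => i; rewrite /= oppr0.
have -> : meval (fun j => (y 0 j)%:C) ((\sum_i adjmp (\matrix_(s, j) (map_mpoly (real_complex R) (qa ((i, s), j))
   + mpolyC n (0 +i* 1) * map_mpoly (real_complex R) (qb ((i, s), j))))
    *m \matrix_(s, j) (map_mpoly (real_complex R) (qa ((i, s), j))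
   + mpolyC n (0 +i* 1) * map_mpoly (real_complex R) (qb ((i, s), j)))) j l) =
  \sum_(p : 'I_N * 'I_r) conjc ((meval (fun j => y 0 j) (qa (p, j))) +i* (meval (fun j => y 0 j) (qb (p, j)))) *
     ((meval (fun j => y 0 j) (qa (p, l))) +i* (meval (fun j => y 0 j) (qb (p, l)))).
  have eQ q q' : meval (fun j => (y 0 j)%:C) (map_mpoly (real_complex R) q + mpolyC n (0 +i* 1) *
      map_mpoly (real_complex R) q') = meval (fun j => y 0 j) q +i* meval (fun j => y 0 j) q' :> K.
    apply: etrans (mevalD _ _ _) _; apply: etrans (congr2 +%R (cQ q) _) (complex_parts _ _).
    exact: etrans (mevalM _ _ _) (congr2 *%R (mevalC _ _) (cQ q')).
  pose F i s := conjc (meval (fun j => y 0 j) (qa (i, s, j)) +i* meval (fun j => y 0 j) (qb (i, s, j))) *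
     (meval (fun j => y 0 j) (qa (i, s, l)) +i* meval (fun j => y 0 j) (qb (i, s, l))).
  rewrite summxE rmorph_sum/= [RHS](eq_bigr (fun p => F p.1 p.2)) => [|[i s]//].
  rewrite -(pair_bigA _ F)/=.
  apply: eq_bigr => i _; rewrite mxE rmorph_sum/=; apply: eq_bigr => s _.
  rewrite !mxE mevalM cC /F; apply: congr2; [exact: (congr1 (@conjc R) (eQ _ _))|exact: eQ].
apply: complexP.
  rewrite Re_ceval -/(hre j l) hreQ Re_sum rmorph_sum/=; apply: eq_bigr => p _.
  by rewrite mevalD !mevalM; ring.
rewrite Im_ceval -/(him j l) himQ Im_sum rmorph_sum/=; apply: eq_bigr => p _.
by rewrite mevalD !mevalM mevalN; ring.
Qed.

End ComplexPolynomials.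

(** * The equations of a lift *)

(** A matrix of maximal rank with row space inside [P] spans [P], and its cokernel gives the
    equations. *)
Lemma subspace_equations (F : fieldType) N (P : set 'rV[F]_N) :
  P 0 -> (forall l x y, P x -> P y -> P (l *: x + y)) ->
  exists E : 'M[F]_N, forall y, P y <-> y *m E = 0.
Proof.
move=> P0 Pl; pose Q k := `[< exists A : 'M[F]_N, (forall u, P (u *m A)) /\ \rank A = k >].
have PD x y : P x -> P y -> P (x + y) by move=> Px Py; rewrite -[x]scale1r; exact: Pl.
have exQ : exists k, Q k.
  by exists 0%N; apply/asboolP; exists 0; rewrite mxrank0; split=> // u; rewrite mulmx0.
have QN k : Q k -> (k <= N)%N by move=> /asboolP[A [_ <-]]; exact: rank_leq_row.
case: (ex_maxnP exQ QN) => k /asboolP[A [PA rA]] kmax.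
exists (cokermx A) => y; split=> [Py|/eqP]; last by rewrite -submxE => /submxP[u ->].
apply/eqP; rewrite -submxE; have : (\rank (A + y)%MS <= \rank A)%N.
  rewrite rA; apply: kmax; apply/asboolP; exists (A + y)%MS; split=> // u.
  have /sub_addsmxP[[v w] ->] := submxMl u (A + y)%MS.
  apply: (PD) (PA _) _; rewrite [w]mx11_scalar mul_scalar_mx -[_ *: _]addr0.
  exact: Pl.
move=> rk; have : \rank A == \rank (A + y)%MS by rewrite eqn_leq rk mxrankS// addsmxSl.
by rewrite (mxrank_leqif_sup (addsmxSl A y)).2; apply: submx_trans (addsmxSr A y).
Qed.

Section PolynomialFunctions.
Context {R : rcfType}.
Implicit Types f g : seq R -> R.

Definition polyfun f : Prop := exists t : qe_rcf.term R, forall e, qe_rcf.eval e t = f e.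

Lemma polyfun_var i : polyfun (fun e => e`_i).
Proof. by exists (qe_rcf.Var _ i). Qed.
Lemma polyfun_cst c : polyfun (fun=> c).
Proof. by exists (qe_rcf.Const c). Qed.
Lemma polyfunD f g : polyfun f -> polyfun g -> polyfun (fun e => f e + g e).
Proof. by move=> [s sf] [t tg]; exists (qe_rcf.Add s t) => e /=; rewrite sf tg. Qed.
Lemma polyfunM f g : polyfun f -> polyfun g -> polyfun (fun e => f e * g e).
Proof. by move=> [s sf] [t tg]; exists (qe_rcf.Mul s t) => e /=; rewrite sf tg. Qed.
Lemma polyfunX f k : polyfun f -> polyfun (fun e => f e ^+ k).
Proof. by move=> [s sf]; exists (qe_rcf.Exp s k) => e /=; rewrite sf. Qed.
Lemma polyfunB f g : polyfun f -> polyfun g -> polyfun (fun e => f e - g e).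
Proof. by move=> [s sf] [t tg]; exists (qe_rcf.Add s (qe_rcf.Opp t)) => e /=; rewrite sf tg. Qed.
Lemma polyfun_sum (I : Type) (s : seq I) (F : I -> seq R -> R) :
  (forall i, polyfun (F i)) -> polyfun (fun e => \sum_(i <- s) F i e).
Proof.
move=> FP; elim: s => [|i s ih].
  by under eq_fun do rewrite big_nil; exact: polyfun_cst.
by under eq_fun do rewrite big_cons; exact: polyfunD.
Qed.

Lemma polyfun_meval n (p : mpoly n R) (v : 'I_n -> seq R -> R) :
  (forall j, polyfun (v j)) -> polyfun (fun e => meval (v^~ e) p).
Proof.
move=> vP; under eq_fun do rewrite mevalE; apply: polyfun_sum => k.
apply: polyfunM; first exact: polyfun_cst.
elim: (index_enum _) => [|j s ih].
  by under eq_fun do rewrite big_nil; exact: polyfun_cst.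
by under eq_fun do rewrite big_cons; apply: polyfunM => //; exact: polyfunX.
Qed.

End PolynomialFunctions.

(** * Complex matrices in real coordinates *)

Section Coding.
Context {R : realType}.
Local Notation K := R[i].

Definition mxcode r (x : 'M[K]_r) : 'rV[R]_(r * r + r * r) :=
  row_mx (mxvec (map_mx (@complex.Re R) x)) (mxvec (map_mx (@complex.Im R) x)).

Definition mxdecode r (y : seq R) : 'M[K]_r := \matrix_(i, j)
  (y`_(lshift (r * r) (mxvec_index i j)) +i* y`_(rshift (r * r) (mxvec_index i j))).

Lemma mxcodeK r (x : 'M[K]_r) : mxdecode r (coords (mxcode x)) = x.
Proof.
apply/matrixP => i j; rewrite mxE !nth_coords row_mxEl row_mxEr !mxvecE !mxE.
by case: (x i j).
Qed.

Lemma mxcode_inj r : injective (@mxcode r).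
Proof. by move=> x y xy; rewrite -[x]mxcodeK xy mxcodeK. Qed.

Lemma mxcodeZD r (l : R) (x y : 'M[K]_r) : mxcode (l%:C *: x + y) = l *: mxcode x + mxcode y.
Proof.
rewrite /mxcode scale_row_mx add_row_mx; congr row_mx.
  rewrite -linearZ -linearD; congr mxvec; apply/matrixP => i j; rewrite !mxE.
  by case: (x i j) (y i j) => [a b] [c e] /=; rewrite mul0r subr0.
rewrite -linearZ -linearD; congr mxvec; apply/matrixP => i j; rewrite !mxE.
by case: (x i j) (y i j) => [a b] [c e] /=; rewrite mul0r addr0.
Qed.

Lemma gram_polyfun r (w : 'I_r -> 'I_r -> seq R -> K) i j :
  (forall i j, polyfun (fun e => Re (w i j e)) /\ polyfun (fun e => Im (w i j e))) ->
  polyfun (fun e => Re (((\matrix_(i, j) w i j e)^t* *m \matrix_(i, j) w i j e) i j)) /\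
  polyfun (fun e => Im (((\matrix_(i, j) w i j e)^t* *m \matrix_(i, j) w i j e) i j)).
Proof.
move=> wP; split.
- under eq_fun do rewrite mxE Re_sum; apply: polyfun_sum => l.
  have := polyfunD (polyfunM (wP l i).1 (wP l j).1) (polyfunM (wP l i).2 (wP l j).2).
  congr polyfun; apply/funext => e; rewrite adjE !mxE.
  by case: (w l i e) (w l j e) => [a b] [c f] /=; rewrite mulNr opprK.
- under eq_fun do rewrite mxE Im_sum; apply: polyfun_sum => l.
  have := polyfunB (polyfunM (wP l i).1 (wP l j).2) (polyfunM (wP l i).2 (wP l j).1).
  congr polyfun; apply/funext => e; rewrite adjE !mxE.
  by case: (w l i e) (w l j e) => [a b] [c f] /=; rewrite mulNr.
Qed.

End Coding.

(** The pairs of x and pi z with gamma z = U x U^* form a subspace of a finite-dimensional space, so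
    linear equations replace the quantifier over [Z], which may have infinite dimension.
    Substituting w^* w for x makes the equations polynomial in the point and in [w]. *)
Lemma lift_equation (R : realType) (n m d r : nat) (q : 'I_m -> mpoly n R) (Z : lmodType R)
    (pi : {linear Z -> 'rV[R]_m}) (gamma : {linear Z -> 'Her[R]_d}) (U : 'M[R[i]]_(d, r)) :
  exists T : qe_rcf.term R, forall x y, qe_rcf.eval (coords x ++ y) T = 0 <->
    exists2 z, Her_mx (gamma z) = U *m ((mxdecode r y)^t* *m mxdecode r y) *m U^t* &
      pi z = qmap q x.
Proof.
pose P : set 'rV[R]_(r * r + r * r + m) := [set v | exists z x,
  Her_mx (gamma z) = U *m x *m U^t* /\ v = row_mx (mxcode x) (pi z)].
have [||E PE] := @subspace_equations R _ P.
- exists 0, 0; split.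
    rewrite mulmx0 mul0mx linear0; apply/matrixP => i j; rewrite [RHS]mxE.
    by rewrite /Her_mx mxE.
  have -> : mxcode (0 : 'M[R[i]]_r) = 0.
    have := mxcodeZD 1 (0 : 'M[R[i]]_r) 0; rewrite scaler0 addr0 scale1r => /eqP.
    by rewrite -subr_eq subrr eq_sym => /eqP.
  by rewrite linear0 row_mx0.
- move=> l v v' [z [x [zx ->]]] [z' [x' [zx' ->]]].
  exists (l *: z + z'), (l%:C *: x + x'); split.
    rewrite linearP; apply: (etrans (Her_mxD _ _)); rewrite mulmxDr mulmxDl -zx'; congr (_ + _).
    by apply: (etrans (Her_mxZ _ _)); rewrite -scalemxAr -scalemxAl -zx.
  by rewrite scale_row_mx add_row_mx mxcodeZD linearP.
pose w (e : seq R) : 'M[R[i]]_r := \matrix_(i, j)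
  (e`_(n + lshift (r * r) (mxvec_index i j)) +i* e`_(n + rshift (r * r) (mxvec_index i j))).
pose g e := row_mx (mxcode ((w e)^t* *m w e)) (\row_i meval (fun j : 'I_n => e`_j) (q i)).
have gP k : polyfun (fun e => g e 0 k).
  rewrite -(fintype.splitK k); case: (fintype.split k) => [k1|i] /=; last first.
    under eq_fun do rewrite row_mxEr mxE.
    by apply: polyfun_meval => j; exact: polyfun_var.
  have wP i j : polyfun (fun e => Re (((w e)^t* *m w e) i j)) /\
      polyfun (fun e => Im (((w e)^t* *m w e) i j)).
    by apply: gram_polyfun => {}i {}j; split; exact: polyfun_var.
  under eq_fun do rewrite row_mxEl.
  rewrite -(fintype.splitK k1); case: (fintype.split k1) => k2 /=; case/mxvec_indexP: k2 => i j.
    under eq_fun do rewrite row_mxEl mxvecE mxE.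
    exact: (wP i j).1.
  under eq_fun do rewrite row_mxEr mxvecE mxE.
  exact: (wP i j).2.
(* Over the reals a sum of squares merges all equations into one. *)
have [T TE] : polyfun (fun e => \sum_k ((g e *m E) 0 k) ^+ 2).
  apply: polyfun_sum => k; apply: polyfunX; under eq_fun do rewrite mxE.
  by apply: polyfun_sum => i; apply: polyfunM => //; exact: polyfun_cst.
exists T => x y; rewrite TE; set e := coords x ++ y.
have sx : size (coords x) = n by rewrite size_map size_enum_ord.
have wE : w e = mxdecode r y.
  by apply/matrixP => i j; rewrite !mxE !nth_cat sx !ltnNge !leq_addr/= !addKn.
have gE : g e = row_mx (mxcode ((mxdecode r y)^t* *m mxdecode r y)) (qmap q x).
  rewrite /g wE; congr row_mx; apply/rowP => i; rewrite !mxE; apply: meval_eq => j.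
  by rewrite nth_cat sx ltn_ord nth_coords.
clearbody g; clear gP TE wE.
have -> : (\sum_k ((g e *m E) 0 k) ^+ 2 = 0) <-> g e *m E = 0.
  split=> [/eqP|->]; last by rewrite big1// => k _; rewrite mxE expr0n.
  rewrite psumr_eq0 => [/allP h|k _]; last exact: sqr_ge0.
  apply/rowP => k; rewrite [RHS]mxE; apply/eqP; rewrite -sqrf_eq0.
  by have := h k (mem_index_enum _).
rewrite -PE gE; split=> [[z [x' [zE /eq_row_mx[]]]]|[z zE piz]].
  by move=> /mxcode_inj xE piz; exists z; rewrite ?xE.
by exists z, ((mxdecode r y)^t* *m mxdecode r y); rewrite piz.
Qed.

(** * Linear maps given by Hermitian coefficients *)

Section HermitianCombinations.
Context {R : realType} {m t : nat}.
Local Notation K := R[i].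

Definition herm_comb (A : 'I_m -> 'Her[R]_t) (v : 'rV[R]_m) : 'Her[R]_t :=
  \sum_i v 0 i *: A i.

Lemma herm_comb_linear A : linear (herm_comb A).
Proof.
move=> l u v; rewrite /herm_comb scaler_sumr -big_split/=; apply: eq_bigr => i _.
by rewrite !mxE scalerDl scalerA.
Qed.
HB.instance Definition _ A := GRing.isLinear.Build R 'rV[R]_m 'Her[R]_t *:%R
  (herm_comb A) (herm_comb_linear A).

Lemma psd_closed_cone n (f : 'rV[R]_n -> 'rV[R]_m) (phi : {linear 'rV[R]_m -> 'Her[R]_t}) :
  (forall a, psdmx (Her_mx (phi (f a)))) ->
  forall v, closure (conic_hull (range f)) v -> psdmx (Her_mx (phi v)).
Proof.
move=> fpsd v Cv; apply/psdmxE; split=> [|x]; first exact: Her_mxK.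
pose g (y : 'rV[R]_m) := Re ((x^t* *m Her_mx (phi y) *m x) 0 0).
have gD u y : g (u + y) = g u + g y.
  rewrite /g linearD; have -> := Her_mxD (phi u) (phi y).
  by rewrite mulmxDr mulmxDl mxE raddfD.
have gZ l y : g (l *: y) = l * g y.
  rewrite /g linearZ; have -> := Her_mxZ l (phi y).
  by rewrite -scalemxAr -scalemxAl mxE mulrC ReM_real mulrC.
have := flc_closed_ge0 gD gZ; rewrite -openC flc_open_rVE openC => /closure_id gcl.
suff : [set y | 0 <= g y] v by [].
rewrite gcl; apply: closure_subset Cv => y [k [l [p [l0 pf ->]]]] /=.
have g0 : g 0 = 0 by rewrite -(scale0r (0 : 'rV[R]_m)) gZ mul0r.
rewrite (big_morph g gD g0); apply: sumr_ge0 => i _; rewrite gZ mulr_ge0//.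
have [a _ <-] := pf i; exact: ((psdmxE _).1 (fpsd a)).2.
Qed.

End HermitianCombinations.

Lemma evalmp_translate (R : realType) n r t (u a : 'rV[R]_n) (P : 'M[mpoly n R[i]]_(r, t)) :
  evalmp a (translatemp u P) = evalmp (a - u) P.
Proof.
apply/matrixP => j k; rewrite !mxE comp_mpoly_meval; apply: meval_eq => i.
by rewrite tnth_mktuple mevalB mevalXU mevalC !mxE rmorphB.
Qed.

Lemma span_comb (R : realType) n m t (q : 'I_m -> mpoly n R) (P : 'M[mpoly n R[i]]_t) :
  mxpoly_span q P ->
  exists phi : {linear 'rV[R]_m -> 'Her[R]_t}, forall a, Her_mx (phi (qmap q a)) = evalmp a P.
Proof.
move=> [A ->]; exists (herm_comb A) => a; rewrite [LHS]Her_mx_sum.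
apply/matrixP => j k; rewrite [RHS]mxE !summxE raddf_sum/=; apply: eq_bigr => i _.
apply: (etrans (congr1 (fun M : 'M[R[i]]_t => M j k) (Her_mxZ _ _))).
rewrite !mxE mevalZ mulrC; congr (_ * _); apply: esym.
by apply: meval_map => l.
Qed.

Theorem corollary4p3 (R : realType) (n m : nat) (q : 'I_m -> mpoly n R)
    (C : set 'rV[R]_m) :
  C = closure (conic_hull (range (qmap q))) ->
  proper_cone C ->
  (exists t : nat, (0 < t)%N /\
     exists H : 'M[mpoly n R[i]]_t,
       [/\ mxpoly_span q H,
           homogeneous_mp H,
           (forall a : 'rV[R]_n, psdmx (evalmp a H)),
           ~ sos_mp H
         & forall u : 'rV[R]_n, mxpoly_span q (translatemp u H)]) ->
  forall d : nat, (0 < d)%N ->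
    ~ has_lift (min_operator_system C) (@psd_system R d).
Proof.
move=> CE Cproper [t [t0 [H [Hq [d0 Hd0] Hpsd Hsos Hu]]]] d _ [Z [pi [gamma lift]]].
apply: Hsos.
have [r [U [z1 [z1E face]]]] := lift_face gamma.
have [T TE] := lift_equation q pi gamma U.
have solv (x : 'rV[R]_n) : exists2 y, size y = (r * r + r * r)%N & qe_rcf.eval (coords x ++ y) T = 0.
  have Cx : C (qmap q x).
    rewrite CE; apply: subset_closure; exists 1%N, (fun=> 1), (fun=> qmap q x).
    by split=> //; rewrite big_ord1 scale1r.
  have [z [zx zpsd]] := lift_points lift Cx.
  have [y ypsd zE] := face z zpsd.
  have [w yE] := psd_factor ypsd.
  exists (coords (mxcode w)); first by rewrite size_map size_enum_ord.
  by apply/TE; exists z; rewrite // mxcodeK -yE.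
(* Taylor order [d0], the degree of [H], is enough; the selection is made before any translate of
   [H] enters. *)
have [D [y [nD Dy yT]]] := nash_selection d0 solv.
have [x0 [Dx0 nDx0]] := nonmeager_somewhere_dense nD.
(* From here on u is [x0], and [phi] maps q(a) to H(a - x0). *)
have [phi phiE] := span_comb (Hu x0).
have phi_psd v : C v -> psdmx (Her_mx (phi v)).
  rewrite CE; apply: psd_closed_cone => a; rewrite phiE evalmp_translate.
  exact: (Hpsd (a - x0)).
have [N [V VE]] := cp_representation Cproper lift z1E t0 phi_psd.
apply: (sos_of_taylor (d := d0) (D := D) (x0 := x0) (w := fun x => mxdecode r (y x)) (V := V)).
- exact: Hd0.
- exact: Hpsd.
- exact: nDx0.
- move=> x Dx; have [z zE zx] := (TE x (y x)).1 (Dy x Dx).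
  rewrite -evalmp_translate -phiE -zx.
  have -> := VE z _ ((psdmxE _).1 (psd_gram (mxdecode r (y x)))).1 zE.
  by apply: eq_bigr => l _; rewrite adjM !mulmxA.
- by move=> i j; have := yT x0 (lshift (r * r) (mxvec_index i j)) Dx0;
    congr taylor; apply/funext => x; rewrite mxE.
- by move=> i j; have := yT x0 (rshift (r * r) (mxvec_index i j)) Dx0;
    congr taylor; apply/funext => x; rewrite mxE.
Qed.
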